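(* Let $(T,\mu,\eta)$ be a vertical double monad on a monoidal double category $(\mathbb D,\otimes,\alpha,\lambda,\rho)$. Let $t$ be a left (respectively right) vertical strength on $T$, and assume that the following transformations are invertible and liftable: the strength $t$; $\alpha,\lambda,\rho$ of $\mathbb D$; and $\mu,\eta$ of $T$. Then $\hat t$ is a left (respectively right) horizontal strength on the horizontal double monad $\hat T$ on the horizontally monoidal double category $(\mathbb D,\otimes,\hat\alpha,\hat\lambda,\hat\rho)$. Moreover, $\mathcal H(\hat t)$ is a left (respectively right) strength on the pseudomonad $\mathcal H(\hat T)$ on the monoidal bicategory $\mathcal H(\mathbb D)$.
   Context: Double categories are strict: objects, 1h-cells (horizontal), 1v-cells (vertical), squares (2-cells). $[a|b|\cdots]$: horizontal composition (left to right), also for 1h-cells; $a/b$: vertical composition ($a$ on top), also for 1v-cells and transformations. $\mathcal H(\mathbb D)$: 2-category of objects, 1h-cells and horizontally globular 2-cells (vertical sides identities). Pseudodouble functors preserve vertical structure strictly and horizontal composition up to coherent natural invertible compositors/unitors. A horizontal pseudonatural transformation $\alpha:F\Rightarrow G$ has 1h-components $\alpha(A)$, squares $\alpha^u$ (top $\alpha(A)$, bottom $\alpha(\tilde A)$, left $F(u)$, right $G(u)$) and invertible horizontally globular 2-cells $\delta_{\alpha,f}:\alpha(B)F(f)\Rightarrow G(f)\alpha(A)$, coherent and natural; horizontal equivalence: all $\alpha(A)$ equivalences in $\mathcal H$. Horizontal modification: horizontally globular 2-cells $\alpha(A)\Rightarrow\beta(A)$ compatible with all structure cells. A vertical strict transformation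 has 1v-components $\alpha(A)$ natural in 1v-cells and squares $\alpha_f$ (top $F(f)$, bottom $G(f)$, left $\alpha(A)$, right $\alpha(B)$) compatible with compositors, unitors, 2-cells; invertible if all $\alpha_f$ are vertically invertible. Companion of $u:A\to B$ (vertical): 1h-cell $\hat u:A\to B$ with 2-cells $\varepsilon_u$ (top $\hat u$, left $u$, other sides identities), $\iota_u$ (bottom $\hat u$, right $u$, other sides identities), $[\iota_u|\varepsilon_u]=\mathrm{Id}$, $\iota_u/\varepsilon_u=\mathrm{Id}$. Liftable vertical transformation: all 1v-components have companions. Companion-lift $\hat\alpha$ of an invertible liftable vertical strict $\alpha$: the horizontal equivalence with components $\hat\alpha(A)$, $[\iota_{\alpha(A)}|\alpha_f|\varepsilon_{\alpha(B)}]$, $[\mathrm{Id}^{F(u)}/\iota_{\alpha(\tilde A)}|\varepsilon_{\alpha(A)}/\mathrm{Id}^{G(u)}]$. For an identity vertically globular 2-cell with left side $u$ and right side $v$ the lift is $[\iota_u|\mathrm{Id}|\varepsilon_v]:\hat v\Rightarrow\hat u$. Monoidal double category: pseudodouble functors $\otimes,I$ and invertible vertical strict $\alpha:(AB)C\to A(BC)$, $\lambda:IA\to A$, $\rho:AI\to A$ satisfying pentagon and unit triangles strictly ($AB$ means $A\otimes B$). Horizontally monoidal: the same with horizontal equivalences $\alpha,\lambda,\rho$ and invertible horizontal modifications $p$ (pentagon), $m,l,r$ (middle, left, right unit triangles) satisfying the axioms of a monoidal bicategory (one-object tricategory, Gordon–Power–Street). If $\alpha,\lambda,\rho$ of a monoidal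 $\mathbb D$ are liftable, then $(\mathbb D,\otimes,\hat\alpha,\hat\lambda,\hat\rho)$, with the lifts of the identity modifications, is horizontally monoidal, and $\mathcal H(\mathbb D)$ is a monoidal bicategory. Vertical double monad: pseudodouble functor $T:\mathbb D\to\mathbb D$ with vertical strict $\mu:TT\Rightarrow T$, $\eta:\mathrm{Id}\Rightarrow T$ satisfying the monad laws strictly. Horizontal double monad: $\mu,\eta$ horizontal pseudonatural, with invertible horizontal modifications $a^T:[T\mu_A|\mu_A]\Rightarrow[\mu_{TA}|\mu_A]$, $r^T:[\eta_{TA}|\mu_A]\Rightarrow1$, $l^T:[T\eta_A|\mu_A]\Rightarrow1$ satisfying the two pseudomonad axioms. If $\mu,\eta$ of a vertical double monad $T$ are invertible and liftable, $\hat T=(T,\hat\mu,\hat\eta)$ is a horizontal double monad and $\mathcal H(\hat T)$ a pseudomonad. Left vertical strength on $T$: vertical strict transformation $t_{A,B}:A\otimes T(B)\to T(A\otimes B)$ with $\lambda_{T(A)}=t_{I,A}/T\lambda_A$, $\alpha_{A,B,T(C)}/(A\,t_{B,C})/t_{A,BC}=t_{AB,C}/T(\alpha_{A,B,C})$, $(A\mu_B)/t_{A,B}=t_{A,T(B)}/T(t_{A,B})/\mu_{AB}$, $\eta_{AB}=(A\eta_B)/t_{A,B}$ (as identity vertical modifications). Right vertical strength: $s_{A,B}:T(A)\otimes B\to T(A\otimes B)$ with the mirror equations. Left horizontal strength on a horizontal double monad $T$ on a horizontally monoidal $\mathbb D$: a horizontal pseudonatural transformation $t_{A,B}:A\otimes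 T(B)\to T(A\otimes B)$ and invertible horizontal modifications $x_A:[t_{I,A}|T\lambda_A]\Rightarrow\lambda_{T(A)}$, $y_{A,B,C}:[t_{AB,C}|T(\alpha_{A,B,C})]\Rightarrow[\alpha_{A,B,T(C)}|A\,t_{B,C}|t_{A,BC}]$, $w_{A,B}:[t_{A,T(B)}|T(t_{A,B})|\mu_{AB}]\Rightarrow[A\mu_B|t_{A,B}]$, $z_{A,B}:[A\eta_B|t_{A,B}]\Rightarrow\eta_{AB}$, satisfying the ten coherence axioms of a strength for a pseudomonad (Paquet–Saville): in each case the two evident pasted 2-cells between the indicated composites agree: three relating $x,y$ to the monoidal structure [with $m$, on $(AI)T(B)$, from $[t_{AI,B}|T\alpha|T(A\lambda_B)]$ to $[\rho_AT(B)|t_{A,B}]$; with $l$, on $(IA)T(B)$, from $[t_{IA,B}|T(\lambda_AB)]$ to composites ending in $t_{A,B}$ after the left unit; with $p$, on $((AB)C)T(D)$ to $T(A(B(CD)))$]; three relating $w,z$ to $l^T,r^T,a^T$ [on $A\,T(B)$ starting with $A\,T(\eta_B)$ resp. $A\,\eta_{T(B)}$, and on $A\,T^3(B)$]; two relating $z$ resp. $w$ to $x$ [on $I\,B$, resp. $I\,T^2(B)$]; two relating $z$ resp. $w$ to $y$ [on $(AB)C$, resp. $(AB)T^2(C)$, to $T(A(BC))$]. Right strengths are mirror images. A strength on a pseudomonad on a monoidal bicategory is the same data and axioms in the bicategory (pseudonatural transformation and modifications). In the theorem, $\hat t$ carries the modifications $\hat x,\hat y,\hat w,\hat z$ lifted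 from the identity vertical modifications.
   Formalization: That (D,⊗,α̂,λ̂,ρ̂) is horizontally monoidal and H(D) a monoidal bicategory is stated assuming that α̂,λ̂,ρ̂ are horizontal equivalences, which does not follow from invertible and liftable alone; the strength and monad claims need no such assumption. *)

(* Defs.v *)
From Stdlib Require Import Eqdep.

Set Implicit Arguments.
Unset Strict Implicit.
Unset Printing Implicit Defensive.
Set Primitive Projections.

(** Composition of 1-cells is written in diagrammatic order: [f · g] is the
    composite of [f : A -> B] and [g : B -> C], as in [[f|g]]. *)

(* The operations on 1-cells and the 2-cell types are kept apart from the other
   operations so that the data of a pseudofunctor or of a transformation on a
   product depends on as little as possible. *)
Record PreTwo : Type := {
  ob :> Type;
  hom : ob -> ob -> Type;
  two : forall A B, hom A B -> hom A B -> Type;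
  i1 : forall A, hom A A;
  c1 : forall A B C, hom A B -> hom B C -> hom A C }.

Arguments i1 {p} A.
Arguments c1 {p A B C} f g.

Declare Scope cell_scope.
Delimit Scope cell_scope with cell.
Open Scope cell_scope.

Notation "f ⇒ g" := (two f g) (at level 70, no associativity) : cell_scope.
Notation "f · g" := (c1 f g) (at level 40, left associativity) : cell_scope.

Record TwoOps : Type := {
  pre2 :> PreTwo;
  c1A : forall (A B C D : pre2) (f : hom A B) (g : hom B C) (h : hom C D),
      (f · g) · h = f · (g · h);
  c1l : forall (A B : pre2) (f : hom A B), i1 A · f = f;
  c1r : forall (A B : pre2) (f : hom A B), f · i1 B = f;
  i2 : forall (A B : pre2) (f : hom A B), f ⇒ f;
  v2 : forall (A B : pre2) (f g h : hom A B), f ⇒ g -> g ⇒ h -> f ⇒ h;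
  h2 : forall (A B C : pre2) (f f' : hom A B) (g g' : hom B C),
      f ⇒ f' -> g ⇒ g' -> f · g ⇒ f' · g' }.

Arguments i2 {t A B} f.
Arguments v2 {t A B f g h} s s'.
Arguments h2 {t A B C f f' g g'} s s'.

Notation "f ◁ s" := (h2 (i2 f) s) (at level 42, right associativity) : cell_scope.
Notation "s ▷ f" := (h2 s (i2 f)) (at level 41, left associativity) : cell_scope.

(** 1-cells compose strictly, so 2-cells are compared and composed up to
    equality of their boundary 1-cells. *)

Definition cast2 {X : PreTwo} {A B : X} {f f' g g' : hom A B}
  (e : f = f') (e' : g = g') (s : f ⇒ g) : f' ⇒ g' :=
  match e in _ = f1, e' in _ = g1 return f1 ⇒ g1 with
  | eq_refl, eq_refl => s
  end.

Definition eq2 {X : PreTwo} {A B : X} {f g f' g' : hom A B}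
  (s : f ⇒ g) (s' : f' ⇒ g') : Prop :=
  exists (e : f = f') (e' : g = g'), cast2 e e' s = s'.

Notation "s ≈ s'" := (eq2 s s') (at level 70, no associativity) : cell_scope.

(* Equality of two bracketings, found by instance resolution. *)
Class Strict {X : Type} (x y : X) : Prop := strict : x = y.
Arguments strict {X x y Strict}.

Ltac solve_strict :=
  red; cbn;
  repeat first [ rewrite c1A | rewrite c1l | rewrite c1r ]; reflexivity.

#[export] Hint Extern 1 (Strict _ _) => solve_strict : typeclass_instances.

Definition as2 {X : PreTwo} {A B : X} {f g f' g' : hom A B} (s : f ⇒ g)
  {e : Strict f f'} {e' : Strict g g'} : f' ⇒ g' := cast2 strict strict s.

Definition glue {X : TwoOps} {A B : X} {f g g' h : hom A B}
  (s : f ⇒ g) (s' : g' ⇒ h) {e : Strict g' g} : f ⇒ h :=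
  v2 s (cast2 strict eq_refl s').

(** [s ;; s'] is [s] followed by [s']: the vertical composite [s/s']. *)
Notation "s ;; s'" := (glue s s') (at level 50, left associativity) : cell_scope.

Record is_two_category (X : TwoOps) : Prop := {
  v2A : forall (A B : X) (f g h k : hom A B) (s : f ⇒ g) (t : g ⇒ h) (u : h ⇒ k),
      v2 (v2 s t) u = v2 s (v2 t u);
  v2l : forall (A B : X) (f g : hom A B) (s : f ⇒ g), v2 (i2 f) s = s;
  v2r : forall (A B : X) (f g : hom A B) (s : f ⇒ g), v2 s (i2 g) = s;
  h2v2 : forall (A B C : X) (f f' f'' : hom A B) (g g' g'' : hom B C)
      (s : f ⇒ f') (s' : f' ⇒ f'') (t : g ⇒ g') (t' : g' ⇒ g''),
      h2 (v2 s s') (v2 t t') = v2 (h2 s t) (h2 s' t');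
  h2i2 : forall (A B C : X) (f : hom A B) (g : hom B C),
      h2 (i2 f) (i2 g) = i2 (f · g);
  h2A : forall (A B C D : X) (f f' : hom A B) (g g' : hom B C) (h h' : hom C D)
      (s : f ⇒ f') (t : g ⇒ g') (u : h ⇒ h'),
      h2 (h2 s t) u ≈ h2 s (h2 t u);
  h2l : forall (A B : X) (f g : hom A B) (s : f ⇒ g), h2 (i2 (i1 A)) s ≈ s;
  h2r : forall (A B : X) (f g : hom A B) (s : f ⇒ g), h2 s (i2 (i1 B)) ≈ s }.

Definition inverse2 {X : TwoOps} {A B : X} {f g : hom A B}
  (s : f ⇒ g) (s' : g ⇒ f) : Prop := v2 s s' = i2 f /\ v2 s' s = i2 g.

Definition invertible2 {X : TwoOps} {A B : X} {f g : hom A B} (s : f ⇒ g) : Prop :=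
  exists s' : g ⇒ f, inverse2 s s'.

Definition is_equivalence {X : TwoOps} {A B : X} (f : hom A B) : Prop :=
  exists (g : hom B A) (s : i1 A ⇒ f · g) (t : g · f ⇒ i1 B),
    invertible2 s /\ invertible2 t.

Definition prod_pre (X Y : PreTwo) : PreTwo := {|
  ob := (X * Y)%type;
  hom A B := (hom (fst A) (fst B) * hom (snd A) (snd B))%type;
  two A B f g := ((fst f ⇒ fst g) * (snd f ⇒ snd g))%type;
  i1 A := (i1 (fst A), i1 (snd A));
  c1 A B C f g := (fst f · fst g, snd f · snd g) |}.

Definition one_pre : PreTwo := {|
  ob := unit;
  hom _ _ := unit;
  two _ _ _ _ := unit;
  i1 _ := tt;
  c1 _ _ _ _ _ := tt |}.

Definition prod_two (X Y : TwoOps) : TwoOps.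
Proof.
  refine {|
    pre2 := prod_pre X Y;
    i2 A B f := (i2 (fst f), i2 (snd f));
    v2 A B f g h s t := (v2 (fst s) (fst t), v2 (snd s) (snd t));
    h2 A B C f f' g g' s t := (h2 (fst s) (fst t), h2 (snd s) (snd t)) |}.
  - intros; cbn; f_equal; apply c1A.
  - intros A B [f f']; cbn; f_equal; apply c1l.
  - intros A B [f f']; cbn; f_equal; apply c1r.
Defined.

Definition one_two : TwoOps.
Proof.
  refine {|
    pre2 := one_pre;
    i2 _ _ _ := tt;
    v2 _ _ _ _ _ _ _ := tt;
    h2 _ _ _ _ _ _ _ _ _ := tt |}.
  - reflexivity.
  - intros A B []; reflexivity.
  - intros A B []; reflexivity.
Defined.

Record Map (X Y : PreTwo) : Type := {
  m0 :> X -> Y;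
  m1 : forall A B, hom A B -> hom (m0 A) (m0 B) }.

Arguments m1 {X Y} m {A B} f.

Definition id_map X : Map X X := {| m0 A := A; m1 A B f := f |}.
Definition comp_map X Y Z (G : Map Y Z) (F : Map X Y) : Map X Z :=
  {| m0 A := G (F A); m1 A B f := m1 G (m1 F f) |}.
Definition pair_map X Y Z (F : Map X Y) (G : Map X Z) : Map X (prod_pre Y Z) :=
  {| m0 A := (F A, G A) : prod_pre Y Z; m1 A B f := (m1 F f, m1 G f) |}.
Definition fst_map X Y : Map (prod_pre X Y) X :=
  {| m0 (A : prod_pre X Y) := fst A; m1 A B f := fst f |}.
Definition snd_map X Y : Map (prod_pre X Y) Y :=
  {| m0 (A : prod_pre X Y) := snd A; m1 A B f := snd f |}.
Definition one_map X : Map X one_pre :=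
  {| m0 A := tt : one_pre; m1 A B f := tt |}.

(** [ph], [ph0] are the compositors and unitors, [phi], [ph0i] their inverses. *)
Record PsFun (X Y : PreTwo) : Type := {
  pmap :> Map X Y;
  f2 : forall (A B : X) (f g : hom A B), f ⇒ g -> m1 pmap f ⇒ m1 pmap g;
  ph : forall (A B C : X) (f : hom A B) (g : hom B C),
      m1 pmap f · m1 pmap g ⇒ m1 pmap (f · g);
  phi : forall (A B C : X) (f : hom A B) (g : hom B C),
      m1 pmap (f · g) ⇒ m1 pmap f · m1 pmap g;
  ph0 : forall A : X, i1 (pmap A) ⇒ m1 pmap (i1 A);
  ph0i : forall A : X, m1 pmap (i1 A) ⇒ i1 (pmap A) }.

Arguments f2 {X Y} p {A B f g} s.
Arguments ph {X Y} p {A B C} f g.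
Arguments phi {X Y} p {A B C} f g.
Arguments ph0 {X Y} p A.
Arguments ph0i {X Y} p A.

Record is_psfun (X Y : TwoOps) (F : PsFun X Y) : Prop := {
  f2_i2 : forall (A B : X) (f : hom A B), f2 F (i2 f) = i2 (m1 F f);
  f2_v2 : forall (A B : X) (f g h : hom A B) (s : f ⇒ g) (t : g ⇒ h),
      f2 F (v2 s t) = v2 (f2 F s) (f2 F t);
  ph_nat : forall (A B C : X) (f f' : hom A B) (g g' : hom B C)
      (s : f ⇒ f') (t : g ⇒ g'),
      v2 (h2 (f2 F s) (f2 F t)) (ph F f' g') = v2 (ph F f g) (f2 F (h2 s t));
  ph_inv : forall (A B C : X) (f : hom A B) (g : hom B C),
      inverse2 (ph F f g) (phi F f g);
  ph0_inv : forall A : X, inverse2 (ph0 F A) (ph0i F A);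
  ph_assoc : forall (A B C D : X) (f : hom A B) (g : hom B C) (h : hom C D),
      (ph F f g ▷ m1 F h) ;; ph F (f · g) h
      ≈ (m1 F f ◁ ph F g h) ;; ph F f (g · h);
  ph_unitl : forall (A B : X) (f : hom A B),
      (ph0 F A ▷ m1 F f) ;; ph F (i1 A) f ≈ i2 (m1 F f);
  ph_unitr : forall (A B : X) (f : hom A B),
      (m1 F f ◁ ph0 F B) ;; ph F f (i1 B) ≈ i2 (m1 F f) }.

Definition id_fun (X : TwoOps) : PsFun X X := {|
  pmap := id_map X;
  f2 A B f g s := s;
  ph A B C f g := i2 (f · g);
  phi A B C f g := i2 (f · g);
  ph0 A := i2 (i1 A);
  ph0i A := i2 (i1 A) |}.

Definition comp_fun (X Y : PreTwo) (Z : TwoOps) (G : PsFun Y Z) (F : PsFun X Y) :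
  PsFun X Z := {|
  pmap := comp_map G F;
  f2 A B f g s := f2 G (f2 F s);
  ph A B C f g := v2 (ph G (m1 F f) (m1 F g)) (f2 G (ph F f g));
  phi A B C f g := v2 (f2 G (phi F f g)) (phi G (m1 F f) (m1 F g));
  ph0 A := v2 (ph0 G (F A)) (f2 G (ph0 F A));
  ph0i A := v2 (f2 G (ph0i F A)) (ph0i G (F A)) |}.

Definition pair_fun (X Y Z : PreTwo) (F : PsFun X Y) (G : PsFun X Z) :
  PsFun X (prod_pre Y Z) := {|
  pmap := pair_map F G;
  f2 A B f g s := (f2 F s, f2 G s);
  ph A B C f g := (ph F f g, ph G f g);
  phi A B C f g := (phi F f g, phi G f g);
  ph0 A := (ph0 F A, ph0 G A);
  ph0i A := (ph0i F A, ph0i G A) |}.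

Definition fst_fun (X : TwoOps) (Y : PreTwo) : PsFun (prod_pre X Y) X := {|
  pmap := fst_map X Y;
  f2 A B f g s := fst s;
  ph A B C f g := i2 (fst f · fst g);
  phi A B C f g := i2 (fst f · fst g);
  ph0 A := i2 (i1 (fst A));
  ph0i A := i2 (i1 (fst A)) |}.

Definition snd_fun (X : PreTwo) (Y : TwoOps) : PsFun (prod_pre X Y) Y := {|
  pmap := snd_map X Y;
  f2 A B f g s := snd s;
  ph A B C f g := i2 (snd f · snd g);
  phi A B C f g := i2 (snd f · snd g);
  ph0 A := i2 (i1 (snd A));
  ph0i A := i2 (i1 (snd A)) |}.

Definition one_fun (X : PreTwo) : PsFun X one_pre := {|
  pmap := one_map X;
  f2 A B f g s := tt;
  ph A B C f g := tt;
  phi A B C f g := tt;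
  ph0 A := tt;
  ph0i A := tt |}.

(** [nd] is the pseudonaturality 2-cell, [ndi] its inverse. *)
Record PsNat (X Y : PreTwo) (F G : Map X Y) : Type := {
  nc :> forall A : X, hom (F A) (G A);
  nd : forall (A B : X) (f : hom A B), m1 F f · nc B ⇒ nc A · m1 G f;
  ndi : forall (A B : X) (f : hom A B), nc A · m1 G f ⇒ m1 F f · nc B }.

Arguments nc {X Y F G} p A.
Arguments nd {X Y F G} p {A B} f.
Arguments ndi {X Y F G} p {A B} f.

Record is_psnat (X Y : TwoOps) (F G : PsFun X Y) (α : PsNat F G) : Prop := {
  nd_inv : forall (A B : X) (f : hom A B), inverse2 (nd α f) (ndi α f);
  nd_nat : forall (A B : X) (f g : hom A B) (s : f ⇒ g),
      (f2 F s ▷ α B) ;; nd α g ≈ nd α f ;; (α A ◁ f2 G s);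
  nd_comp : forall (A B C : X) (f : hom A B) (g : hom B C),
      (ph F f g ▷ α C) ;; nd α (f · g)
      ≈ (m1 F f ◁ nd α g) ;; (nd α f ▷ m1 G g) ;; (α A ◁ ph G f g);
  nd_unit : forall A : X,
      (ph0 F A ▷ α A) ;; nd α (i1 A) ≈ α A ◁ ph0 G A }.

Definition comp_nat (X : PreTwo) (Y : TwoOps) (F G H : Map X Y)
  (α : PsNat F G) (β : PsNat G H) : PsNat F H := {|
  nc A := α A · β A;
  nd A B f := as2 ((nd α f ▷ β B) ;; (α A ◁ nd β f));
  ndi A B f := as2 ((α A ◁ ndi β f) ;; (ndi α f ▷ β B)) |}.

Definition id_nat (X : PreTwo) (Y : TwoOps) (F : Map X Y) : PsNat F F := {|
  nc A := i1 (F A);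
  nd A B f := as2 (i2 (m1 F f));
  ndi A B f := as2 (i2 (m1 F f)) |}.

(** [post_nat T α] is [Tα], [pre_nat α K] is [α_K] *)

Definition post_nat (X Y : PreTwo) (Z : TwoOps) (T : PsFun Y Z) (F G : Map X Y)
  (α : PsNat F G) : PsNat (comp_map T F) (comp_map T G) :=
  @Build_PsNat X Z (comp_map T F) (comp_map T G)
    (fun A => m1 T (α A))
    (fun A B f => ph T (m1 F f) (α B) ;; f2 T (nd α f) ;; phi T (α A) (m1 G f))
    (fun A B f => ph T (α A) (m1 G f) ;; f2 T (ndi α f) ;; phi T (m1 F f) (α B)).

Definition pre_nat (X Y Z : PreTwo) (F G : Map Y Z) (α : PsNat F G) (K : Map X Y) :
  PsNat (comp_map F K) (comp_map G K) :=
  @Build_PsNat X Z (comp_map F K) (comp_map G K)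
    (fun A => α (K A))
    (fun A B f => nd α (m1 K f))
    (fun A B f => ndi α (m1 K f)).

Definition pair_nat (X Y Z : PreTwo) (F G : Map X Y) (F' G' : Map X Z)
  (α : PsNat F G) (β : PsNat F' G') : PsNat (pair_map F F') (pair_map G G') :=
  @Build_PsNat X (prod_pre Y Z) (pair_map F F') (pair_map G G')
    (fun A => (α A, β A))
    (fun A B f => (nd α f, nd β f))
    (fun A B f => (ndi α f, ndi β f)).

Definition Cells (X Y : PreTwo) (F G : Map X Y) (α β : PsNat F G) : Type :=
  forall A : X, α A ⇒ β A.

Definition is_modification (X : PreTwo) (Y : TwoOps) (F G : Map X Y)
  (α β : PsNat F G) (γ : Cells α β) : Prop :=
  forall (A B : X) (f : hom A B),
    (m1 F f ◁ γ B) ;; nd β f ≈ nd α f ;; (γ A ▷ m1 G f).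

Definition all_invertible (X : PreTwo) (Y : TwoOps) (F G : Map X Y)
  (α β : PsNat F G) (γ : Cells α β) : Prop :=
  forall A : X, invertible2 (γ A).

(** [imij F s] is [F s] conjugated by the compositors of [F], for a 2-cell [s] from
    a composite of [i] to a composite of [j] 1-cells. *)
Section Image.
Context {X Y : TwoOps} (F : PsFun X Y).

Definition ph3 {A B C D : X} (f : hom A B) (g : hom B C) (h : hom C D) :
  m1 F f · m1 F g · m1 F h ⇒ m1 F (f · g · h) :=
  (ph F f g ▷ m1 F h) ;; ph F (f · g) h.

Definition phi3 {A B C D : X} (f : hom A B) (g : hom B C) (h : hom C D) :
  m1 F (f · g · h) ⇒ m1 F f · m1 F g · m1 F h :=
  phi F (f · g) h ;; (phi F f g ▷ m1 F h).

Definition im20 {A B : X} {f : hom A B} {g : hom B A} (s : f · g ⇒ i1 A) :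
  m1 F f · m1 F g ⇒ i1 (F A) := ph F f g ;; f2 F s ;; ph0i F A.

Definition im21 {A B C : X} {f : hom A B} {g : hom B C} {h : hom A C}
  (s : f · g ⇒ h) : m1 F f · m1 F g ⇒ m1 F h := ph F f g ;; f2 F s.

Definition im12 {A B C : X} {f : hom A B} {g : hom B C} {h : hom A C}
  (s : h ⇒ f · g) : m1 F h ⇒ m1 F f · m1 F g := f2 F s ;; phi F f g.

Definition im22 {A B B' C : X} {f : hom A B} {g : hom B C} {f' : hom A B'}
  {g' : hom B' C} (s : f · g ⇒ f' · g') :
  m1 F f · m1 F g ⇒ m1 F f' · m1 F g' := ph F f g ;; f2 F s ;; phi F f' g'.

Definition im23 {A B B' C' C : X} {f : hom A B} {g : hom B C} {f' : hom A B'}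
  {g' : hom B' C'} {h' : hom C' C} (s : f · g ⇒ f' · g' · h') :
  m1 F f · m1 F g ⇒ m1 F f' · m1 F g' · m1 F h' :=
  ph F f g ;; f2 F s ;; phi3 f' g' h'.

Definition im32 {A B B' C' C : X} {f : hom A B} {g : hom B C} {f' : hom A B'}
  {g' : hom B' C'} {h' : hom C' C} (s : f' · g' · h' ⇒ f · g) :
  m1 F f' · m1 F g' · m1 F h' ⇒ m1 F f · m1 F g :=
  ph3 f' g' h' ;; f2 F s ;; phi F f g.
End Image.

Notation "X '²'" := (prod_pre X X) (at level 2, format "X '²'") : cell_scope.
Notation "X '³'" := (prod_pre (prod_pre X X) X)
  (at level 2, format "X '³'") : cell_scope.
Notation "X '⁴'" := (prod_pre (prod_pre (prod_pre X X) X) X)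
  (at level 2, format "X '⁴'") : cell_scope.

Section Variables.
Context {X : PreTwo}.
Definition v1_2 : Map X² X := fst_map X X.
Definition v2_2 : Map X² X := snd_map X X.
Definition v1_3 : Map X³ X := comp_map v1_2 (fst_map X² X).
Definition v2_3 : Map X³ X := comp_map v2_2 (fst_map X² X).
Definition v3_3 : Map X³ X := snd_map X² X.
Definition v1_4 : Map X⁴ X := comp_map v1_3 (fst_map X³ X).
Definition v2_4 : Map X⁴ X := comp_map v2_3 (fst_map X³ X).
Definition v3_4 : Map X⁴ X := comp_map v3_3 (fst_map X³ X).
Definition v4_4 : Map X⁴ X := snd_map X³ X.
End Variables.

Section FunVariables.
Context {X : TwoOps}.
Definition V1_2 : PsFun X² X := fst_fun X X.
Definition V2_2 : PsFun X² X := snd_fun X X.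
Definition V1_3 : PsFun X³ X := comp_fun V1_2 (fst_fun (prod_two X X) X).
Definition V2_3 : PsFun X³ X := comp_fun V2_2 (fst_fun (prod_two X X) X).
Definition V3_3 : PsFun X³ X := snd_fun X² X.
End FunVariables.

Section Tensor.
Context {K : TwoOps} (ten : PsFun K² K) (unt : PsFun one_pre K).

Definition ten_map (X : PreTwo) (F G : Map X K) : Map X K :=
  comp_map ten (pair_map F G).
Definition unt_map (X : PreTwo) : Map X K := comp_map unt (one_map X).
Definition ten_fun (X : PreTwo) (F G : PsFun X K) : PsFun X K :=
  comp_fun ten (pair_fun F G).
Definition unt_fun (X : PreTwo) : PsFun X K := comp_fun unt (one_fun X).
Definition ten_nat (X : PreTwo) (F G F' G' : Map X K)
  (α : PsNat F G) (β : PsNat F' G') : PsNat (ten_map F F') (ten_map G G') :=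
  post_nat ten (pair_nat α β).
End Tensor.

Record MonCore (K : TwoOps) : Type := {
  ten : PsFun K² K;
  unt : PsFun one_pre K;
  ass : PsNat (ten_map ten (ten_map ten v1_3 v2_3) v3_3)
              (ten_map ten v1_3 (ten_map ten v2_3 v3_3));
  lun : PsNat (ten_map ten (unt_map unt K) (id_map K)) (id_map K);
  run : PsNat (ten_map ten (id_map K) (unt_map unt K)) (id_map K) }.

Section MonCells.
Context {K : TwoOps} (M : MonCore K).

Local Notation "F ⊠ G" := (ten_map (ten M) F G) (at level 39, left associativity).
Local Notation "α ⊠' β" := (ten_nat (ten M) α β) (at level 39, left associativity).
Local Notation "1_[ F ]" := (id_nat F) (format "1_[ F ]").

Definition ass_at (X : PreTwo) (F G H : Map X K) : PsNat (F ⊠ G ⊠ H) (F ⊠ (G ⊠ H)) :=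
  pre_nat (ass M) (pair_map (pair_map F G) H).
Definition lun_at (X : PreTwo) (F : Map X K) : PsNat (unt_map (unt M) X ⊠ F) F :=
  pre_nat (lun M) F.
Definition run_at (X : PreTwo) (F : Map X K) : PsNat (F ⊠ unt_map (unt M) X) F :=
  pre_nat (run M) F.

(* (α_{A,B,C} D | α_{A,BC,D} | A α_{B,C,D}) and (α_{AB,C,D} | α_{A,B,CD}) *)
Definition pent_src : PsNat (v1_4 ⊠ v2_4 ⊠ v3_4 ⊠ v4_4)
                            (v1_4 ⊠ (v2_4 ⊠ (v3_4 ⊠ v4_4))) :=
  comp_nat (comp_nat (ass_at v1_4 v2_4 v3_4 ⊠' 1_[v4_4])
                     (ass_at v1_4 (v2_4 ⊠ v3_4) v4_4))
           (1_[v1_4] ⊠' ass_at v2_4 v3_4 v4_4).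
Definition pent_tgt : PsNat (v1_4 ⊠ v2_4 ⊠ v3_4 ⊠ v4_4)
                            (v1_4 ⊠ (v2_4 ⊠ (v3_4 ⊠ v4_4))) :=
  comp_nat (ass_at (v1_4 ⊠ v2_4) v3_4 v4_4) (ass_at v1_4 v2_4 (v3_4 ⊠ v4_4)).

(* (α_{A,I,B} | A λ_B) and ρ_A B *)
Definition mid_src : PsNat (v1_2 ⊠ unt_map (unt M) K² ⊠ v2_2) (v1_2 ⊠ v2_2) :=
  comp_nat (ass_at v1_2 (unt_map (unt M) K²) v2_2) (1_[v1_2] ⊠' lun_at v2_2).
Definition mid_tgt : PsNat (v1_2 ⊠ unt_map (unt M) K² ⊠ v2_2) (v1_2 ⊠ v2_2) :=
  run_at v1_2 ⊠' 1_[v2_2].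

(* λ_A B and (α_{I,A,B} | λ_{AB}) *)
Definition left_src : PsNat (unt_map (unt M) K² ⊠ v1_2 ⊠ v2_2) (v1_2 ⊠ v2_2) :=
  lun_at v1_2 ⊠' 1_[v2_2].
Definition left_tgt : PsNat (unt_map (unt M) K² ⊠ v1_2 ⊠ v2_2) (v1_2 ⊠ v2_2) :=
  comp_nat (ass_at (unt_map (unt M) K²) v1_2 v2_2) (lun_at (v1_2 ⊠ v2_2)).

(* ρ_{AB} and (α_{A,B,I} | A ρ_B) *)
Definition right_src : PsNat (v1_2 ⊠ v2_2 ⊠ unt_map (unt M) K²) (v1_2 ⊠ v2_2) :=
  run_at (v1_2 ⊠ v2_2).
Definition right_tgt : PsNat (v1_2 ⊠ v2_2 ⊠ unt_map (unt M) K²) (v1_2 ⊠ v2_2) :=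
  comp_nat (ass_at v1_2 v2_2 (unt_map (unt M) K²)) (1_[v1_2] ⊠' run_at v2_2).
End MonCells.

Record MonData (K : TwoOps) : Type := {
  core :> MonCore K;
  pent : Cells (pent_src core) (pent_tgt core);
  mid : Cells (mid_src core) (mid_tgt core);
  lft : Cells (left_src core) (left_tgt core);
  rgt : Cells (right_src core) (right_tgt core) }.

Section MonComponents.
Context {K : TwoOps} (M : MonData K).

Definition t0 (A B : K) : K := ten M (A, B).
Definition t1 {A A' B B' : K} (f : hom A A') (g : hom B B') :
  hom (t0 A B) (t0 A' B') :=
  @m1 _ _ (ten M) (A, B) (A', B') (f, g).
Definition t2 {A A' B B' : K} {f f' : hom A A'} {g g' : hom B B'}
  (s : f ⇒ f') (t : g ⇒ g') : t1 f g ⇒ t1 f' g' :=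
  @f2 _ _ (ten M) (A, B) (A', B') (f, g) (f', g') (s, t).
Definition tφ {A A' A'' B B' B'' : K} (f : hom A A') (f' : hom A' A'')
  (g : hom B B') (g' : hom B' B'') : t1 f g · t1 f' g' ⇒ t1 (f · f') (g · g') :=
  @ph _ _ (ten M) (A, B) (A', B') (A'', B'') (f, g) (f', g').
Definition tφi {A A' A'' B B' B'' : K} (f : hom A A') (f' : hom A' A'')
  (g : hom B B') (g' : hom B' B'') : t1 (f · f') (g · g') ⇒ t1 f g · t1 f' g' :=
  @phi _ _ (ten M) (A, B) (A', B') (A'', B'') (f, g) (f', g').
Definition tφ0 (A B : K) : i1 (t0 A B) ⇒ t1 (i1 A) (i1 B) := ph0 (ten M) (A, B).
Definition tφ0i (A B : K) : t1 (i1 A) (i1 B) ⇒ i1 (t0 A B) := ph0i (ten M) (A, B).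

Definition lten (A : K) : PsFun K K :=
  @Build_PsFun K K (@Build_Map K K (fun B => t0 A B) (fun B B' g => t1 (i1 A) g))
    (fun B B' g g' s => t2 (i2 (i1 A)) s)
    (fun B B' B'' g g' => as2 (tφ (i1 A) (i1 A) g g'))
    (fun B B' B'' g g' => as2 (tφi (i1 A) (i1 A) g g'))
    (fun B => tφ0 A B)
    (fun B => tφ0i A B).
Definition rten (B : K) : PsFun K K :=
  @Build_PsFun K K (@Build_Map K K (fun A => t0 A B) (fun A A' f => t1 f (i1 B)))
    (fun A A' f f' s => t2 s (i2 (i1 B)))
    (fun A A' A'' f f' => as2 (tφ f f' (i1 B) (i1 B)))
    (fun A A' A'' f f' => as2 (tφi f f' (i1 B) (i1 B)))
    (fun A => tφ0 A B)
    (fun A => tφ0i A B).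

Definition I0 : K := unt M tt.

Definition al (A B C : K) : hom (t0 (t0 A B) C) (t0 A (t0 B C)) := ass M (A, B, C).
Definition la (A : K) : hom (t0 I0 A) A := lun M A.
Definition ro (A : K) : hom (t0 A I0) A := run M A.

Definition pp (A B C D : K) :
  t1 (al A B C) (i1 D) · al A (t0 B C) D · t1 (i1 A) (al B C D)
  ⇒ al (t0 A B) C D · al A B (t0 C D) := pent M (A, B, C, D).
Definition mm (A B : K) : al A I0 B · t1 (i1 A) (la B) ⇒ t1 (ro A) (i1 B) :=
  mid M (A, B).
Definition ll (A B : K) : t1 (la A) (i1 B) ⇒ al I0 A B · la (t0 A B) :=
  lft M (A, B).
Definition rr (A B : K) : ro (t0 A B) ⇒ al A B I0 · t1 (i1 A) (ro B) :=
  rgt M (A, B).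

(** Pseudonaturality of [α], [λ], [ρ] in one variable; for instance [al_n1 f]
    is pseudonaturality of [α] at [(f, 1, 1)] with [1 ⊗ 1] replaced by [1]. *)
Definition al_n {A A' B B' C C' : K} (f : hom A A') (g : hom B B') (h : hom C C') :
  t1 (t1 f g) h · al A' B' C' ⇒ al A B C · t1 f (t1 g h) :=
  @nd _ _ _ _ (ass M) (A, B, C) (A', B', C') (f, g, h).
Definition al_ni {A A' B B' C C' : K} (f : hom A A') (g : hom B B') (h : hom C C') :
  al A B C · t1 f (t1 g h) ⇒ t1 (t1 f g) h · al A' B' C' :=
  @ndi _ _ _ _ (ass M) (A, B, C) (A', B', C') (f, g, h).

Definition al_n1 {A A' : K} (f : hom A A') (B C : K) :
  t1 (t1 f (i1 B)) (i1 C) · al A' B C ⇒ al A B C · t1 f (i1 (t0 B C)) :=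
  al_n f (i1 B) (i1 C) ;; (al A B C ◁ t2 (i2 f) (tφ0i B C)).
Definition al_n1i {A A' : K} (f : hom A A') (B C : K) :
  al A B C · t1 f (i1 (t0 B C)) ⇒ t1 (t1 f (i1 B)) (i1 C) · al A' B C :=
  (al A B C ◁ t2 (i2 f) (tφ0 B C)) ;; al_ni f (i1 B) (i1 C).
Definition al_n2 (A : K) {B B' : K} (g : hom B B') (C : K) :
  t1 (t1 (i1 A) g) (i1 C) · al A B' C ⇒ al A B C · t1 (i1 A) (t1 g (i1 C)) :=
  al_n (i1 A) g (i1 C).
Definition al_n2i (A : K) {B B' : K} (g : hom B B') (C : K) :
  al A B C · t1 (i1 A) (t1 g (i1 C)) ⇒ t1 (t1 (i1 A) g) (i1 C) · al A B' C :=
  al_ni (i1 A) g (i1 C).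
Definition al_n3 (A B : K) {C C' : K} (h : hom C C') :
  t1 (i1 (t0 A B)) h · al A B C' ⇒ al A B C · t1 (i1 A) (t1 (i1 B) h) :=
  (t2 (tφ0 A B) (i2 h) ▷ al A B C') ;; al_n (i1 A) (i1 B) h.
Definition al_n3i (A B : K) {C C' : K} (h : hom C C') :
  al A B C · t1 (i1 A) (t1 (i1 B) h) ⇒ t1 (i1 (t0 A B)) h · al A B C' :=
  al_ni (i1 A) (i1 B) h ;; (t2 (tφ0i A B) (i2 h) ▷ al A B C').

Definition la_n {A A' : K} (f : hom A A') : t1 (i1 I0) f · la A' ⇒ la A · f :=
  (t2 (ph0 (unt M) tt) (i2 f) ▷ la A') ;; (nd (lun M) f : t1 (m1 (unt M) tt) f · la A' ⇒ la A · f).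
Definition ro_n {A A' : K} (f : hom A A') : t1 f (i1 I0) · ro A' ⇒ ro A · f :=
  (t2 (i2 f) (ph0 (unt M) tt) ▷ ro A') ;; (nd (run M) f : t1 f (m1 (unt M) tt) · ro A' ⇒ ro A · f).

(** The axioms of a one-object tricategory: the nonabelian 4-cocycle condition
    on [(((AB)C)D)E], and the left and right normalization conditions on
    [((AI)B)C] and [((AB)I)C]. *)

Definition cocycle_axiom : Prop := forall A B C D E : K,
     (im32 (rten E) (pp A B C D) ▷ al A (t0 B (t0 C D)) E
        ▷ t1 (i1 A) (al B (t0 C D) E) ▷ t1 (i1 A) (t1 (i1 B) (al C D E)))
  ;; (t1 (al (t0 A B) C D) (i1 E) ◁ pp A B (t0 C D) E
        ▷ t1 (i1 A) (t1 (i1 B) (al C D E)))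
  ;; (t1 (al (t0 A B) C D) (i1 E) ◁ al (t0 A B) (t0 C D) E ◁ al_n3i A B (al C D E))
  ;; (pp (t0 A B) C D E ▷ al A B (t0 C (t0 D E)))
  ≈  (t1 (t1 (al A B C) (i1 D)) (i1 E) ◁ t1 (al A (t0 B C) D) (i1 E)
        ◁ al_n2 A (al B C D) E
        ▷ t1 (i1 A) (al B (t0 C D) E) ▷ t1 (i1 A) (t1 (i1 B) (al C D E)))
  ;; (t1 (t1 (al A B C) (i1 D)) (i1 E) ◁ t1 (al A (t0 B C) D) (i1 E)
        ◁ al A (t0 (t0 B C) D) E ◁ im32 (lten A) (pp B C D E))
  ;; (t1 (t1 (al A B C) (i1 D)) (i1 E) ◁ pp A (t0 B C) D E
        ▷ t1 (i1 A) (al B C (t0 D E)))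
  ;; (al_n1 (al A B C) D E ▷ al A (t0 B C) (t0 D E) ▷ t1 (i1 A) (al B C (t0 D E)))
  ;; (al (t0 (t0 A B) C) D E ◁ pp A B C (t0 D E)).

Definition left_normalization_axiom : Prop := forall A B C : K,
     (t1 (al A I0 B) (i1 C) ◁ al A (t0 I0 B) C ◁ im12 (lten A) (ll B C))
  ;; (pp A I0 B C ▷ t1 (i1 A) (la (t0 B C)))
  ;; (al (t0 A I0) B C ◁ mm A (t0 B C))
  ;; al_n1i (ro A) B C
  ≈  (t1 (al A I0 B) (i1 C) ◁ al_n2i A (la B) C)
  ;; (im21 (rten C) (mm A B) ▷ al A B C).

Definition right_normalization_axiom : Prop := forall A B C : K,
     (pp A B I0 C ▷ t1 (i1 A) (t1 (i1 B) (la C)))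
  ;; (al (t0 A B) I0 C ◁ al_n3i A B (la C))
  ;; (mm (t0 A B) C ▷ al A B C)
  ;; (im12 (rten C) (rr A B) ▷ al A B C)
  ≈  (t1 (al A B I0) (i1 C) ◁ al A (t0 B I0) C ◁ im21 (lten A) (mm B C))
  ;; (t1 (al A B I0) (i1 C) ◁ al_n2i A (ro B) C).

Record monoidal_axioms : Prop := {
  mon_cocycle : cocycle_axiom;
  mon_left : left_normalization_axiom;
  mon_right : right_normalization_axiom }.

Record is_monoidal_bicategory : Prop := {
  mb_two : is_two_category K;
  mb_ten : @is_psfun (prod_two K K) K (ten M);
  mb_unt : @is_psfun one_two K (unt M);
  mb_ass : @is_psnat (prod_two (prod_two K K) K) K
             (ten_fun (ten M) (ten_fun (ten M) V1_3 V2_3) V3_3)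
             (ten_fun (ten M) V1_3 (ten_fun (ten M) V2_3 V3_3)) (ass M);
  mb_lun : @is_psnat K K (ten_fun (ten M) (unt_fun (unt M) K) (id_fun K))
             (id_fun K) (lun M);
  mb_run : @is_psnat K K (ten_fun (ten M) (id_fun K) (unt_fun (unt M) K))
             (id_fun K) (run M);
  mb_ass_eq : forall A B C : K, is_equivalence (al A B C);
  mb_lun_eq : forall A : K, is_equivalence (la A);
  mb_run_eq : forall A : K, is_equivalence (ro A);
  mb_pent : is_modification (pent M) /\ all_invertible (pent M);
  mb_mid : is_modification (mid M) /\ all_invertible (mid M);
  mb_lft : is_modification (lft M) /\ all_invertible (lft M);
  mb_rgt : is_modification (rgt M) /\ all_invertible (rgt M);
  mb_axioms : monoidal_axioms }.
End MonComponents.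

Record MonadCore (K : TwoOps) : Type := {
  Tf : PsFun K K;
  mu : PsNat (comp_map Tf Tf) Tf;
  eta : PsNat (id_map K) Tf }.

Section MonadCells.
Context {K : TwoOps} (T : MonadCore K).

(* (Tμ_A | μ_A), (μ_{TA} | μ_A), (η_{TA} | μ_A), (Tη_A | μ_A), 1 *)
Definition massoc_src : PsNat (comp_map (Tf T) (comp_map (Tf T) (Tf T))) (Tf T) :=
  comp_nat (post_nat (Tf T) (mu T)) (mu T).
Definition massoc_tgt : PsNat (comp_map (Tf T) (comp_map (Tf T) (Tf T))) (Tf T) :=
  comp_nat (pre_nat (mu T) (Tf T)) (mu T).
Definition mright_src : PsNat (Tf T) (Tf T) :=
  comp_nat (pre_nat (eta T) (Tf T)) (mu T).
Definition mleft_src : PsNat (Tf T) (Tf T) :=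
  comp_nat (post_nat (Tf T) (eta T)) (mu T).
Definition munit_tgt : PsNat (Tf T) (Tf T) := id_nat (Tf T).
End MonadCells.

Record MonadData (K : TwoOps) : Type := {
  mcore :> MonadCore K;
  Ta : Cells (massoc_src mcore) (massoc_tgt mcore);
  Tr : Cells (mright_src mcore) (munit_tgt mcore);
  Tl : Cells (mleft_src mcore) (munit_tgt mcore) }.

Section MonadAxioms.
Context {K : TwoOps} (T : MonadData K).

Definition mu_ (A : K) : hom (Tf T (Tf T A)) (Tf T A) := mu T A.
Definition eta_ (A : K) : hom A (Tf T A) := eta T A.
Definition aT (A : K) : m1 (Tf T) (mu_ A) · mu_ A ⇒ mu_ (Tf T A) · mu_ A := Ta T A.
Definition rT (A : K) : eta_ (Tf T A) · mu_ A ⇒ i1 (Tf T A) := Tr T A.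
Definition lT (A : K) : m1 (Tf T) (eta_ A) · mu_ A ⇒ i1 (Tf T A) := Tl T A.
Definition mu_n {A B : K} (f : hom A B) :
  m1 (Tf T) (m1 (Tf T) f) · mu_ B ⇒ mu_ A · m1 (Tf T) f := nd (mu T) f.
Definition mu_ni {A B : K} (f : hom A B) :
  mu_ A · m1 (Tf T) f ⇒ m1 (Tf T) (m1 (Tf T) f) · mu_ B := ndi (mu T) f.
Definition eta_ni {A B : K} (f : hom A B) :
  eta_ A · m1 (Tf T) f ⇒ f · eta_ B := ndi (eta T) f.

Record pseudomonad_axioms : Prop := {
  pm_assoc : forall A : K,
       (im22 (Tf T) (aT A) ▷ mu_ A)
    ;; (m1 (Tf T) (mu_ (Tf T A)) ◁ aT A)
    ;; (aT (Tf T A) ▷ mu_ A)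
    ≈  (m1 (Tf T) (m1 (Tf T) (mu_ A)) ◁ aT A)
    ;; (mu_n (mu_ A) ▷ mu_ A)
    ;; (mu_ (Tf T (Tf T A)) ◁ aT A);
  pm_unit : forall A : K,
       im20 (Tf T) (rT A) ▷ mu_ A
    ≈  (m1 (Tf T) (eta_ (Tf T A)) ◁ aT A) ;; (lT (Tf T A) ▷ mu_ A) }.

Record is_pseudomonad : Prop := {
  pm_two : is_two_category K;
  pm_fun : is_psfun (Tf T);
  pm_mu : @is_psnat K K (comp_fun (Tf T) (Tf T)) (Tf T) (mu T);
  pm_eta : @is_psnat K K (id_fun K) (Tf T) (eta T);
  pm_a : is_modification (Ta T) /\ all_invertible (Ta T);
  pm_r : is_modification (Tr T) /\ all_invertible (Tr T);
  pm_l : is_modification (Tl T) /\ all_invertible (Tl T);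
  pm_axioms : pseudomonad_axioms }.
End MonadAxioms.

Section StrengthCells.
Context {K : TwoOps} (M : MonCore K) (T : MonadCore K).

Local Notation "F ⊠ G" := (ten_map (ten M) F G) (at level 39, left associativity).
Local Notation "α ⊠' β" := (ten_nat (ten M) α β) (at level 39, left associativity).
Local Notation "1_[ F ]" := (id_nat F) (format "1_[ F ]").
Local Notation "'T∘' F" := (comp_map (Tf T) F) (at level 38, right associativity).
Local Notation I_ := (unt_map (unt M) _).

(** The types of [t_{A,B} : A ⊗ T(B) → T(A ⊗ B)] and
    [s_{A,B} : T(A) ⊗ B → T(A ⊗ B)]. *)
Definition LNat : Type := PsNat (v1_2 ⊠ T∘ v2_2) (T∘ (v1_2 ⊠ v2_2)).
Definition RNat : Type := PsNat (T∘ v1_2 ⊠ v2_2) (T∘ (v1_2 ⊠ v2_2)).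

Section Left.
Variable t : LNat.

Definition t_at (X : PreTwo) (F G : Map X K) : PsNat (F ⊠ T∘ G) (T∘ (F ⊠ G)) :=
  pre_nat t (pair_map F G).

(* (t_{I,A} | Tλ_A) and λ_{TA} *)
Definition lx_src : PsNat (unt_map (unt M) K ⊠ T∘ id_map K) (T∘ id_map K) :=
  comp_nat (t_at (unt_map (unt M) K) (id_map K)) (post_nat (Tf T) (lun M)).
Definition lx_tgt : PsNat (unt_map (unt M) K ⊠ T∘ id_map K) (T∘ id_map K) :=
  lun_at M (T∘ id_map K).

(* (t_{AB,C} | Tα_{A,B,C}) and (α_{A,B,TC} | A t_{B,C} | t_{A,BC}) *)
Definition ly_src : PsNat (v1_3 ⊠ v2_3 ⊠ T∘ v3_3) (T∘ (v1_3 ⊠ (v2_3 ⊠ v3_3))) :=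
  comp_nat (t_at (v1_3 ⊠ v2_3) v3_3) (post_nat (Tf T) (ass M)).
Definition ly_tgt : PsNat (v1_3 ⊠ v2_3 ⊠ T∘ v3_3) (T∘ (v1_3 ⊠ (v2_3 ⊠ v3_3))) :=
  comp_nat (comp_nat (ass_at M v1_3 v2_3 (T∘ v3_3)) (1_[v1_3] ⊠' t_at v2_3 v3_3))
           (t_at v1_3 (v2_3 ⊠ v3_3)).

(* (t_{A,TB} | T t_{A,B} | μ_{AB}) and (Aμ_B | t_{A,B}) *)
Definition lw_src : PsNat (v1_2 ⊠ T∘ T∘ v2_2) (T∘ (v1_2 ⊠ v2_2)) :=
  comp_nat (comp_nat (t_at v1_2 (T∘ v2_2)) (post_nat (Tf T) t))
           (pre_nat (mu T) (v1_2 ⊠ v2_2)).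
Definition lw_tgt : PsNat (v1_2 ⊠ T∘ T∘ v2_2) (T∘ (v1_2 ⊠ v2_2)) :=
  comp_nat (1_[v1_2] ⊠' pre_nat (mu T) v2_2) t.

(* (Aη_B | t_{A,B}) and η_{AB} *)
Definition lz_src : PsNat (v1_2 ⊠ v2_2) (T∘ (v1_2 ⊠ v2_2)) :=
  comp_nat (1_[v1_2] ⊠' pre_nat (eta T) v2_2) t.
Definition lz_tgt : PsNat (v1_2 ⊠ v2_2) (T∘ (v1_2 ⊠ v2_2)) :=
  pre_nat (eta T) (v1_2 ⊠ v2_2).
End Left.

Section Right.
Variable s : RNat.

Definition s_at (X : PreTwo) (F G : Map X K) : PsNat (T∘ F ⊠ G) (T∘ (F ⊠ G)) :=
  pre_nat s (pair_map F G).

(* (s_{A,I} | Tρ_A) and ρ_{TA} *)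
Definition rx_src : PsNat (T∘ id_map K ⊠ unt_map (unt M) K) (T∘ id_map K) :=
  comp_nat (s_at (id_map K) (unt_map (unt M) K)) (post_nat (Tf T) (run M)).
Definition rx_tgt : PsNat (T∘ id_map K ⊠ unt_map (unt M) K) (T∘ id_map K) :=
  run_at M (T∘ id_map K).

(* (s_{A,B} C | s_{AB,C} | Tα_{A,B,C}) and (α_{TA,B,C} | s_{A,BC}) *)
(* This is the mirror image of [y], whose associator points backwards, with
   [α^{-1}] moved to the other side. *)
Definition ry_src : PsNat (T∘ v1_3 ⊠ v2_3 ⊠ v3_3) (T∘ (v1_3 ⊠ (v2_3 ⊠ v3_3))) :=
  comp_nat (comp_nat (s_at v1_3 v2_3 ⊠' 1_[v3_3]) (s_at (v1_3 ⊠ v2_3) v3_3))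
           (post_nat (Tf T) (ass M)).
Definition ry_tgt : PsNat (T∘ v1_3 ⊠ v2_3 ⊠ v3_3) (T∘ (v1_3 ⊠ (v2_3 ⊠ v3_3))) :=
  comp_nat (ass_at M (T∘ v1_3) v2_3 v3_3) (s_at v1_3 (v2_3 ⊠ v3_3)).

(* (s_{TA,B} | T s_{A,B} | μ_{AB}) and (μ_A B | s_{A,B}) *)
Definition rw_src : PsNat (T∘ T∘ v1_2 ⊠ v2_2) (T∘ (v1_2 ⊠ v2_2)) :=
  comp_nat (comp_nat (s_at (T∘ v1_2) v2_2) (post_nat (Tf T) s))
           (pre_nat (mu T) (v1_2 ⊠ v2_2)).
Definition rw_tgt : PsNat (T∘ T∘ v1_2 ⊠ v2_2) (T∘ (v1_2 ⊠ v2_2)) :=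
  comp_nat (pre_nat (mu T) v1_2 ⊠' 1_[v2_2]) s.

(* (η_A B | s_{A,B}) and η_{AB} *)
Definition rz_src : PsNat (v1_2 ⊠ v2_2) (T∘ (v1_2 ⊠ v2_2)) :=
  comp_nat (pre_nat (eta T) v1_2 ⊠' 1_[v2_2]) s.
Definition rz_tgt : PsNat (v1_2 ⊠ v2_2) (T∘ (v1_2 ⊠ v2_2)) :=
  pre_nat (eta T) (v1_2 ⊠ v2_2).
End Right.
End StrengthCells.

Record LStrData (K : TwoOps) (M : MonCore K) (T : MonadCore K) : Type := {
  lt : LNat M T;
  lx : Cells (lx_src lt) (lx_tgt M T);
  ly : Cells (ly_src lt) (ly_tgt lt);
  lw : Cells (lw_src lt) (lw_tgt lt);
  lz : Cells (lz_src lt) (lz_tgt M T) }.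

Record RStrData (K : TwoOps) (M : MonCore K) (T : MonadCore K) : Type := {
  rs : RNat M T;
  rx : Cells (rx_src rs) (rx_tgt M T);
  ry : Cells (ry_src rs) (ry_tgt rs);
  rw : Cells (rw_src rs) (rw_tgt rs);
  rz : Cells (rz_src rs) (rz_tgt M T) }.

Section StrengthAxioms.
Context {K : TwoOps} (M : MonData K) (T : MonadData K).

Local Notation Tm := (Tf T).
Local Notation Ti f := (m1 (Tf T) f).
Local Notation "A ⊗ B" := (t0 M A B) (at level 36, left associativity).
Local Notation "A ◂ g" := (t1 M (i1 A) g) (at level 38, right associativity).
Local Notation "f ▸ B" := (t1 M f (i1 B)) (at level 37, left associativity).
Local Notation I_ := (I0 M).
Local Notation "'α'" := (al M).
Local Notation "'λ'" := (la M).
Local Notation "'ρ'" := (ro M).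
Local Notation "'μ'" := (mu_ T).
Local Notation "'η'" := (eta_ T).

Section Left.
Variable S : LStrData M T.

Definition tt_ (A B : K) : hom (A ⊗ Tm B) (Tm (A ⊗ B)) := lt S (A, B).
Local Notation "'τ'" := tt_.

Definition xx (A : K) : τ I_ A · Ti (λ A) ⇒ λ (Tm A) := lx S A.
Definition yy (A B C : K) :
  τ (A ⊗ B) C · Ti (α A B C) ⇒ α A B (Tm C) · (A ◂ τ B C) · τ A (B ⊗ C) :=
  ly S (A, B, C).
Definition ww (A B : K) :
  τ A (Tm B) · Ti (τ A B) · μ (A ⊗ B) ⇒ (A ◂ μ B) · τ A B := lw S (A, B).
Definition zz (A B : K) : (A ◂ η B) · τ A B ⇒ η (A ⊗ B) := lz S (A, B).

Definition tt_n {A A' B B' : K} (f : hom A A') (g : hom B B') :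
  t1 M f (Ti g) · τ A' B' ⇒ τ A B · Ti (t1 M f g) :=
  @nd _ _ _ _ (lt S) (A, B) (A', B') (f, g).
Definition tt_ni {A A' B B' : K} (f : hom A A') (g : hom B B') :
  τ A B · Ti (t1 M f g) ⇒ t1 M f (Ti g) · τ A' B' :=
  @ndi _ _ _ _ (lt S) (A, B) (A', B') (f, g).
Definition tt_n1i {A A' : K} (f : hom A A') (B : K) :
  τ A B · Ti (f ▸ B) ⇒ (f ▸ Tm B) · τ A' B :=
  tt_ni f (i1 B) ;; (t2 M (i2 f) (ph0i Tm B) ▷ τ A' B).
Definition tt_n2 (A : K) {B B' : K} (g : hom B B') :
  (A ◂ Ti g) · τ A B' ⇒ τ A B · Ti (A ◂ g) := tt_n (i1 A) g.
Definition tt_n2i (A : K) {B B' : K} (g : hom B B') :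
  τ A B · Ti (A ◂ g) ⇒ (A ◂ Ti g) · τ A B' := tt_ni (i1 A) g.

Record left_strength_axioms : Prop := {
  ls_mid : forall A B : K,
       (τ (A ⊗ I_) B ◁ im21 Tm (mm M A B))
    ;; tt_n1i (ro M A) B
    ≈  (yy A I_ B ▷ Ti (A ◂ λ B))
    ;; (α A I_ (Tm B) ◁ (A ◂ τ I_ B) ◁ tt_n2i A (λ B))
    ;; (α A I_ (Tm B) ◁ im21 (lten M A) (xx B) ▷ τ A B)
    ;; (mm M A (Tm B) ▷ τ A B);
  ls_left : forall A B : K,
       (τ (I_ ⊗ A) B ◁ im12 Tm (ll M A B))
    ;; (yy I_ A B ▷ Ti (λ (A ⊗ B)))
    ;; (α I_ A (Tm B) ◁ (I_ ◂ τ A B) ◁ xx (A ⊗ B))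
    ;; (α I_ A (Tm B) ◁ la_n M (τ A B))
    ≈  tt_n1i (λ A) B
    ;; (ll M A (Tm B) ▷ τ A B);
  ls_pent : forall A B C D : K,
       (τ (A ⊗ B ⊗ C) D ◁ im32 Tm (pp M A B C D))
    ;; (yy (A ⊗ B) C D ▷ Ti (α A B (C ⊗ D)))
    ;; (α (A ⊗ B) C (Tm D) ◁ (A ⊗ B ◂ τ C D) ◁ yy A B (C ⊗ D))
    ;; (α (A ⊗ B) C (Tm D) ◁ al_n3 M A B (τ C D)
          ▷ (A ◂ τ B (C ⊗ D)) ▷ τ A (B ⊗ (C ⊗ D)))
    ≈  (tt_n1i (α A B C) D ▷ Ti (α A (B ⊗ C) D) ▷ Ti (A ◂ α B C D))
    ;; ((α A B C ▸ Tm D) ◁ yy A (B ⊗ C) D ▷ Ti (A ◂ α B C D))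
    ;; ((α A B C ▸ Tm D) ◁ α A (B ⊗ C) (Tm D) ◁ (A ◂ τ (B ⊗ C) D)
          ◁ tt_n2i A (α B C D))
    ;; ((α A B C ▸ Tm D) ◁ α A (B ⊗ C) (Tm D) ◁ im23 (lten M A) (yy B C D)
          ▷ τ A (B ⊗ (C ⊗ D)))
    ;; (pp M A B C (Tm D) ▷ (A ◂ (B ◂ τ C D)) ▷ (A ◂ τ B (C ⊗ D))
          ▷ τ A (B ⊗ (C ⊗ D)));
  ls_monad_left : forall A B : K,
       ((A ◂ Ti (η B)) ◁ ww A B)
    ;; (im20 (lten M A) (lT T B) ▷ τ A B)
    ≈  (tt_n2 A (η B) ▷ Ti (τ A B) ▷ μ (A ⊗ B))
    ;; (τ A B ◁ im21 Tm (zz A B) ▷ μ (A ⊗ B))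
    ;; (τ A B ◁ lT T (A ⊗ B));
  ls_monad_right : forall A B : K,
       ((A ◂ η (Tm B)) ◁ ww A B)
    ;; (im20 (lten M A) (rT T B) ▷ τ A B)
    ≈  (zz A (Tm B) ▷ Ti (τ A B) ▷ μ (A ⊗ B))
    ;; (eta_ni T (τ A B) ▷ μ (A ⊗ B))
    ;; (τ A B ◁ rT T (A ⊗ B));
  ls_monad_assoc : forall A B : K,
       (τ A (Tm (Tm B)) ◁ im32 Tm (ww A B) ▷ μ (A ⊗ B))
    ;; (tt_n2i A (μ B) ▷ Ti (τ A B) ▷ μ (A ⊗ B))
    ;; ((A ◂ Ti (μ B)) ◁ ww A B)
    ;; (im22 (lten M A) (aT T B) ▷ τ A B)
    ≈  (τ A (Tm (Tm B)) ◁ Ti (τ A (Tm B)) ◁ Ti (Ti (τ A B)) ◁ aT T (A ⊗ B))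
    ;; (τ A (Tm (Tm B)) ◁ Ti (τ A (Tm B)) ◁ mu_n T (τ A B) ▷ μ (A ⊗ B))
    ;; (ww A (Tm B) ▷ Ti (τ A B) ▷ μ (A ⊗ B))
    ;; ((A ◂ μ (Tm B)) ◁ ww A B);
  ls_unit_eta : forall B : K,
       (zz I_ B ▷ Ti (λ B)) ;; eta_ni T (λ B)
    ≈  ((I_ ◂ η B) ◁ xx B) ;; la_n M (η B);
  ls_unit_mu : forall B : K,
       (ww I_ B ▷ Ti (λ B)) ;; ((I_ ◂ μ B) ◁ xx B) ;; la_n M (μ B)
    ≈  (τ I_ (Tm B) ◁ Ti (τ I_ B) ◁ mu_ni T (λ B))
    ;; (τ I_ (Tm B) ◁ im21 Tm (xx B) ▷ μ B)
    ;; (xx (Tm B) ▷ μ B);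
  ls_assoc_eta : forall A B C : K,
       (zz (A ⊗ B) C ▷ Ti (α A B C)) ;; eta_ni T (α A B C)
    ≈  ((A ⊗ B ◂ η C) ◁ yy A B C)
    ;; (al_n3 M A B (η C) ▷ (A ◂ τ B C) ▷ τ A (B ⊗ C))
    ;; (α A B C ◁ im21 (lten M A) (zz B C) ▷ τ A (B ⊗ C))
    ;; (α A B C ◁ zz A (B ⊗ C));
  ls_assoc_mu : forall A B C : K,
       (ww (A ⊗ B) C ▷ Ti (α A B C))
    ;; ((A ⊗ B ◂ μ C) ◁ yy A B C)
    ;; (al_n3 M A B (μ C) ▷ (A ◂ τ B C) ▷ τ A (B ⊗ C))
    ≈  (τ (A ⊗ B) (Tm C) ◁ Ti (τ (A ⊗ B) C) ◁ mu_ni T (α A B C))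
    ;; (τ (A ⊗ B) (Tm C) ◁ im23 Tm (yy A B C) ▷ μ (A ⊗ (B ⊗ C)))
    ;; (yy A B (Tm C) ▷ Ti (A ◂ τ B C) ▷ Ti (τ A (B ⊗ C)) ▷ μ (A ⊗ (B ⊗ C)))
    ;; (α A B (Tm (Tm C)) ◁ (A ◂ τ B (Tm C)) ◁ tt_n2i A (τ B C)
          ▷ Ti (τ A (B ⊗ C)) ▷ μ (A ⊗ (B ⊗ C)))
    ;; (α A B (Tm (Tm C)) ◁ (A ◂ τ B (Tm C)) ◁ (A ◂ Ti (τ B C)) ◁ ww A (B ⊗ C))
    ;; (α A B (Tm (Tm C)) ◁ im32 (lten M A) (ww B C) ▷ τ A (B ⊗ C)) }.

Record is_left_strength : Prop := {
  ls_nat : @is_psnat (prod_two K K) K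
             (ten_fun (ten M) V1_2 (comp_fun Tm V2_2))
             (comp_fun Tm (ten_fun (ten M) V1_2 V2_2)) (lt S);
  ls_x : is_modification (lx S) /\ all_invertible (lx S);
  ls_y : is_modification (ly S) /\ all_invertible (ly S);
  ls_w : is_modification (lw S) /\ all_invertible (lw S);
  ls_z : is_modification (lz S) /\ all_invertible (lz S);
  ls_axioms : left_strength_axioms }.
End Left.

Section Right.
Variable S : RStrData M T.

Definition ss_ (A B : K) : hom (Tm A ⊗ B) (Tm (A ⊗ B)) := rs S (A, B).
Local Notation "'σ'" := ss_.

Definition xr (A : K) : σ A I_ · Ti (ρ A) ⇒ ρ (Tm A) := rx S A.
Definition yr (A B C : K) :
  (σ A B ▸ C) · σ (A ⊗ B) C · Ti (α A B C) ⇒ α (Tm A) B C · σ A (B ⊗ C) :=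
  ry S (A, B, C).
Definition wr (A B : K) :
  σ (Tm A) B · Ti (σ A B) · μ (A ⊗ B) ⇒ (μ A ▸ B) · σ A B := rw S (A, B).
Definition zr (A B : K) : (η A ▸ B) · σ A B ⇒ η (A ⊗ B) := rz S (A, B).

Definition ss_n {A A' B B' : K} (f : hom A A') (g : hom B B') :
  t1 M (Ti f) g · σ A' B' ⇒ σ A B · Ti (t1 M f g) :=
  @nd _ _ _ _ (rs S) (A, B) (A', B') (f, g).
Definition ss_ni {A A' B B' : K} (f : hom A A') (g : hom B B') :
  σ A B · Ti (t1 M f g) ⇒ t1 M (Ti f) g · σ A' B' :=
  @ndi _ _ _ _ (rs S) (A, B) (A', B') (f, g).
Definition ss_n2i (A : K) {B B' : K} (g : hom B B') :
  σ A B · Ti (A ◂ g) ⇒ (Tm A ◂ g) · σ A B' :=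
  ss_ni (i1 A) g ;; (t2 M (ph0i Tm A) (i2 g) ▷ σ A B').
Definition ss_n1 {A A' : K} (f : hom A A') (B : K) :
  (Ti f ▸ B) · σ A' B ⇒ σ A B · Ti (f ▸ B) := ss_n f (i1 B).
Definition ss_n1i {A A' : K} (f : hom A A') (B : K) :
  σ A B · Ti (f ▸ B) ⇒ (Ti f ▸ B) · σ A' B := ss_ni f (i1 B).

Record right_strength_axioms : Prop := {
  rs_mid : forall A B : K,
       ((σ A I_ ▸ B) ◁ σ (A ⊗ I_) B ◁ im21 Tm (mm M A B))
    ;; ((σ A I_ ▸ B) ◁ ss_n1i (ρ A) B)
    ;; (im21 (rten M B) (xr A) ▷ σ A B)
    ≈  (yr A I_ B ▷ Ti (A ◂ λ B))
    ;; (α (Tm A) I_ B ◁ ss_n2i A (λ B))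
    ;; (mm M (Tm A) B ▷ σ A B);
  rs_right : forall A B : K,
       ((σ A B ▸ I_) ◁ σ (A ⊗ B) I_ ◁ im12 Tm (rr M A B))
    ;; (yr A B I_ ▷ Ti (A ◂ ρ B))
    ;; (α (Tm A) B I_ ◁ ss_n2i A (ρ B))
    ≈  ((σ A B ▸ I_) ◁ xr (A ⊗ B))
    ;; ro_n M (σ A B)
    ;; (rr M (Tm A) B ▷ σ A B);
  rs_pent : forall A B C D : K,
       ((σ A B ▸ C ▸ D) ◁ (σ (A ⊗ B) C ▸ D) ◁ σ (A ⊗ B ⊗ C) D
          ◁ im32 Tm (pp M A B C D))
    ;; ((σ A B ▸ C ▸ D) ◁ yr (A ⊗ B) C D ▷ Ti (α A B (C ⊗ D)))
    ;; (al_n1 M (σ A B) C D ▷ σ (A ⊗ B) (C ⊗ D) ▷ Ti (α A B (C ⊗ D)))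
    ;; (α (Tm A ⊗ B) C D ◁ yr A B (C ⊗ D))
    ≈  ((σ A B ▸ C ▸ D) ◁ (σ (A ⊗ B) C ▸ D) ◁ ss_n1i (α A B C) D
          ▷ Ti (α A (B ⊗ C) D) ▷ Ti (A ◂ α B C D))
    ;; (im32 (rten M D) (yr A B C) ▷ σ (A ⊗ (B ⊗ C)) D
          ▷ Ti (α A (B ⊗ C) D) ▷ Ti (A ◂ α B C D))
    ;; ((α (Tm A) B C ▸ D) ◁ yr A (B ⊗ C) D ▷ Ti (A ◂ α B C D))
    ;; ((α (Tm A) B C ▸ D) ◁ α (Tm A) (B ⊗ C) D ◁ ss_n2i A (α B C D))
    ;; (pp M (Tm A) B C D ▷ σ A (B ⊗ (C ⊗ D)));
  rs_monad_left : forall A B : K,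
       ((Ti (η A) ▸ B) ◁ wr A B)
    ;; (im20 (rten M B) (lT T A) ▷ σ A B)
    ≈  (ss_n1 (η A) B ▷ Ti (σ A B) ▷ μ (A ⊗ B))
    ;; (σ A B ◁ im21 Tm (zr A B) ▷ μ (A ⊗ B))
    ;; (σ A B ◁ lT T (A ⊗ B));
  rs_monad_right : forall A B : K,
       ((η (Tm A) ▸ B) ◁ wr A B)
    ;; (im20 (rten M B) (rT T A) ▷ σ A B)
    ≈  (zr (Tm A) B ▷ Ti (σ A B) ▷ μ (A ⊗ B))
    ;; (eta_ni T (σ A B) ▷ μ (A ⊗ B))
    ;; (σ A B ◁ rT T (A ⊗ B));
  rs_monad_assoc : forall A B : K,
       (σ (Tm (Tm A)) B ◁ im32 Tm (wr A B) ▷ μ (A ⊗ B))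
    ;; (ss_n1i (μ A) B ▷ Ti (σ A B) ▷ μ (A ⊗ B))
    ;; ((Ti (μ A) ▸ B) ◁ wr A B)
    ;; (im22 (rten M B) (aT T A) ▷ σ A B)
    ≈  (σ (Tm (Tm A)) B ◁ Ti (σ (Tm A) B) ◁ Ti (Ti (σ A B)) ◁ aT T (A ⊗ B))
    ;; (σ (Tm (Tm A)) B ◁ Ti (σ (Tm A) B) ◁ mu_n T (σ A B) ▷ μ (A ⊗ B))
    ;; (wr (Tm A) B ▷ Ti (σ A B) ▷ μ (A ⊗ B))
    ;; ((μ (Tm A) ▸ B) ◁ wr A B);
  rs_unit_eta : forall A : K,
       (zr A I_ ▷ Ti (ρ A)) ;; eta_ni T (ρ A)
    ≈  ((η A ▸ I_) ◁ xr A) ;; ro_n M (η A);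
  rs_unit_mu : forall A : K,
       (wr A I_ ▷ Ti (ρ A)) ;; ((μ A ▸ I_) ◁ xr A) ;; ro_n M (μ A)
    ≈  (σ (Tm A) I_ ◁ Ti (σ A I_) ◁ mu_ni T (ρ A))
    ;; (σ (Tm A) I_ ◁ im21 Tm (xr A) ▷ μ A)
    ;; (xr (Tm A) ▷ μ A);
  rs_assoc_eta : forall A B C : K,
       (im21 (rten M C) (zr A B) ▷ σ (A ⊗ B) C ▷ Ti (α A B C))
    ;; (zr (A ⊗ B) C ▷ Ti (α A B C))
    ;; eta_ni T (α A B C)
    ≈  ((η A ▸ B ▸ C) ◁ yr A B C)
    ;; (al_n1 M (η A) B C ▷ σ A (B ⊗ C))
    ;; (α A B C ◁ zr A (B ⊗ C));
  rs_assoc_mu : forall A B C : K,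
       ((σ (Tm A) B ▸ C) ◁ ss_n1i (σ A B) C ▷ Ti (σ (A ⊗ B) C) ▷ μ (A ⊗ B ⊗ C)
          ▷ Ti (α A B C))
    ;; ((σ (Tm A) B ▸ C) ◁ (Ti (σ A B) ▸ C) ◁ wr (A ⊗ B) C ▷ Ti (α A B C))
    ;; (im32 (rten M C) (wr A B) ▷ σ (A ⊗ B) C ▷ Ti (α A B C))
    ;; ((μ A ▸ B ▸ C) ◁ yr A B C)
    ;; (al_n1 M (μ A) B C ▷ σ A (B ⊗ C))
    ≈  ((σ (Tm A) B ▸ C) ◁ σ (Tm A ⊗ B) C ◁ Ti (σ A B ▸ C) ◁ Ti (σ (A ⊗ B) C)
          ◁ mu_ni T (α A B C))
    ;; ((σ (Tm A) B ▸ C) ◁ σ (Tm A ⊗ B) C ◁ im32 Tm (yr A B C) ▷ μ (A ⊗ (B ⊗ C)))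
    ;; (yr (Tm A) B C ▷ Ti (σ A (B ⊗ C)) ▷ μ (A ⊗ (B ⊗ C)))
    ;; (α (Tm (Tm A)) B C ◁ wr A (B ⊗ C)) }.

Record is_right_strength : Prop := {
  rs_nat : @is_psnat (prod_two K K) K
             (ten_fun (ten M) (comp_fun Tm V1_2) V2_2)
             (comp_fun Tm (ten_fun (ten M) V1_2 V2_2)) (rs S);
  rs_x : is_modification (rx S) /\ all_invertible (rx S);
  rs_y : is_modification (ry S) /\ all_invertible (ry S);
  rs_w : is_modification (rw S) /\ all_invertible (rw S);
  rs_z : is_modification (rz S) /\ all_invertible (rz S);
  rs_axioms : right_strength_axioms }.
End Right.
End StrengthAxioms.

(** A square [s : sq f u v g] has top [f], left side [u], right side [v] and
    bottom [g]. [id_h f] is the identity square on the 1h-cell [f] for vertical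
    composition, [id_v u] the one on the 1v-cell [u] for horizontal composition. *)
Record DblOps : Type := {
  dob :> Type;
  hh : dob -> dob -> Type;
  vv : dob -> dob -> Type;
  hid : forall A, hh A A;
  hc : forall A B C, hh A B -> hh B C -> hh A C;
  vid : forall A, vv A A;
  vc : forall A B C, vv A B -> vv B C -> vv A C;
  hcA : forall A B C D (f : hh A B) (g : hh B C) (h : hh C D),
      hc (hc f g) h = hc f (hc g h);
  hcl : forall A B (f : hh A B), hc (hid A) f = f;
  hcr : forall A B (f : hh A B), hc f (hid B) = f;
  vcA : forall A B C D (u : vv A B) (v : vv B C) (w : vv C D),
      vc (vc u v) w = vc u (vc v w);
  vcl : forall A B (u : vv A B), vc (vid A) u = u;
  vcr : forall A B (u : vv A B), vc u (vid B) = u;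
  sq : forall A B A' B', hh A B -> vv A A' -> vv B B' -> hh A' B' -> Type;
  id_h : forall A B (f : hh A B), sq f (vid A) (vid B) f;
  id_v : forall A A' (u : vv A A'), sq (hid A) u u (hid A');
  sqh : forall A B C A' B' C' (f : hh A B) (g : hh B C) (u : vv A A') (v : vv B B')
      (w : vv C C') (f' : hh A' B') (g' : hh B' C'),
      sq f u v f' -> sq g v w g' -> sq (hc f g) u w (hc f' g');
  sqv : forall A B A' B' A'' B'' (f : hh A B) (u : vv A A') (v : vv B B')
      (g : hh A' B') (u' : vv A' A'') (v' : vv B' B'') (h : hh A'' B''),
      sq f u v g -> sq g u' v' h -> sq f (vc u u') (vc v v') h }.

Arguments hh {d} _ _.
Arguments vv {d} _ _.
Arguments hid {d} A.
Arguments hc {d A B C} f g.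
Arguments vid {d} A.
Arguments vc {d A B C} u v.
Arguments id_h {d A B} f.
Arguments id_v {d A A'} u.
Arguments sqh {d A B C A' B' C' f g u v w f' g'} s t.
Arguments sqv {d A B A' B' A'' B'' f u v g u' v' h} s t.

Declare Scope square_scope.
Delimit Scope square_scope with square.
Open Scope square_scope.

Notation "u // v" := (vc u v) (at level 40, left associativity) : square_scope.
Notation "⟦ s | t ⟧" := (sqh s t) (s at level 49, t at level 49) : square_scope.
Notation "s /// t" := (sqv s t) (at level 45, left associativity) : square_scope.

(** Squares are compared up to equality of their sides. *)

Definition sqcast {D : DblOps} {A B A' B' : D} {f f1 : hh A B} {u u1 : vv A A'}
  {v v1 : vv B B'} {g g1 : hh A' B'} (ef : f = f1) (eu : u = u1) (ev : v = v1)
  (eg : g = g1) (s : sq f u v g) : sq f1 u1 v1 g1 :=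
  match ef in _ = x, eu in _ = y, ev in _ = z, eg in _ = w return sq x y z w with
  | eq_refl, eq_refl, eq_refl, eq_refl => s
  end.

Definition sqeq {D : DblOps} {A B A' B' : D} {f f1 : hh A B} {u u1 : vv A A'}
  {v v1 : vv B B'} {g g1 : hh A' B'} (s : sq f u v g) (s1 : sq f1 u1 v1 g1) : Prop :=
  exists (ef : f = f1) (eu : u = u1) (ev : v = v1) (eg : g = g1),
    sqcast ef eu ev eg s = s1.

Notation "s ≋ t" := (sqeq s t) (at level 70, no associativity) : square_scope.

Record is_double_category (D : DblOps) : Prop := {
  sqhA : forall (A B C E A' B' C' E' : D) (f : hh A B) (g : hh B C) (h : hh C E)
      (u : vv A A') (v : vv B B') (w : vv C C') (x : vv E E')
      (f' : hh A' B') (g' : hh B' C') (h' : hh C' E')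
      (r : sq f u v f') (s : sq g v w g') (t : sq h w x h'),
      ⟦ ⟦ r | s ⟧ | t ⟧ ≋ ⟦ r | ⟦ s | t ⟧ ⟧;
  sqhl : forall (A B A' B' : D) (f : hh A B) (u : vv A A') (v : vv B B')
      (g : hh A' B') (s : sq f u v g), ⟦ id_v u | s ⟧ ≋ s;
  sqhr : forall (A B A' B' : D) (f : hh A B) (u : vv A A') (v : vv B B')
      (g : hh A' B') (s : sq f u v g), ⟦ s | id_v v ⟧ ≋ s;
  sqvA : forall (A B A' B' A'' B'' A''' B''' : D) (f : hh A B) (u : vv A A')
      (v : vv B B') (g : hh A' B') (u' : vv A' A'') (v' : vv B' B'')
      (h : hh A'' B'') (u'' : vv A'' A''') (v'' : vv B'' B''') (k : hh A''' B''')
      (r : sq f u v g) (s : sq g u' v' h) (t : sq h u'' v'' k),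
      (r /// s) /// t ≋ r /// (s /// t);
  sqvl : forall (A B A' B' : D) (f : hh A B) (u : vv A A') (v : vv B B')
      (g : hh A' B') (s : sq f u v g), id_h f /// s ≋ s;
  sqvr : forall (A B A' B' : D) (f : hh A B) (u : vv A A') (v : vv B B')
      (g : hh A' B') (s : sq f u v g), s /// id_h g ≋ s;
  interchange : forall (A B C A' B' C' A'' B'' C'' : D) (f : hh A B) (g : hh B C)
      (u : vv A A') (v : vv B B') (w : vv C C') (f' : hh A' B') (g' : hh B' C')
      (u' : vv A' A'') (v' : vv B' B'') (w' : vv C' C'') (f'' : hh A'' B'')
      (g'' : hh B'' C'') (a : sq f u v f') (b : sq g v w g')
      (c : sq f' u' v' f'') (d : sq g' v' w' g''),
      ⟦ a | b ⟧ /// ⟦ c | d ⟧ = ⟦ a /// c | b /// d ⟧;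
  id_h_hc : forall (A B C : D) (f : hh A B) (g : hh B C),
      ⟦ id_h f | id_h g ⟧ = id_h (hc f g);
  id_v_vc : forall (A B C : D) (u : vv A B) (v : vv B C),
      id_v u /// id_v v = id_v (u // v);
  id_hv : forall A : D, id_h (hid A) = id_v (vid A) }.

Record DoubleCat : Type := {
  dbl_ops :> DblOps;
  dbl_laws : is_double_category dbl_ops }.

Definition prod_dbl (D E : DblOps) : DblOps.
Proof.
  refine {|
    dob := (D * E)%type;
    hh A B := (hh (fst A) (fst B) * hh (snd A) (snd B))%type;
    vv A B := (vv (fst A) (fst B) * vv (snd A) (snd B))%type;
    hid A := (hid (fst A), hid (snd A));
    hc A B C f g := (hc (fst f) (fst g), hc (snd f) (snd g));
    vid A := (vid (fst A), vid (snd A));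
    vc A B C u v := (fst u // fst v, snd u // snd v);
    sq A B A' B' f u v g :=
      (sq (fst f) (fst u) (fst v) (fst g) * sq (snd f) (snd u) (snd v) (snd g))%type;
    id_h A B f := (id_h (fst f), id_h (snd f));
    id_v A B u := (id_v (fst u), id_v (snd u));
    sqh A B C A' B' C' f g u v w f' g' s t :=
      (⟦ fst s | fst t ⟧, ⟦ snd s | snd t ⟧);
    sqv A B A' B' A'' B'' f u v g u' v' h s t :=
      (fst s /// fst t, snd s /// snd t) |}.
  - intros; cbn; f_equal; apply hcA.
  - intros A B [f f']; cbn; f_equal; apply hcl.
  - intros A B [f f']; cbn; f_equal; apply hcr.
  - intros; cbn; f_equal; apply vcA.
  - intros A B [f f']; cbn; f_equal; apply vcl.
  - intros A B [f f']; cbn; f_equal; apply vcr.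
Defined.

Definition one_dbl : DblOps.
Proof.
  refine {|
    dob := unit;
    hh _ _ := unit;
    vv _ _ := unit;
    hid _ := tt;
    hc _ _ _ _ _ := tt;
    vid _ := tt;
    vc _ _ _ _ _ := tt;
    sq _ _ _ _ _ _ _ _ := unit;
    id_h _ _ _ := tt;
    id_v _ _ _ := tt;
    sqh _ _ _ _ _ _ _ _ _ _ _ _ _ _ _ := tt;
    sqv _ _ _ _ _ _ _ _ _ _ _ _ _ _ _ := tt |}.
  - reflexivity.
  - intros A B []; reflexivity.
  - intros A B []; reflexivity.
  - reflexivity.
  - intros A B []; reflexivity.
  - intros A B []; reflexivity.
Defined.

Definition hor_pre (D : DblOps) : PreTwo := {|
  ob := D;
  hom A B := hh A B;
  two A B f g := sq f (vid A) (vid B) g;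
  i1 A := hid A;
  c1 A B C f g := hc f g |}.

Definition hor_ops (D : DblOps) : TwoOps := {|
  pre2 := hor_pre D;
  c1A A B C E f g h := @hcA D A B C E f g h;
  c1l A B f := @hcl D A B f;
  c1r A B f := @hcr D A B f;
  i2 A B f := id_h f;
  v2 A B f g h s t := sqcast eq_refl (vcl _) (vcl _) eq_refl (s /// t);
  h2 A B C f f' g g' s t := ⟦ s | t ⟧ |}.

Lemma sqeq_refl (D : DblOps) (A B A' B' : D) (f : hh A B) (u : vv A A')
  (v : vv B B') (g : hh A' B') (s : sq f u v g) : s ≋ s.
Proof. now exists eq_refl, eq_refl, eq_refl, eq_refl. Qed.

Lemma sqeq_sym (D : DblOps) (A B A' B' : D) (f f1 : hh A B) (u u1 : vv A A')
  (v v1 : vv B B') (g g1 : hh A' B') (s : sq f u v g) (s1 : sq f1 u1 v1 g1) :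
  s ≋ s1 -> s1 ≋ s.
Proof.
  intros (ef & eu & ev & eg & e); destruct ef, eu, ev, eg; cbn in e; subst.
  apply sqeq_refl.
Qed.

Lemma sqeq_trans (D : DblOps) (A B A' B' : D) (f f1 f2 : hh A B) (u u1 u2 : vv A A')
  (v v1 v2 : vv B B') (g g1 g2 : hh A' B') (s : sq f u v g) (s1 : sq f1 u1 v1 g1)
  (s2 : sq f2 u2 v2 g2) : s ≋ s1 -> s1 ≋ s2 -> s ≋ s2.
Proof.
  intros (ef & eu & ev & eg & e); destruct ef, eu, ev, eg; cbn in e; subst; auto.
Qed.

Lemma sqeq_eq (D : DblOps) (A B A' B' : D) (f : hh A B) (u : vv A A')
  (v : vv B B') (g : hh A' B') (s s1 : sq f u v g) : s ≋ s1 -> s = s1.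
Proof.
  intros (ef & eu & ev & eg & e).
  rewrite (UIP_refl _ _ ef), (UIP_refl _ _ eu), (UIP_refl _ _ ev), (UIP_refl _ _ eg) in e.
  exact e.
Qed.

Lemma sqcast_eq (D : DblOps) (A B A' B' : D) (f f1 : hh A B) (u u1 : vv A A')
  (v v1 : vv B B') (g g1 : hh A' B') (ef : f = f1) (eu : u = u1) (ev : v = v1)
  (eg : g = g1) (s : sq f u v g) : sqcast ef eu ev eg s ≋ s.
Proof. destruct ef, eu, ev, eg; apply sqeq_refl. Qed.

Lemma sqh_eq (D : DblOps) (A B C A' B' C' : D) (f f1 : hh A B) (g g1 : hh B C)
  (u u1 : vv A A') (v v1 : vv B B') (w w1 : vv C C') (f' f1' : hh A' B')
  (g' g1' : hh B' C') (s : sq f u v f') (t : sq g v w g') (s1 : sq f1 u1 v1 f1')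
  (t1 : sq g1 v1 w1 g1') : s ≋ s1 -> t ≋ t1 -> ⟦ s | t ⟧ ≋ ⟦ s1 | t1 ⟧.
Proof.
  intros (ef & eu & ev & eg & e) (ef' & eu' & ev' & eg' & e').
  destruct ef, eu, ev, eg, ef', ev', eg'; cbn in e; subst.
  rewrite (UIP_refl _ _ eu'); apply sqeq_refl.
Qed.

Lemma sqv_eq (D : DblOps) (A B A' B' A'' B'' : D) (f f1 : hh A B) (u u1 : vv A A')
  (v v1 : vv B B') (g g1 : hh A' B') (u' u1' : vv A' A'') (v' v1' : vv B' B'')
  (h h1 : hh A'' B'') (s : sq f u v g) (t : sq g u' v' h) (s1 : sq f1 u1 v1 g1)
  (t1 : sq g1 u1' v1' h1) : s ≋ s1 -> t ≋ t1 -> s /// t ≋ s1 /// t1.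
Proof.
  intros (ef & eu & ev & eg & e) (ef' & eu' & ev' & eg' & e').
  destruct ef, eu, ev, eg, eu', ev', eg'; cbn in e; subst.
  rewrite (UIP_refl _ _ ef'); apply sqeq_refl.
Qed.

Lemma sqeq_eq2 (D : DblOps) (A B : D) (f f1 g g1 : hh A B)
  (s : sq f (vid A) (vid B) g) (s1 : sq f1 (vid A) (vid B) g1) :
  s ≋ s1 -> @eq2 (hor_pre D) A B f g f1 g1 s s1.
Proof.
  intros (ef & eu & ev & eg & e); exists ef, eg; destruct ef, eg.
  rewrite (UIP_refl _ _ eu), (UIP_refl _ _ ev) in e; exact e.
Qed.

Lemma hor_laws (D : DoubleCat) : is_two_category (hor_ops D).
Proof.
  destruct D as [D L]; cbn.
  assert (V : forall (A B : D) (f g h : hh A B) (s : sq f (vid A) (vid B) g)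
      (t : sq g (vid A) (vid B) h), @v2 (hor_ops D) A B f g h s t ≋ s /// t)
    by (intros; apply sqcast_eq).
  split; intros.
  - apply sqeq_eq.
    eapply sqeq_trans; [apply V|].
    eapply sqeq_trans; [apply sqv_eq; [apply V|apply sqeq_refl]|].
    eapply sqeq_trans; [apply (sqvA L)|].
    apply sqeq_sym; eapply sqeq_trans; [apply V|].
    apply sqv_eq; [apply sqeq_refl|apply V].
  - apply sqeq_eq; eapply sqeq_trans; [apply V|]; apply (sqvl L).
  - apply sqeq_eq; eapply sqeq_trans; [apply V|]; apply (sqvr L).
  - apply sqeq_eq.
    eapply sqeq_trans; [apply sqh_eq; apply V|].
    apply sqeq_sym; eapply sqeq_trans; [apply V|].
    cbn; rewrite (interchange L); apply sqeq_refl.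
  - apply (id_h_hc L).
  - apply sqeq_eq2, (sqhA L).
  - apply sqeq_eq2; cbn; rewrite (id_hv L); apply (sqhl L).
  - apply sqeq_eq2; cbn; rewrite (id_hv L); apply (sqhr L).
Qed.

Record DMap (D E : DblOps) : Type := {
  dmap :> Map (hor_pre D) (hor_pre E);
  mv : forall A B : D, vv A B -> @vv E (dmap A) (dmap B) }.

Arguments mv {D E} d {A B} u.

Definition id_dmap D : DMap D D := {| dmap := id_map (hor_pre D); mv A B u := u |}.
Definition comp_dmap D E F (H : DMap E F) (G : DMap D E) : DMap D F :=
  {| dmap := comp_map H G; mv A B u := mv H (mv G u) |}.
Definition pair_dmap D E F (G : DMap D E) (H : DMap D F) : DMap D (prod_dbl E F) :=
  @Build_DMap D (prod_dbl E F) (pair_map G H) (fun A B u => (mv G u, mv H u)).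
Definition fst_dmap D E : DMap (prod_dbl D E) D :=
  @Build_DMap (prod_dbl D E) D (fst_map (hor_pre D) (hor_pre E)) (fun A B u => fst u).
Definition snd_dmap D E : DMap (prod_dbl D E) E :=
  @Build_DMap (prod_dbl D E) E (snd_map (hor_pre D) (hor_pre E)) (fun A B u => snd u).
Definition one_dmap D : DMap D one_dbl :=
  @Build_DMap D one_dbl (one_map (hor_pre D)) (fun A B u => tt).

(** The part of a pseudodouble functor [F] involving only [H(-)] is the field
    [hfun], which is [H(F)]. The action [fs] on squares extends that of [hfun]
    on horizontally globular 2-cells (see [fs_f2]). *)
Record DFun (D E : DblOps) : Type := {
  hfun :> PsFun (hor_pre D) (hor_pre E);
  fv : forall A B : D, vv A B -> @vv E (hfun A) (hfun B);
  fv_id : forall A : D, fv (vid A) = vid (hfun A);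
  fv_vc : forall (A B C : D) (u : vv A B) (v : vv B C), fv (u // v) = fv u // fv v;
  fs : forall (A B A' B' : D) (f : hh A B) (u : vv A A') (v : vv B B') (g : hh A' B'),
      sq f u v g -> @sq E _ _ _ _ (m1 hfun f) (fv u) (fv v) (m1 hfun g) }.

Arguments fv {D E} d {A B} u.
Arguments fs {D E} d {A B A' B' f u v g} s.

Definition dfun_dmap D E (F : DFun D E) : DMap D E :=
  {| dmap := F; mv A B u := fv F u |}.
Coercion dfun_dmap : DFun >-> DMap.

Section DoubleFunctorLaws.
Context {D E : DblOps} (F : DFun D E).

Definition sph {A B C : D} (f : hh A B) (g : hh B C) :
  @sq E _ _ _ _ (hc (m1 F f) (m1 F g : hh (F B) (F C))) (vid _) (vid _) (m1 F (hc f g)) :=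
  @ph _ _ F A B C f g.
Definition sph0 (A : D) : @sq E _ _ _ _ (hid (F A)) (vid _) (vid _) (m1 F (hid A)) :=
  @ph0 _ _ F A.
Definition sph0i (A : D) : @sq E _ _ _ _ (m1 F (hid A)) (vid _) (vid _) (hid (F A)) :=
  @ph0i _ _ F A.

Record is_double_functor : Prop := {
  df_hor : @is_psfun (hor_ops D) (hor_ops E) F;
  fs_f2 : forall (A B : D) (f g : hh A B) (s : sq f (vid A) (vid B) g),
      fs F s ≋ (@f2 _ _ F A B f g s : @sq E _ _ _ _ (m1 F f) (vid _) (vid _) (m1 F g));
  fs_id_h : forall (A B : D) (f : hh A B),
      fs F (id_h f) ≋ @id_h E _ _ (m1 F f);
  fs_sqv : forall (A B A' B' A'' B'' : D) (f : hh A B) (u : vv A A') (v : vv B B')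
      (g : hh A' B') (u' : vv A' A'') (v' : vv B' B'') (h : hh A'' B'')
      (s : sq f u v g) (t : sq g u' v' h),
      fs F (s /// t) ≋ fs F s /// fs F t;
  sph_nat : forall (A B C A' B' C' : D) (f : hh A B) (g : hh B C) (u : vv A A')
      (v : vv B B') (w : vv C C') (f' : hh A' B') (g' : hh B' C')
      (s : sq f u v f') (t : sq g v w g'),
      ⟦ fs F s | fs F t ⟧ /// sph f' g' ≋ sph f g /// fs F ⟦ s | t ⟧;
  sph0_nat : forall (A B : D) (u : vv A B),
      id_v (fv F u) /// sph0 B ≋ sph0 A /// fs F (id_v u) }.
End DoubleFunctorLaws.

Record PseudoDoubleFunctor (D E : DblOps) : Type := {
  pdf :> DFun D E;
  pdf_laws : is_double_functor pdf }.

Definition id_dfun (D : DblOps) : DFun D D := {|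
  hfun := id_fun (hor_ops D);
  fv A B u := u;
  fv_id A := eq_refl;
  fv_vc A B C u v := eq_refl;
  fs A B A' B' f u v g s := s |}.

Definition comp_dfun (D E F : DblOps) (H : DFun E F) (G : DFun D E) : DFun D F.
Proof.
  refine (@Build_DFun D F (@comp_fun _ _ (hor_ops F) H G)
    (fun A B u => fv H (fv G u)) _ _
    (fun A B A' B' f u v g s => fs H (fs G s))).
  - intros A; exact (eq_trans (f_equal (fv H) (fv_id G A)) (fv_id H (G A))).
  - intros A B C u v.
    exact (eq_trans (f_equal (fv H) (fv_vc G u v)) (fv_vc H (fv G u) (fv G v))).
Defined.

Definition pair_dfun (D E F : DblOps) (G : DFun D E) (H : DFun D F) :
  DFun D (prod_dbl E F).
Proof.
  refine (@Build_DFun D (prod_dbl E F) (pair_fun G H)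
    (fun A B u => (fv G u, fv H u)) _ _
    (fun A B A' B' f u v g s => (fs G s, fs H s))).
  - intros A; cbn; now rewrite (fv_id G), (fv_id H).
  - intros A B C u v; cbn; now rewrite (fv_vc G), (fv_vc H).
Defined.

Definition fst_dfun (D E : DblOps) : DFun (prod_dbl D E) D :=
  @Build_DFun (prod_dbl D E) D (fst_fun (hor_ops D) (hor_pre E))
    (fun A B u => fst u) (fun A => eq_refl) (fun A B C u v => eq_refl)
    (fun A B A' B' f u v g s => fst s).
Definition snd_dfun (D E : DblOps) : DFun (prod_dbl D E) E :=
  @Build_DFun (prod_dbl D E) E (snd_fun (hor_pre D) (hor_ops E))
    (fun A B u => snd u) (fun A => eq_refl) (fun A B C u v => eq_refl)
    (fun A B A' B' f u v g s => snd s).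
Definition one_dfun (D : DblOps) : DFun D one_dbl :=
  @Build_DFun D one_dbl (one_fun (hor_pre D))
    (fun A B u => tt) (fun A => eq_refl) (fun A B C u v => eq_refl)
    (fun A B A' B' f u v g s => tt).

(** [hnat] is [H(α)]; [hs α u] is the square [α^u]. *)
Record HNat (D E : DblOps) (F G : DMap D E) : Type := {
  hnat :> @PsNat (hor_pre D) (hor_pre E) F G;
  hs : forall (A B : D) (u : vv A B), @sq E _ _ _ _ (hnat A) (mv F u) (mv G u) (hnat B) }.

Arguments hs {D E F G} h {A B} u.

Section HorizontalLaws.
Context {D E : DblOps}.

Definition hδ {F G : DMap D E} (α : HNat F G) {A B : D} (f : hh A B) :
  @sq E _ _ _ _ (hc (m1 F f : hh (F A) (F B)) (α B)) (vid _) (vid _)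
                (hc (α A) (m1 G f : hh (G A) (G B))) :=
  @nd _ _ _ _ α A B f.

Record is_horizontal_transformation (F G : DFun D E) (α : HNat F G) : Prop := {
  ht_psnat : @is_psnat (hor_ops D) (hor_ops E) F G α;
  ht_vid : forall A : D, hs α (vid A) ≋ @id_h E _ _ (α A);
  ht_vc : forall (A B C : D) (u : vv A B) (v : vv B C),
      hs α (u // v) ≋ hs α u /// hs α v;
  ht_nat : forall (A B A' B' : D) (f : hh A B) (u : vv A A') (v : vv B B')
      (g : hh A' B') (s : sq f u v g),
      ⟦ fs F s | hs α v ⟧ /// hδ α g ≋ hδ α f /// ⟦ hs α u | fs G s ⟧ }.

Definition is_horizontal_modification (F G : DMap D E) (α β : HNat F G)
  (γ : Cells α β) : Prop :=
  @is_modification (hor_pre D) (hor_ops E) F G α β γ /\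
  forall (A B : D) (u : vv A B),
    (γ A : @sq E _ _ _ _ (α A) (vid _) (vid _) (β A)) /// hs β u
    ≋ hs α u /// (γ B : @sq E _ _ _ _ (α B) (vid _) (vid _) (β B)).

Definition is_invertible_hmod (F G : DMap D E) (α β : HNat F G)
  (γ : Cells α β) : Prop :=
  is_horizontal_modification γ /\ @all_invertible (hor_pre D) (hor_ops E) F G α β γ.

Definition is_horizontal_equivalence (F G : DMap D E) (α : HNat F G) : Prop :=
  forall A : D, @is_equivalence (hor_ops E) (F A) (G A) (α A).
End HorizontalLaws.

Definition comp_hnat (D E : DblOps) (F G H : DMap D E) (α : HNat F G) (β : HNat G H) :
  HNat F H :=
  @Build_HNat D E F H (@comp_nat _ (hor_ops E) F G H α β)
    (fun A B u => ⟦ hs α u | hs β u ⟧).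
Definition id_hnat (D E : DblOps) (F : DMap D E) : HNat F F :=
  @Build_HNat D E F F (@id_nat _ (hor_ops E) F) (fun A B u => id_v (mv F u)).
Definition post_hnat (D E E' : DblOps) (T : DFun E E') (F G : DMap D E)
  (α : HNat F G) : HNat (comp_dmap T F) (comp_dmap T G) :=
  @Build_HNat D E' (comp_dmap T F) (comp_dmap T G)
    (@post_nat _ _ (hor_ops E') T F G α) (fun A B u => fs T (hs α u)).
Definition pre_hnat (D D' E : DblOps) (F G : DMap D' E) (α : HNat F G)
  (K : DMap D D') : HNat (comp_dmap F K) (comp_dmap G K) :=
  @Build_HNat D E (comp_dmap F K) (comp_dmap G K)
    (pre_nat α K) (fun A B u => hs α (mv K u)).
Definition pair_hnat (D E E' : DblOps) (F G : DMap D E) (F' G' : DMap D E')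
  (α : HNat F G) (β : HNat F' G') : HNat (pair_dmap F F') (pair_dmap G G') :=
  @Build_HNat D (prod_dbl E E') (pair_dmap F F') (pair_dmap G G')
    (pair_nat α β) (fun A B u => (hs α u, hs β u)).

Notation "D '²⁻'" := (prod_dbl D D) (at level 2, format "D '²⁻'") : square_scope.
Notation "D '³⁻'" := (prod_dbl (prod_dbl D D) D)
  (at level 2, format "D '³⁻'") : square_scope.
Notation "D '⁴⁻'" := (prod_dbl (prod_dbl (prod_dbl D D) D) D)
  (at level 2, format "D '⁴⁻'") : square_scope.

Section DoubleVariables.
Context {D : DblOps}.
Definition d1_2 : DMap D²⁻ D := fst_dmap D D.
Definition d2_2 : DMap D²⁻ D := snd_dmap D D.
Definition d1_3 : DMap D³⁻ D := comp_dmap d1_2 (fst_dmap D²⁻ D).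
Definition d2_3 : DMap D³⁻ D := comp_dmap d2_2 (fst_dmap D²⁻ D).
Definition d3_3 : DMap D³⁻ D := snd_dmap D²⁻ D.
Definition d1_4 : DMap D⁴⁻ D := comp_dmap d1_3 (fst_dmap D³⁻ D).
Definition d2_4 : DMap D⁴⁻ D := comp_dmap d2_3 (fst_dmap D³⁻ D).
Definition d3_4 : DMap D⁴⁻ D := comp_dmap d3_3 (fst_dmap D³⁻ D).
Definition d4_4 : DMap D⁴⁻ D := snd_dmap D³⁻ D.
Definition D1_2 : DFun D²⁻ D := fst_dfun D D.
Definition D2_2 : DFun D²⁻ D := snd_dfun D D.
Definition D1_3 : DFun D³⁻ D := comp_dfun D1_2 (fst_dfun D²⁻ D).
Definition D2_3 : DFun D³⁻ D := comp_dfun D2_2 (fst_dfun D²⁻ D).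
Definition D3_3 : DFun D³⁻ D := snd_dfun D²⁻ D.
End DoubleVariables.

Section DoubleTensor.
Context {D : DblOps} (ten : DFun D²⁻ D) (unt : DFun one_dbl D).
Definition ten_dmap (X : DblOps) (F G : DMap X D) : DMap X D :=
  comp_dmap ten (pair_dmap F G).
Definition unt_dmap (X : DblOps) : DMap X D := comp_dmap unt (one_dmap X).
Definition ten_dfun (X : DblOps) (F G : DFun X D) : DFun X D :=
  comp_dfun ten (pair_dfun F G).
Definition unt_dfun (X : DblOps) : DFun X D := comp_dfun unt (one_dfun X).
Definition ten_hnat (X : DblOps) (F G F' G' : DMap X D)
  (α : HNat F G) (β : HNat F' G') : HNat (ten_dmap F F') (ten_dmap G G') :=
  post_hnat ten (pair_hnat α β).
End DoubleTensor.

Record HMonCore (D : DblOps) : Type := {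
  hten : DFun D²⁻ D;
  hunt : DFun one_dbl D;
  hass : HNat (ten_dmap hten (ten_dmap hten d1_3 d2_3) d3_3)
              (ten_dmap hten d1_3 (ten_dmap hten d2_3 d3_3));
  hlun : HNat (ten_dmap hten (unt_dmap hunt D) (id_dmap D)) (id_dmap D);
  hrun : HNat (ten_dmap hten (id_dmap D) (unt_dmap hunt D)) (id_dmap D) }.

Section HMonCells.
Context {D : DblOps} (M : HMonCore D).

Local Notation "F ⊠ G" := (ten_dmap (hten M) F G) (at level 39, left associativity).
Local Notation "α ⊠' β" := (ten_hnat (hten M) α β) (at level 39, left associativity).
Local Notation "1_[ F ]" := (id_hnat F) (format "1_[ F ]").

Definition hass_at (X : DblOps) (F G H : DMap X D) :
  HNat (F ⊠ G ⊠ H) (F ⊠ (G ⊠ H)) :=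
  pre_hnat (hass M) (pair_dmap (pair_dmap F G) H).
Definition hlun_at (X : DblOps) (F : DMap X D) : HNat (unt_dmap (hunt M) X ⊠ F) F :=
  pre_hnat (hlun M) F.
Definition hrun_at (X : DblOps) (F : DMap X D) : HNat (F ⊠ unt_dmap (hunt M) X) F :=
  pre_hnat (hrun M) F.

Definition hpent_src : HNat (d1_4 ⊠ d2_4 ⊠ d3_4 ⊠ d4_4)
                            (d1_4 ⊠ (d2_4 ⊠ (d3_4 ⊠ d4_4))) :=
  comp_hnat (comp_hnat (hass_at d1_4 d2_4 d3_4 ⊠' 1_[d4_4])
                       (hass_at d1_4 (d2_4 ⊠ d3_4) d4_4))
            (1_[d1_4] ⊠' hass_at d2_4 d3_4 d4_4).
Definition hpent_tgt : HNat (d1_4 ⊠ d2_4 ⊠ d3_4 ⊠ d4_4)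
                            (d1_4 ⊠ (d2_4 ⊠ (d3_4 ⊠ d4_4))) :=
  comp_hnat (hass_at (d1_4 ⊠ d2_4) d3_4 d4_4) (hass_at d1_4 d2_4 (d3_4 ⊠ d4_4)).
Definition hmid_src : HNat (d1_2 ⊠ unt_dmap (hunt M) D²⁻ ⊠ d2_2) (d1_2 ⊠ d2_2) :=
  comp_hnat (hass_at d1_2 (unt_dmap (hunt M) D²⁻) d2_2) (1_[d1_2] ⊠' hlun_at d2_2).
Definition hmid_tgt : HNat (d1_2 ⊠ unt_dmap (hunt M) D²⁻ ⊠ d2_2) (d1_2 ⊠ d2_2) :=
  hrun_at d1_2 ⊠' 1_[d2_2].
Definition hleft_src : HNat (unt_dmap (hunt M) D²⁻ ⊠ d1_2 ⊠ d2_2) (d1_2 ⊠ d2_2) :=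
  hlun_at d1_2 ⊠' 1_[d2_2].
Definition hleft_tgt : HNat (unt_dmap (hunt M) D²⁻ ⊠ d1_2 ⊠ d2_2) (d1_2 ⊠ d2_2) :=
  comp_hnat (hass_at (unt_dmap (hunt M) D²⁻) d1_2 d2_2) (hlun_at (d1_2 ⊠ d2_2)).
Definition hright_src : HNat (d1_2 ⊠ d2_2 ⊠ unt_dmap (hunt M) D²⁻) (d1_2 ⊠ d2_2) :=
  hrun_at (d1_2 ⊠ d2_2).
Definition hright_tgt : HNat (d1_2 ⊠ d2_2 ⊠ unt_dmap (hunt M) D²⁻) (d1_2 ⊠ d2_2) :=
  comp_hnat (hass_at d1_2 d2_2 (unt_dmap (hunt M) D²⁻)) (1_[d1_2] ⊠' hrun_at d2_2).
End HMonCells.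

Record HMonData (D : DblOps) : Type := {
  hcore :> HMonCore D;
  hpent : Cells (hpent_src hcore) (hpent_tgt hcore);
  hmid : Cells (hmid_src hcore) (hmid_tgt hcore);
  hlft : Cells (hleft_src hcore) (hleft_tgt hcore);
  hrgt : Cells (hright_src hcore) (hright_tgt hcore) }.

Definition hor_mon_core (D : DblOps) (M : HMonCore D) : MonCore (hor_ops D) :=
  @Build_MonCore (hor_ops D) (hten M) (hunt M) (hass M) (hlun M) (hrun M).
Definition hor_mon (D : DblOps) (M : HMonData D) : MonData (hor_ops D) :=
  @Build_MonData (hor_ops D) (hor_mon_core M) (hpent M) (hmid M) (hlft M) (hrgt M).

Record is_horizontally_monoidal (D : DblOps) (M : HMonData D) : Prop := {
  hm_ten : is_double_functor (hten M);
  hm_unt : is_double_functor (hunt M);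
  hm_ass : @is_horizontal_transformation _ _
             (ten_dfun (hten M) (ten_dfun (hten M) D1_3 D2_3) D3_3)
             (ten_dfun (hten M) D1_3 (ten_dfun (hten M) D2_3 D3_3)) (hass M);
  hm_lun : @is_horizontal_transformation _ _
             (ten_dfun (hten M) (unt_dfun (hunt M) D) (id_dfun D)) (id_dfun D) (hlun M);
  hm_run : @is_horizontal_transformation _ _
             (ten_dfun (hten M) (id_dfun D) (unt_dfun (hunt M) D)) (id_dfun D) (hrun M);
  hm_ass_eq : is_horizontal_equivalence (hass M);
  hm_lun_eq : is_horizontal_equivalence (hlun M);
  hm_run_eq : is_horizontal_equivalence (hrun M);
  hm_pent : is_invertible_hmod (hpent M);
  hm_mid : is_invertible_hmod (hmid M);
  hm_lft : is_invertible_hmod (hlft M);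
  hm_rgt : is_invertible_hmod (hrgt M);
  hm_axioms : monoidal_axioms (hor_mon M) }.

Record HMonadCore (D : DblOps) : Type := {
  hT : DFun D D;
  hmu : HNat (comp_dmap hT hT) hT;
  heta : HNat (id_dmap D) hT }.

Section HMonadCells.
Context {D : DblOps} (T : HMonadCore D).
Definition hmassoc_src : HNat (comp_dmap (hT T) (comp_dmap (hT T) (hT T))) (hT T) :=
  comp_hnat (post_hnat (hT T) (hmu T)) (hmu T).
Definition hmassoc_tgt : HNat (comp_dmap (hT T) (comp_dmap (hT T) (hT T))) (hT T) :=
  comp_hnat (pre_hnat (hmu T) (hT T)) (hmu T).
Definition hmright_src : HNat (hT T) (hT T) :=
  comp_hnat (pre_hnat (heta T) (hT T)) (hmu T).
Definition hmleft_src : HNat (hT T) (hT T) :=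
  comp_hnat (post_hnat (hT T) (heta T)) (hmu T).
Definition hmunit_tgt : HNat (hT T) (hT T) := id_hnat (hT T).
End HMonadCells.

Record HMonadData (D : DblOps) : Type := {
  hmcore :> HMonadCore D;
  hTa : Cells (hmassoc_src hmcore) (hmassoc_tgt hmcore);
  hTr : Cells (hmright_src hmcore) (hmunit_tgt hmcore);
  hTl : Cells (hmleft_src hmcore) (hmunit_tgt hmcore) }.

Definition hor_monad_core (D : DblOps) (T : HMonadCore D) : MonadCore (hor_ops D) :=
  @Build_MonadCore (hor_ops D) (hT T) (hmu T) (heta T).
Definition hor_monad (D : DblOps) (T : HMonadData D) : MonadData (hor_ops D) :=
  @Build_MonadData (hor_ops D) (hor_monad_core T) (hTa T) (hTr T) (hTl T).

Record is_horizontal_double_monad (D : DblOps) (T : HMonadData D) : Prop := {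
  hm_fun : is_double_functor (hT T);
  hm_mu : @is_horizontal_transformation _ _ (comp_dfun (hT T) (hT T)) (hT T) (hmu T);
  hm_eta : @is_horizontal_transformation _ _ (id_dfun D) (hT T) (heta T);
  hm_a : is_invertible_hmod (hTa T);
  hm_r : is_invertible_hmod (hTr T);
  hm_l : is_invertible_hmod (hTl T);
  hm_monad_axioms : pseudomonad_axioms (hor_monad T) }.

Section HStrengthCells.
Context {D : DblOps} (M : HMonCore D) (T : HMonadCore D).

Local Notation "F ⊠ G" := (ten_dmap (hten M) F G) (at level 39, left associativity).
Local Notation "α ⊠' β" := (ten_hnat (hten M) α β) (at level 39, left associativity).
Local Notation "1_[ F ]" := (id_hnat F) (format "1_[ F ]").
Local Notation "'T∘' F" := (comp_dmap (hT T) F) (at level 38, right associativity).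

Definition HLNat : Type := HNat (d1_2 ⊠ T∘ d2_2) (T∘ (d1_2 ⊠ d2_2)).
Definition HRNat : Type := HNat (T∘ d1_2 ⊠ d2_2) (T∘ (d1_2 ⊠ d2_2)).

Section Left.
Variable t : HLNat.
Definition ht_at (X : DblOps) (F G : DMap X D) : HNat (F ⊠ T∘ G) (T∘ (F ⊠ G)) :=
  pre_hnat t (pair_dmap F G).
Definition hlx_src : HNat (unt_dmap (hunt M) D ⊠ T∘ id_dmap D) (T∘ id_dmap D) :=
  comp_hnat (ht_at (unt_dmap (hunt M) D) (id_dmap D)) (post_hnat (hT T) (hlun M)).
Definition hlx_tgt : HNat (unt_dmap (hunt M) D ⊠ T∘ id_dmap D) (T∘ id_dmap D) :=
  hlun_at M (T∘ id_dmap D).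
Definition hly_src : HNat (d1_3 ⊠ d2_3 ⊠ T∘ d3_3) (T∘ (d1_3 ⊠ (d2_3 ⊠ d3_3))) :=
  comp_hnat (ht_at (d1_3 ⊠ d2_3) d3_3) (post_hnat (hT T) (hass M)).
Definition hly_tgt : HNat (d1_3 ⊠ d2_3 ⊠ T∘ d3_3) (T∘ (d1_3 ⊠ (d2_3 ⊠ d3_3))) :=
  comp_hnat (comp_hnat (hass_at M d1_3 d2_3 (T∘ d3_3)) (1_[d1_3] ⊠' ht_at d2_3 d3_3))
            (ht_at d1_3 (d2_3 ⊠ d3_3)).
Definition hlw_src : HNat (d1_2 ⊠ T∘ T∘ d2_2) (T∘ (d1_2 ⊠ d2_2)) :=
  comp_hnat (comp_hnat (ht_at d1_2 (T∘ d2_2)) (post_hnat (hT T) t))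
            (pre_hnat (hmu T) (d1_2 ⊠ d2_2)).
Definition hlw_tgt : HNat (d1_2 ⊠ T∘ T∘ d2_2) (T∘ (d1_2 ⊠ d2_2)) :=
  comp_hnat (1_[d1_2] ⊠' pre_hnat (hmu T) d2_2) t.
Definition hlz_src : HNat (d1_2 ⊠ d2_2) (T∘ (d1_2 ⊠ d2_2)) :=
  comp_hnat (1_[d1_2] ⊠' pre_hnat (heta T) d2_2) t.
Definition hlz_tgt : HNat (d1_2 ⊠ d2_2) (T∘ (d1_2 ⊠ d2_2)) :=
  pre_hnat (heta T) (d1_2 ⊠ d2_2).
End Left.

Section Right.
Variable s : HRNat.
Definition hs_at (X : DblOps) (F G : DMap X D) : HNat (T∘ F ⊠ G) (T∘ (F ⊠ G)) :=
  pre_hnat s (pair_dmap F G).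
Definition hrx_src : HNat (T∘ id_dmap D ⊠ unt_dmap (hunt M) D) (T∘ id_dmap D) :=
  comp_hnat (hs_at (id_dmap D) (unt_dmap (hunt M) D)) (post_hnat (hT T) (hrun M)).
Definition hrx_tgt : HNat (T∘ id_dmap D ⊠ unt_dmap (hunt M) D) (T∘ id_dmap D) :=
  hrun_at M (T∘ id_dmap D).
Definition hry_src : HNat (T∘ d1_3 ⊠ d2_3 ⊠ d3_3) (T∘ (d1_3 ⊠ (d2_3 ⊠ d3_3))) :=
  comp_hnat (comp_hnat (hs_at d1_3 d2_3 ⊠' 1_[d3_3]) (hs_at (d1_3 ⊠ d2_3) d3_3))
            (post_hnat (hT T) (hass M)).
Definition hry_tgt : HNat (T∘ d1_3 ⊠ d2_3 ⊠ d3_3) (T∘ (d1_3 ⊠ (d2_3 ⊠ d3_3))) :=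
  comp_hnat (hass_at M (T∘ d1_3) d2_3 d3_3) (hs_at d1_3 (d2_3 ⊠ d3_3)).
Definition hrw_src : HNat (T∘ T∘ d1_2 ⊠ d2_2) (T∘ (d1_2 ⊠ d2_2)) :=
  comp_hnat (comp_hnat (hs_at (T∘ d1_2) d2_2) (post_hnat (hT T) s))
            (pre_hnat (hmu T) (d1_2 ⊠ d2_2)).
Definition hrw_tgt : HNat (T∘ T∘ d1_2 ⊠ d2_2) (T∘ (d1_2 ⊠ d2_2)) :=
  comp_hnat (pre_hnat (hmu T) d1_2 ⊠' 1_[d2_2]) s.
Definition hrz_src : HNat (d1_2 ⊠ d2_2) (T∘ (d1_2 ⊠ d2_2)) :=
  comp_hnat (pre_hnat (heta T) d1_2 ⊠' 1_[d2_2]) s.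
Definition hrz_tgt : HNat (d1_2 ⊠ d2_2) (T∘ (d1_2 ⊠ d2_2)) :=
  pre_hnat (heta T) (d1_2 ⊠ d2_2).
End Right.
End HStrengthCells.

Record HLStrData (D : DblOps) (M : HMonCore D) (T : HMonadCore D) : Type := {
  hlt : HLNat M T;
  hlx : Cells (hlx_src hlt) (hlx_tgt M T);
  hly : Cells (hly_src hlt) (hly_tgt hlt);
  hlw : Cells (hlw_src hlt) (hlw_tgt hlt);
  hlz : Cells (hlz_src hlt) (hlz_tgt M T) }.

Record HRStrData (D : DblOps) (M : HMonCore D) (T : HMonadCore D) : Type := {
  hrs : HRNat M T;
  hrx : Cells (hrx_src hrs) (hrx_tgt M T);
  hry : Cells (hry_src hrs) (hry_tgt hrs);
  hrw : Cells (hrw_src hrs) (hrw_tgt hrs);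
  hrz : Cells (hrz_src hrs) (hrz_tgt M T) }.

Definition hor_lstr (D : DblOps) (M : HMonData D) (T : HMonadData D)
  (S : HLStrData M T) : LStrData (hor_mon M) (hor_monad T) :=
  @Build_LStrData (hor_ops D) (hor_mon M) (hor_monad T)
    (hlt S) (hlx S) (hly S) (hlw S) (hlz S).
Definition hor_rstr (D : DblOps) (M : HMonData D) (T : HMonadData D)
  (S : HRStrData M T) : RStrData (hor_mon M) (hor_monad T) :=
  @Build_RStrData (hor_ops D) (hor_mon M) (hor_monad T)
    (hrs S) (hrx S) (hry S) (hrw S) (hrz S).

Record is_left_horizontal_strength (D : DblOps) (M : HMonData D) (T : HMonadData D)
  (S : HLStrData M T) : Prop := {
  hls_nat : @is_horizontal_transformation _ _
              (ten_dfun (hten M) D1_2 (comp_dfun (hT T) D2_2))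
              (comp_dfun (hT T) (ten_dfun (hten M) D1_2 D2_2)) (hlt S);
  hls_x : is_invertible_hmod (hlx S);
  hls_y : is_invertible_hmod (hly S);
  hls_w : is_invertible_hmod (hlw S);
  hls_z : is_invertible_hmod (hlz S);
  hls_axioms : left_strength_axioms (hor_lstr S) }.

Record is_right_horizontal_strength (D : DblOps) (M : HMonData D) (T : HMonadData D)
  (S : HRStrData M T) : Prop := {
  hrs_nat : @is_horizontal_transformation _ _
              (ten_dfun (hten M) (comp_dfun (hT T) D1_2) D2_2)
              (comp_dfun (hT T) (ten_dfun (hten M) D1_2 D2_2)) (hrs S);
  hrs_x : is_invertible_hmod (hrx S);
  hrs_y : is_invertible_hmod (hry S);
  hrs_w : is_invertible_hmod (hrw S);
  hrs_z : is_invertible_hmod (hrz S);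
  hrs_axioms : right_strength_axioms (hor_rstr S) }.

(** [vs α f] is the square [α_f]. *)
Record VNat (D E : DblOps) (F G : DFun D E) : Type := {
  vt :> forall A : D, @vv E (F A) (G A);
  vs : forall (A B : D) (f : hh A B), @sq E _ _ _ _ (m1 F f) (vt A) (vt B) (m1 G f);
  vt_nat : forall (A B : D) (u : vv A B), fv F u // vt B = vt A // fv G u;
  vs_nat : forall (A B A' B' : D) (f : hh A B) (u : vv A A') (v : vv B B')
      (g : hh A' B') (s : sq f u v g), fs F s /// vs g ≋ vs f /// fs G s;
  vs_ph : forall (A B C : D) (f : hh A B) (g : hh B C),
      sph F f g /// vs (hc f g) ≋ ⟦ vs f | vs g ⟧ /// sph G f g;
  vs_ph0 : forall A : D, sph0 F A /// vs (hid A) ≋ id_v (vt A) /// sph0 G A }.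

Arguments vt {D E F G} _ A.
Arguments vs {D E F G} _ {A B} f.

(** Vertical inverses of squares are unique, so nothing is lost by recording
    them as data. *)
Record VInverse (D : DblOps) (A B A' B' : D) (f : hh A B) (u : vv A A')
  (v : vv B B') (g : hh A' B') (s : sq f u v g) : Type := {
  inv_l : vv A' A;
  inv_r : vv B' B;
  inv_sq : sq g inv_l inv_r f;
  inv_sqr : s /// inv_sq ≋ id_h f;
  inv_sql : inv_sq /// s ≋ id_h g }.

Definition VInvertible (D E : DblOps) (F G : DFun D E) (α : VNat F G) : Type :=
  forall (A B : D) (f : hh A B), VInverse (vs α f).

Record CompanionData (D : DblOps) (A B : D) (u : vv A B) : Type := {
  ch : hh A B;
  cε : sq ch u (vid B) (hid B);
  cι : sq (hid A) (vid A) u ch }.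

Record Companion (D : DblOps) (A B : D) (u : vv A B) : Type := {
  comp_data :> CompanionData u;
  comp_h : ⟦ cι comp_data | cε comp_data ⟧ ≋ id_h (ch comp_data);
  comp_v : cι comp_data /// cε comp_data ≋ id_v u }.

Definition Liftable (D E : DblOps) (F G : DFun D E) (α : VNat F G) : Type :=
  forall A : D, Companion (α A).

Definition id_companion (D : DblOps) (A : D) : CompanionData (vid A) :=
  {| ch := hid A; cε := id_h (hid A); cι := id_h (hid A) |}.

Definition comp_companion (D : DblOps) (A B C : D) (u : vv A B) (v : vv B C)
  (κ : CompanionData u) (κ' : CompanionData v) : CompanionData (u // v) := {|
  ch := hc (ch κ) (ch κ');
  cε := sqcast eq_refl eq_refl (vcl (vid C)) eq_refl
          (sqcast eq_refl eq_refl eq_refl (hcl (ch κ')) ⟦ cε κ | id_h (ch κ') ⟧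
             /// cε κ');
  cι := sqcast eq_refl (vcl (vid A)) eq_refl eq_refl
          (cι κ /// sqcast (hcr (ch κ)) eq_refl eq_refl eq_refl
                      ⟦ id_h (ch κ) | cι κ' ⟧) |}.

Definition pair_companion (D E : DblOps) (A B : D) (A' B' : E) (u : vv A B)
  (v : vv A' B') (κ : CompanionData u) (κ' : CompanionData v) :
  @CompanionData (prod_dbl D E) (A, A') (B, B') (u, v) :=
  @Build_CompanionData (prod_dbl D E) (A, A') (B, B') (u, v)
    (ch κ, ch κ') (cε κ, cε κ') (cι κ, cι κ').

Definition map_companion (D E : DblOps) (F : DFun D E) (A B : D) (u : vv A B)
  (κ : CompanionData u) : CompanionData (fv F u) :=
  @Build_CompanionData E (F A) (F B) (fv F u)
    (m1 F (ch κ))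
    (sqcast eq_refl (vcr (fv F u))
       (eq_trans (f_equal (fun x => x // vid (F B)) (fv_id F B)) (vcl (vid (F B))))
       eq_refl (fs F (cε κ) /// sph0i F B))
    (sqcast eq_refl
       (eq_trans (f_equal (fun x => vid (F A) // x) (fv_id F A)) (vcl (vid (F A))))
       (vcl (fv F u)) eq_refl (sph0 F A /// fs F (cι κ))).

Section Lift.
Context {D E : DblOps} {F G : DFun D E} (α : VNat F G)
  (inv : VInvertible α) (κ : Liftable α).

(* [ι_{α(A)} | α_f | ε_{α(B)}] *)
Definition lift_δ (A B : D) (f : hh A B) :
  @sq E _ _ _ _ (hc (m1 F f) (ch (κ B))) (vid (F A)) (vid (G B))
                (hc (ch (κ A)) (m1 G f)) :=
  sqcast (f_equal (fun x => hc x (ch (κ B))) (hcl (m1 F f : @hh E (F A) (F B))))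
         eq_refl eq_refl (hcr _)
    ⟦ ⟦ cι (κ A) | vs α f ⟧ | cε (κ B) ⟧.

Lemma lift_inv_l (A B : D) (f : hh A B) :
  (α A // inv_l (inv f)) // vid (F A) = vid (F A).
Proof. destruct (inv_sqr (inv f)) as (_ & e & _); now rewrite e, vcl. Qed.

Lemma lift_inv_r (A B : D) (f : hh A B) :
  (vid (G B) // inv_r (inv f)) // α B = vid (G B).
Proof. destruct (inv_sql (inv f)) as (_ & _ & e & _); now rewrite vcl, e. Qed.

(* the inverse, [ε_{α(A)} | Id] / α_f^{-1} / [Id | ι_{α(B)}] *)
Definition lift_δinv (A B : D) (f : hh A B) :
  @sq E _ _ _ _ (hc (ch (κ A)) (m1 G f)) (vid (F A)) (vid (G B))
                (hc (m1 F f) (ch (κ B))) :=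
  sqcast eq_refl (lift_inv_l f) (lift_inv_r f) eq_refl
    (sqcast eq_refl eq_refl eq_refl (hcl (m1 G f : @hh E (G A) (G B)))
       ⟦ cε (κ A) | id_h (m1 G f : @hh E (G A) (G B)) ⟧
     /// inv_sq (inv f)
     /// sqcast (hcr (m1 F f : @hh E (F A) (F B))) eq_refl eq_refl eq_refl
           ⟦ id_h (m1 F f : @hh E (F A) (F B)) | cι (κ B) ⟧).

(* [Id^{F(u)} / ι_{α(B)} | ε_{α(A)} / Id^{G(u)}] *)
Definition lift_sq (A B : D) (u : vv A B) :
  @sq E _ _ _ _ (ch (κ A)) (fv F u) (fv G u) (ch (κ B)) :=
  sqcast (hcl (ch (κ A))) (vcr (fv F u)) (vcl (fv G u)) (hcr (ch (κ B)))
    ⟦ id_v (fv F u) /// cι (κ B)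
     | sqcast eq_refl (eq_sym (vt_nat α u)) eq_refl eq_refl
         (cε (κ A) /// id_v (fv G u)) ⟧.

Definition lift : HNat F G :=
  @Build_HNat D E F G
    (@Build_PsNat (hor_pre D) (hor_pre E) F G (fun A => ch (κ A)) lift_δ lift_δinv)
    lift_sq.
End Lift.

(** The lift [[ι_u | Id | ε_v] : v̂ ⇒ û] of an identity vertically globular
    2-cell with left side [u] and right side [v]. *)
Definition lift_id (D : DblOps) (A B : D) (u v : vv A B) (e : u = v)
  (κ : CompanionData u) (κ' : CompanionData v) :
  sq (ch κ') (vid A) (vid B) (ch κ) :=
  sqcast (eq_trans (f_equal (fun x => hc x (ch κ')) (hcl (hid A))) (hcl (ch κ')))
         eq_refl eq_refl
         (eq_trans (hcr (hc (ch κ) (hid B))) (hcr (ch κ)))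
    ⟦ ⟦ cι κ | id_v u ⟧ | sqcast eq_refl (eq_sym e) eq_refl eq_refl (cε κ') ⟧.

Section TensorCells.
Context {D : DblOps} (ten : DFun D²⁻ D).
Definition o0 (A B : D) : D := ten (A, B).
Definition oh {A A' B B' : D} (f : hh A A') (g : hh B B') : hh (o0 A B) (o0 A' B') :=
  @m1 _ _ ten (A, B) (A', B') (f, g).
Definition ov {A A' B B' : D} (u : vv A A') (v : vv B B') : vv (o0 A B) (o0 A' B') :=
  @fv _ _ ten (A, B) (A', B') (u, v).
Definition os {A1 A2 A1' A2' B1 B2 B1' B2' : D} {f : hh A1 A2} {u : vv A1 A1'}
  {u' : vv A2 A2'} {f' : hh A1' A2'} {g : hh B1 B2} {v : vv B1 B1'} {v' : vv B2 B2'}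
  {g' : hh B1' B2'} (s : sq f u u' f') (t : sq g v v' g') :
  sq (oh f g) (ov u v) (ov u' v') (oh f' g') :=
  @fs _ _ ten (A1, B1) (A2, B2) (A1', B1') (A2', B2') (f, g) (u, v) (u', v') (f', g')
    (s, t).
Definition o_companion {A A' B B' : D} {u : vv A A'} {v : vv B B'}
  (κ : CompanionData u) (κ' : CompanionData v) : CompanionData (ov u v) :=
  map_companion ten (pair_companion κ κ').

Section Assoc.
Variable a : VNat (ten_dfun ten (ten_dfun ten D1_3 D2_3) D3_3)
                  (ten_dfun ten D1_3 (ten_dfun ten D2_3 D3_3)).
Definition va (A B C : D) : vv (o0 (o0 A B) C) (o0 A (o0 B C)) := a (A, B, C).
Definition sa {A B C A' B' C' : D} (f : hh A A') (g : hh B B') (h : hh C C') :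
  sq (oh (oh f g) h) (va A B C) (va A' B' C') (oh f (oh g h)) :=
  @vs _ _ _ _ a (A, B, C) (A', B', C') (f, g, h).
End Assoc.

Section Unitors.
Context (unt : DFun one_dbl D)
  (l : VNat (ten_dfun ten (unt_dfun unt D) (id_dfun D)) (id_dfun D))
  (r : VNat (ten_dfun ten (id_dfun D) (unt_dfun unt D)) (id_dfun D)).
Definition oI : D := unt tt.
Definition oI1 : hh oI oI := @m1 _ _ unt tt tt tt.
Definition vl (A : D) : vv (o0 oI A) A := l A.
Definition vr (A : D) : vv (o0 A oI) A := r A.
Definition sl {A B : D} (f : hh A B) : sq (oh oI1 f) (vl A) (vl B) f :=
  @vs _ _ _ _ l A B f.
Definition sr {A B : D} (f : hh A B) : sq (oh f oI1) (vr A) (vr B) f :=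
  @vs _ _ _ _ r A B f.
End Unitors.
End TensorCells.

(** Equations between vertical strict transformations are stated on 1v-components
    and, with suffix [_sq], on the squares at all 1h-cells. *)
Record MonoidalDoubleCat (D : DblOps) : Type := {
  mten : PseudoDoubleFunctor D²⁻ D;
  munt : PseudoDoubleFunctor one_dbl D;
  mass : VNat (ten_dfun mten (ten_dfun mten D1_3 D2_3) D3_3)
              (ten_dfun mten D1_3 (ten_dfun mten D2_3 D3_3));
  mlun : VNat (ten_dfun mten (unt_dfun munt D) (id_dfun D)) (id_dfun D);
  mrun : VNat (ten_dfun mten (id_dfun D) (unt_dfun munt D)) (id_dfun D);
  mass_inv : VInvertible mass;
  mlun_inv : VInvertible mlun;
  mrun_inv : VInvertible mrun;
  m_pent : forall A B C E : D,
      va mass (o0 mten A B) C E // va mass A B (o0 mten C E)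
      = ov mten (va mass A B C) (vid E) // va mass A (o0 mten B C) E
        // ov mten (vid A) (va mass B C E);
  m_pent_sq : forall (A B C E A' B' C' E' : D)
      (f : hh A A') (g : hh B B') (h : hh C C') (k : hh E E'),
      sa mass (oh mten f g) h k /// sa mass f g (oh mten h k)
      ≋ os mten (sa mass f g h) (id_h k) /// sa mass f (oh mten g h) k
        /// os mten (id_h f) (sa mass g h k);
  m_mid : forall A B : D,
      ov mten (vr mrun A) (vid B)
      = va mass A (oI munt) B // ov mten (vid A) (vl mlun B);
  m_mid_sq : forall (A B A' B' : D) (f : hh A A') (g : hh B B'),
      os mten (sr mrun f) (id_h g)
      ≋ sa mass f (oI1 munt) g /// os mten (id_h f) (sl mlun g);
  m_lft : forall A B : D,
      va mass (oI munt) A B // vl mlun (o0 mten A B)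
      = ov mten (vl mlun A) (vid B);
  m_lft_sq : forall (A B A' B' : D) (f : hh A A') (g : hh B B'),
      sa mass (oI1 munt) f g /// sl mlun (oh mten f g)
      ≋ os mten (sl mlun f) (id_h g);
  m_rgt : forall A B : D,
      va mass A B (oI munt) // ov mten (vid A) (vr mrun B)
      = vr mrun (o0 mten A B);
  m_rgt_sq : forall (A B A' B' : D) (f : hh A A') (g : hh B B'),
      sa mass f g (oI1 munt) /// os mten (id_h f) (sr mrun g)
      ≋ sr mrun (oh mten f g) }.

Section LiftMonoidal.
Context {D : DblOps} (M : MonoidalDoubleCat D)
  (κa : Liftable (mass M)) (κl : Liftable (mlun M)) (κr : Liftable (mrun M)).

Definition lift_mon_core : HMonCore D :=
  @Build_HMonCore D (mten M) (munt M)
    (lift (mass_inv M) κa) (lift (mlun_inv M) κl) (lift (mrun_inv M) κr).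

Definition ca (A B C : D) : CompanionData (va (mass M) A B C) := κa (A, B, C).
Definition cl (A : D) : CompanionData (vl (mlun M) A) := κl A.
Definition cr (A : D) : CompanionData (vr (mrun M) A) := κr A.

Definition lift_pent : Cells (hpent_src lift_mon_core) (hpent_tgt lift_mon_core).
Proof.
  intros (((A, B), C), E).
  exact (lift_id (m_pent M A B C E)
    (comp_companion (ca (o0 (mten M) A B) C E) (ca A B (o0 (mten M) C E)))
    (comp_companion
       (comp_companion (o_companion (mten M) (ca A B C) (id_companion E))
                       (ca A (o0 (mten M) B C) E))
       (o_companion (mten M) (id_companion A) (ca B C E)))).
Defined.

Definition lift_mid : Cells (hmid_src lift_mon_core) (hmid_tgt lift_mon_core).
Proof.
  intros (A, B).
  exact (lift_id (m_mid M A B)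
    (o_companion (mten M) (cr A) (id_companion B))
    (comp_companion (ca A (oI (munt M)) B)
                    (o_companion (mten M) (id_companion A) (cl B)))).
Defined.

Definition lift_lft : Cells (hleft_src lift_mon_core) (hleft_tgt lift_mon_core).
Proof.
  intros (A, B).
  exact (lift_id (m_lft M A B)
    (comp_companion (ca (oI (munt M)) A B) (cl (o0 (mten M) A B)))
    (o_companion (mten M) (cl A) (id_companion B))).
Defined.

Definition lift_rgt : Cells (hright_src lift_mon_core) (hright_tgt lift_mon_core).
Proof.
  intros (A, B).
  exact (lift_id (m_rgt M A B)
    (comp_companion (ca A B (oI (munt M)))
                    (o_companion (mten M) (id_companion A) (cr B)))
    (cr (o0 (mten M) A B))).
Defined.

Definition lift_monoidal : HMonData D :=
  @Build_HMonData D lift_mon_core lift_pent lift_mid lift_lft lift_rgt.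
End LiftMonoidal.

Record VerticalDoubleMonad (D : DblOps) : Type := {
  vT : PseudoDoubleFunctor D D;
  vmu : VNat (comp_dfun vT vT) vT;
  veta : VNat (id_dfun D) vT;
  vm_assoc : forall A : D, vmu (vT A) // vmu A = fv vT (vmu A) // vmu A;
  vm_assoc_sq : forall (A B : D) (f : hh A B),
      vs vmu (m1 vT f) /// vs vmu f ≋ fs vT (vs vmu f) /// vs vmu f;
  vm_right : forall A : D, vid (vT A) = veta (vT A) // vmu A;
  vm_right_sq : forall (A B : D) (f : hh A B),
      @id_h D _ _ (m1 vT f) ≋ vs veta (m1 vT f) /// vs vmu f;
  vm_left : forall A : D, vid (vT A) = fv vT (veta A) // vmu A;
  vm_left_sq : forall (A B : D) (f : hh A B),
      @id_h D _ _ (m1 vT f) ≋ fs vT (vs veta f) /// vs vmu f }.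

Section LiftMonad.
Context {D : DblOps} (T : VerticalDoubleMonad D)
  (iμ : VInvertible (vmu T)) (iη : VInvertible (veta T))
  (κμ : Liftable (vmu T)) (κη : Liftable (veta T)).

Definition lift_monad_core : HMonadCore D :=
  @Build_HMonadCore D (vT T) (lift iμ κμ) (lift iη κη).

Definition lift_a : Cells (hmassoc_src lift_monad_core) (hmassoc_tgt lift_monad_core) :=
  fun A => lift_id (vm_assoc T A)
    (comp_companion (κμ (vT T A)) (κμ A))
    (comp_companion (map_companion (vT T) (κμ A)) (κμ A)).
Definition lift_r : Cells (hmright_src lift_monad_core) (hmunit_tgt lift_monad_core) :=
  fun A => lift_id (vm_right T A)
    (id_companion (vT T A)) (comp_companion (κη (vT T A)) (κμ A)).
Definition lift_l : Cells (hmleft_src lift_monad_core) (hmunit_tgt lift_monad_core) :=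
  fun A => lift_id (vm_left T A)
    (id_companion (vT T A)) (comp_companion (map_companion (vT T) (κη A)) (κμ A)).

Definition lift_monad : HMonadData D :=
  @Build_HMonadData D lift_monad_core lift_a lift_r lift_l.
End LiftMonad.

Section StrengthComponents.
Context {D : DblOps} (ten : DFun D²⁻ D) (T : DFun D D).
Section Left.
Variable t : VNat (ten_dfun ten D1_2 (comp_dfun T D2_2))
                  (comp_dfun T (ten_dfun ten D1_2 D2_2)).
Definition vtl (A B : D) : vv (o0 ten A (T B)) (T (o0 ten A B)) := t (A, B).
Definition stl {A A' B B' : D} (f : hh A A') (g : hh B B') :
  @sq D _ _ _ _ (oh ten f (m1 T g)) (vtl A B) (vtl A' B') (m1 T (oh ten f g)) :=
  @vs _ _ _ _ t (A, B) (A', B') (f, g).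
End Left.
Section Right.
Variable s : VNat (ten_dfun ten (comp_dfun T D1_2) D2_2)
                  (comp_dfun T (ten_dfun ten D1_2 D2_2)).
Definition vtr (A B : D) : vv (o0 ten (T A) B) (T (o0 ten A B)) := s (A, B).
Definition str {A A' B B' : D} (f : hh A A') (g : hh B B') :
  @sq D _ _ _ _ (oh ten (m1 T f) g) (vtr A B) (vtr A' B') (m1 T (oh ten f g)) :=
  @vs _ _ _ _ s (A, B) (A', B') (f, g).
End Right.
End StrengthComponents.

Section VerticalStrength.
Context {D : DblOps} (M : MonoidalDoubleCat D) (T : VerticalDoubleMonad D).

Local Notation "A ⊗ B" := (o0 (mten M) A B) (at level 36, left associativity).
Local Notation "f ⊗h g" := (oh (mten M) f g) (at level 36, left associativity).
Local Notation "u ⊗v v" := (ov (mten M) u v) (at level 36, left associativity).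
Local Notation "s ⊗s t" := (os (mten M) s t) (at level 36, left associativity).
Local Notation T0 := (vT T).
Local Notation Th f := (m1 (vT T) f).
Local Notation Tv u := (fv (vT T) u).
Local Notation Ts s := (fs (vT T) s).
Local Notation "'α'" := (va (mass M)).
Local Notation "'λ'" := (vl (mlun M)).
Local Notation "'ρ'" := (vr (mrun M)).
Local Notation "'μ'" := (vmu T).
Local Notation "'η'" := (veta T).
Local Notation I_ := (oI (munt M)).
Local Notation I1 := (oI1 (munt M)).

Record LeftVerticalStrength : Type := {
  vlt : VNat (ten_dfun (mten M) D1_2 (comp_dfun T0 D2_2))
             (comp_dfun T0 (ten_dfun (mten M) D1_2 D2_2));
  vl_x : forall A : D, λ (T0 A) = vtl vlt I_ A // Tv (λ A);
  vl_x_sq : forall (A A' : D) (f : hh A A'),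
      sl (mlun M) (Th f : hh (T0 A) (T0 A')) ≋ stl vlt I1 f /// Ts (sl (mlun M) f);
  vl_y : forall A B C : D,
      α A B (T0 C) // (vid A ⊗v vtl vlt B C) // vtl vlt A (B ⊗ C)
      = vtl vlt (A ⊗ B) C // Tv (α A B C);
  vl_y_sq : forall (A B C A' B' C' : D) (f : hh A A') (g : hh B B') (h : hh C C'),
      sa (mass M) f g (Th h : hh (T0 C) (T0 C')) /// (id_h f ⊗s stl vlt g h)
        /// stl vlt f (g ⊗h h)
      ≋ stl vlt (f ⊗h g) h /// Ts (sa (mass M) f g h);
  vl_w : forall A B : D,
      (vid A ⊗v μ B) // vtl vlt A B
      = vtl vlt A (T0 B) // Tv (vtl vlt A B) // μ (A ⊗ B);
  vl_w_sq : forall (A B A' B' : D) (f : hh A A') (g : hh B B'),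
      (id_h f ⊗s vs μ g) /// stl vlt f g
      ≋ stl vlt f (Th g : hh (T0 B) (T0 B')) /// Ts (stl vlt f g) /// vs μ (f ⊗h g);
  vl_z : forall A B : D, η (A ⊗ B) = (vid A ⊗v η B) // vtl vlt A B;
  vl_z_sq : forall (A B A' B' : D) (f : hh A A') (g : hh B B'),
      vs η (f ⊗h g) ≋ (id_h f ⊗s vs η g) /// stl vlt f g }.

Record RightVerticalStrength : Type := {
  vrs : VNat (ten_dfun (mten M) (comp_dfun T0 D1_2) D2_2)
             (comp_dfun T0 (ten_dfun (mten M) D1_2 D2_2));
  vr_x : forall A : D, ρ (T0 A) = vtr vrs A I_ // Tv (ρ A);
  vr_x_sq : forall (A A' : D) (f : hh A A'),
      sr (mrun M) (Th f : hh (T0 A) (T0 A')) ≋ str vrs f I1 /// Ts (sr (mrun M) f);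
  vr_y : forall A B C : D,
      α (T0 A) B C // vtr vrs A (B ⊗ C)
      = (vtr vrs A B ⊗v vid C) // vtr vrs (A ⊗ B) C // Tv (α A B C);
  vr_y_sq : forall (A B C A' B' C' : D) (f : hh A A') (g : hh B B') (h : hh C C'),
      sa (mass M) (Th f : hh (T0 A) (T0 A')) g h /// str vrs f (g ⊗h h)
      ≋ (str vrs f g ⊗s id_h h) /// str vrs (f ⊗h g) h /// Ts (sa (mass M) f g h);
  vr_w : forall A B : D,
      (μ A ⊗v vid B) // vtr vrs A B
      = vtr vrs (T0 A) B // Tv (vtr vrs A B) // μ (A ⊗ B);
  vr_w_sq : forall (A B A' B' : D) (f : hh A A') (g : hh B B'),
      (vs μ f ⊗s id_h g) /// str vrs f g
      ≋ str vrs (Th f : hh (T0 A) (T0 A')) g /// Ts (str vrs f g) /// vs μ (f ⊗h g);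
  vr_z : forall A B : D, η (A ⊗ B) = (η A ⊗v vid B) // vtr vrs A B;
  vr_z_sq : forall (A B A' B' : D) (f : hh A A') (g : hh B B'),
      vs η (f ⊗h g) ≋ (vs η f ⊗s id_h g) /// str vrs f g }.

Context (κa : Liftable (mass M)) (κl : Liftable (mlun M)) (κr : Liftable (mrun M))
  (iμ : VInvertible (vmu T)) (iη : VInvertible (veta T))
  (κμ : Liftable (vmu T)) (κη : Liftable (veta T)).

Local Notation Mh := (lift_monoidal κa κl κr).
Local Notation Tg := (lift_monad iμ iη κμ κη).

Section LiftLeft.
Context (S : LeftVerticalStrength) (it : VInvertible (vlt S)) (κt : Liftable (vlt S)).

Definition ct (A B : D) : CompanionData (vtl (vlt S) A B) := κt (A, B).

Definition lift_lt : HLNat Mh Tg := lift it κt.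

Definition lift_lx : Cells (hlx_src lift_lt) (hlx_tgt Mh Tg) :=
  fun A => lift_id (vl_x S A) (cl κl (T0 A))
    (comp_companion (ct I_ A) (map_companion T0 (cl κl A))).

Definition lift_ly : Cells (hly_src lift_lt) (hly_tgt lift_lt).
Proof.
  intros ((A, B), C).
  exact (lift_id (vl_y S A B C)
    (comp_companion
       (comp_companion (ca κa A B (T0 C))
                       (o_companion (mten M) (id_companion A) (ct B C)))
       (ct A (B ⊗ C)))
    (comp_companion (ct (A ⊗ B) C) (map_companion T0 (ca κa A B C)))).
Defined.

Definition lift_lw : Cells (hlw_src lift_lt) (hlw_tgt lift_lt).
Proof.
  intros (A, B).
  exact (lift_id (vl_w S A B)
    (comp_companion (o_companion (mten M) (id_companion A) (κμ B)) (ct A B))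
    (comp_companion
       (comp_companion (ct A (T0 B)) (map_companion T0 (ct A B)))
       (κμ (A ⊗ B)))).
Defined.

Definition lift_lz : Cells (hlz_src lift_lt) (hlz_tgt Mh Tg).
Proof.
  intros (A, B).
  exact (lift_id (vl_z S A B) (κη (A ⊗ B))
    (comp_companion (o_companion (mten M) (id_companion A) (κη B)) (ct A B))).
Defined.

Definition lift_left_strength : HLStrData Mh Tg :=
  @Build_HLStrData D Mh Tg lift_lt lift_lx lift_ly lift_lw lift_lz.
End LiftLeft.

Section LiftRight.
Context (S : RightVerticalStrength) (is : VInvertible (vrs S)) (κs : Liftable (vrs S)).

Definition cs (A B : D) : CompanionData (vtr (vrs S) A B) := κs (A, B).

Definition lift_rs : HRNat Mh Tg := lift is κs.

Definition lift_rx : Cells (hrx_src lift_rs) (hrx_tgt Mh Tg) :=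
  fun A => lift_id (vr_x S A) (cr κr (T0 A))
    (comp_companion (cs A I_) (map_companion T0 (cr κr A))).

Definition lift_ry : Cells (hry_src lift_rs) (hry_tgt lift_rs).
Proof.
  intros ((A, B), C).
  exact (lift_id (vr_y S A B C)
    (comp_companion (ca κa (T0 A) B C) (cs A (B ⊗ C)))
    (comp_companion
       (comp_companion (o_companion (mten M) (cs A B) (id_companion C))
                       (cs (A ⊗ B) C))
       (map_companion T0 (ca κa A B C)))).
Defined.

Definition lift_rw : Cells (hrw_src lift_rs) (hrw_tgt lift_rs).
Proof.
  intros (A, B).
  exact (lift_id (vr_w S A B)
    (comp_companion (o_companion (mten M) (κμ A) (id_companion B)) (cs A B))
    (comp_companion
       (comp_companion (cs (T0 A) B) (map_companion T0 (cs A B)))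
       (κμ (A ⊗ B)))).
Defined.

Definition lift_rz : Cells (hrz_src lift_rs) (hrz_tgt Mh Tg).
Proof.
  intros (A, B).
  exact (lift_id (vr_z S A B) (κη (A ⊗ B))
    (comp_companion (o_companion (mten M) (κη A) (id_companion B)) (cs A B))).
Defined.

Definition lift_right_strength : HRStrData Mh Tg :=
  @Build_HRStrData D Mh Tg lift_rs lift_rx lift_ry lift_rw lift_rz.
End LiftRight.
End VerticalStrength.

(* Main.v *)
(** Call a globular 2-cell [s : û ⇒ v̂] between companions of equal vertical cells
    [u = v] canonical if [ι_u / s = ι_v]. Since [[ι_u|ε_u] = Id], there is exactly one
    such [s], namely [[ι_v|ε_u]]. Canonical 2-cells are closed under both compositions
    and under double functors, and identities, compositors, unitors, the
    pseudonaturality 2-cells of companion-lifts at companions, and the lifts of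
    identity 2-cells are canonical. Hence companions and canonical 2-cells form a
    2-category in which parallel 2-cells are equal. The lifted monoidal structure,
    monad and strength restrict to it, where every coherence axiom is trivial; as each
    axiom involves only companions, it holds in [H(D)].

    At an arbitrary 1h-cell [f], a lift of a vertical transformation [α] is
    characterized by [[Id_f|ι_{α(B)}] / δ_f = [ι_{α(A)}|α_f]] and
    [ι_{α(A)} / α̂^u = Id^{F(u)} / ι_{α(B)}]. These equations are stable under
    composition, whiskering and pairing, and reduce the modification axioms to the
    equations between the vertical transformations. *)

Require Import Defs.
From Stdlib Require Import Eqdep ClassicalEpsilon ProofIrrelevance.

Set Implicit Arguments.
Unset Strict Implicit.
Unset Printing Implicit Defensive.
Set Primitive Projections.

(** * Packed squares *)

(** The associativity and unit laws of 1-cells are propositional equalities, so the two sides of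
    most equations between squares have different types, and rewriting inside a pasting would have
    to carry casts. Packing a square with its corners and sides erases the casts; the price is that
    composition becomes partial and that boundaries have to be tracked separately. The coherence
    axioms are never pasted by hand. They are terms over an arbitrary [TwoOps], and so can be read
    both in H(D) and in the structure of companions and canonical cells. In the latter an axiom only
    asks that its two boundaries be equal. The return to H(D) follows the syntax of the axiom: both
    readings are built by the same operations from the same squares of D, so their packed values
    agree, and an equation between the first two values is an equation between the other two. This
    requires every functor and transformation of the structure to be rebuilt on companions, with the
    same underlying squares. The work lies in equating the fold that a composite double functor
    assigns to a companion with the one computed by the 2-categorical composite. *)

Record Packed (D : DblOps) : Type := Pack {
  pA : D; pB : D; pA' : D; pB' : D;
  ptop : hh pA pB; plft : vv pA pA'; prgt : vv pB pB'; pbot : hh pA' pB';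
  pcell : sq ptop plft prgt pbot }.

Definition pk (D : DblOps) (A B A' B' : D) (f : hh A B) (u : vv A A') (v : vv B B')
  (g : hh A' B') (s : sq f u v g) : option (Packed D) := Some (Pack s).

Section Packing.
Context {D : DblOps}.

Lemma pk_sqeq (A B A' B' : D) (f f1 : hh A B) (u u1 : vv A A') (v v1 : vv B B')
  (g g1 : hh A' B') (s : sq f u v g) (s1 : sq f1 u1 v1 g1) :
  s ≋ s1 -> pk s = pk s1.
Proof.
  intros (ef & eu & ev & eg & e); destruct ef, eu, ev, eg; cbn in e; now subst.
Qed.

Lemma sqeq_pk (A B A' B' : D) (f f1 : hh A B) (u u1 : vv A A') (v v1 : vv B B')
  (g g1 : hh A' B') (s : sq f u v g) (s1 : sq f1 u1 v1 g1) :
  pk s = pk s1 -> s ≋ s1.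
Proof.
  intros H.
  (* The packed square is generalized to [p], with separate equations for its corners. Inverting
     [Some p = pk s] then leaves only loops at the corners, which uniqueness of identity proofs
     removes. *)
  assert (Q : forall p, Some p = pk s ->
    forall (eA : A = pA p) (eB : B = pB p) (eA' : A' = pA' p) (eB' : B' = pB' p),
    match eA in _ = a, eB in _ = b, eA' in _ = a', eB' in _ = b'
      return forall (h : hh a b) (x : vv a a') (y : vv b b') (k : hh a' b'),
             sq h x y k -> Prop with
    | eq_refl, eq_refl, eq_refl, eq_refl => fun h x y k r => s ≋ r
    end (ptop p) (plft p) (prgt p) (pbot p) (pcell p)).
  { intros p [= ->] eA eB eA' eB'; cbn in *.
    rewrite (UIP_refl _ _ eA), (UIP_refl _ _ eB), (UIP_refl _ _ eA'), (UIP_refl _ _ eB').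
    apply sqeq_refl. }
  exact (Q (Pack s1) (eq_sym H) eq_refl eq_refl eq_refl eq_refl).
Qed.

Lemma pk_inj (A B A' B' : D) (f : hh A B) (u : vv A A') (v : vv B B')
  (g : hh A' B') (s s1 : sq f u v g) : pk s = pk s1 -> s = s1.
Proof. intros H; apply sqeq_eq, sqeq_pk, H. Qed.

Lemma pk_cast (A B A' B' : D) (f f1 : hh A B) (u u1 : vv A A') (v v1 : vv B B')
  (g g1 : hh A' B') (ef : f = f1) (eu : u = u1) (ev : v = v1) (eg : g = g1)
  (s : sq f u v g) : pk (sqcast ef eu ev eg s) = pk s.
Proof. apply pk_sqeq, sqcast_eq. Qed.

(** The graph of horizontal composition. Composability of packed squares would be an equality
    between sides of dependent type; quantifying over one shared boundary avoids stating it. *)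
Definition hrel (a b c : option (Packed D)) : Prop :=
  exists (A B C A' B' C' : D) (f : hh A B) (g : hh B C) (u : vv A A') (v : vv B B')
    (w : vv C C') (f' : hh A' B') (g' : hh B' C') (s : sq f u v f') (t : sq g v w g'),
    a = pk s /\ b = pk t /\ c = pk ⟦ s | t ⟧.

Definition vrel (a b c : option (Packed D)) : Prop :=
  exists (A B A' B' A'' B'' : D) (f : hh A B) (u : vv A A') (v : vv B B')
    (g : hh A' B') (u' : vv A' A'') (v' : vv B' B'') (h : hh A'' B'')
    (s : sq f u v g) (t : sq g u' v' h),
    a = pk s /\ b = pk t /\ c = pk (s /// t).

(* Compositions of packed squares are total, with value [None] on incompatible
   squares, so that associativity needs no side condition. *)
Definition partial_op (R : option (Packed D) -> Prop) : option (Packed D) :=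
  match excluded_middle_informative (exists c, R c) with
  | left e => proj1_sig (constructive_indefinite_description _ e)
  | right _ => None
  end.

Lemma partial_op_spec (R : option (Packed D) -> Prop) (c : option (Packed D)) :
  (forall c', R c' -> c' = c) -> R c -> partial_op R = c.
Proof.
  intros U H; unfold partial_op.
  destruct excluded_middle_informative as [e|e]; [|now destruct e; exists c].
  apply U; exact (proj2_sig (constructive_indefinite_description _ e)).
Qed.

Lemma partial_op_inv (R : option (Packed D) -> Prop) :
  (exists c, R c /\ partial_op R = c) \/ partial_op R = None.
Proof.
  unfold partial_op; destruct excluded_middle_informative as [e|e]; [left|now right].
  eexists; split; [exact (proj2_sig (constructive_indefinite_description _ e))|].
  reflexivity.
Qed.

Definition hcp (a b : option (Packed D)) : option (Packed D) := partial_op (hrel a b).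
Definition vcp (a b : option (Packed D)) : option (Packed D) := partial_op (vrel a b).

Lemma hrel_fun (A B C A' B' C' : D) (f : hh A B) (g : hh B C) (u : vv A A')
  (v : vv B B') (w : vv C C') (f' : hh A' B') (g' : hh B' C')
  (s : sq f u v f') (t : sq g v w g') (c : option (Packed D)) :
  hrel (pk s) (pk t) c -> c = pk ⟦ s | t ⟧.
Proof.
  intros (A1 & B1 & C1 & A1' & B1' & C1' & f1 & g1 & u1 & v1 & w1 & f1' & g1' & s1 & t1
          & Hs & Ht & ->).
  (* The corners have a non-dependent type, so plain projections equate them; once they are
     substituted, the sides and cells can be compared by [≋]. *)
  assert (EA := f_equal (option_map (@pA D)) Hs); assert (EB := f_equal (option_map (@pB D)) Hs).
  assert (EA' := f_equal (option_map (@pA' D)) Hs); assert (EB' := f_equal (option_map (@pB' D)) Hs).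
  assert (EC := f_equal (option_map (@pB D)) Ht); assert (EC' := f_equal (option_map (@pB' D)) Ht).
  cbn in *; injection EA; injection EB; injection EC; injection EA'; injection EB';
    injection EC'; intros; subst.
  apply pk_sqeq, sqh_eq; apply sqeq_sym, sqeq_pk; assumption.
Qed.

Lemma vrel_fun (A B A' B' A'' B'' : D) (f : hh A B) (u : vv A A') (v : vv B B')
  (g : hh A' B') (u' : vv A' A'') (v' : vv B' B'') (h : hh A'' B'')
  (s : sq f u v g) (t : sq g u' v' h) (c : option (Packed D)) :
  vrel (pk s) (pk t) c -> c = pk (s /// t).
Proof.
  intros (A1 & B1 & A1' & B1' & A1'' & B1'' & f1 & u1 & v1 & g1 & u1' & v1' & h1 & s1 & t1
          & Hs & Ht & ->).
  assert (EA := f_equal (option_map (@pA D)) Hs); assert (EB := f_equal (option_map (@pB D)) Hs).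
  assert (EA' := f_equal (option_map (@pA' D)) Hs); assert (EB' := f_equal (option_map (@pB' D)) Hs).
  assert (EC := f_equal (option_map (@pA' D)) Ht); assert (EC' := f_equal (option_map (@pB' D)) Ht).
  cbn in *; injection EA; injection EB; injection EC; injection EA'; injection EB';
    injection EC'; intros; subst.
  apply pk_sqeq, sqv_eq; apply sqeq_sym, sqeq_pk; assumption.
Qed.

Lemma pk_h (A B C A' B' C' : D) (f : hh A B) (g : hh B C) (u : vv A A')
  (v : vv B B') (w : vv C C') (f' : hh A' B') (g' : hh B' C')
  (s : sq f u v f') (t : sq g v w g') : pk ⟦ s | t ⟧ = hcp (pk s) (pk t).
Proof.
  symmetry; apply partial_op_spec; [intros c; apply hrel_fun|].
  now exists A, B, C, A', B', C', f, g, u, v, w, f', g', s, t.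
Qed.

Lemma pk_v (A B A' B' A'' B'' : D) (f : hh A B) (u : vv A A') (v : vv B B')
  (g : hh A' B') (u' : vv A' A'') (v' : vv B' B'') (h : hh A'' B'')
  (s : sq f u v g) (t : sq g u' v' h) : pk (s /// t) = vcp (pk s) (pk t).
Proof.
  symmetry; apply partial_op_spec; [intros c; apply vrel_fun|].
  now exists A, B, A', B', A'', B'', f, u, v, g, u', v', h, s, t.
Qed.

(** Unit and interchange laws for packed squares depend on boundaries that the type no longer shows.
    [Bd] recovers them, and is closed under composition with adjacent sides matching only up to a
    proven equality. *)
Definition Bd {A B A' B' : D} (a : option (Packed D)) (f : hh A B) (u : vv A A')
  (v : vv B B') (g : hh A' B') : Prop := exists s : sq f u v g, a = pk s.

Lemma Bd_pk (A B A' B' : D) (f : hh A B) (u : vv A A') (v : vv B B') (g : hh A' B')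
  (s : sq f u v g) : Bd (pk s) f u v g.
Proof. now exists s. Qed.

Lemma Bd_eq (A B A' B' : D) (a : option (Packed D)) (f f1 : hh A B) (u u1 : vv A A')
  (v v1 : vv B B') (g g1 : hh A' B') :
  Bd a f u v g -> f = f1 -> u = u1 -> v = v1 -> g = g1 -> Bd a f1 u1 v1 g1.
Proof. now intros H -> -> -> ->. Qed.

Lemma Bd_h (A B C A' B' C' : D) (a b : option (Packed D)) (f : hh A B) (g : hh B C)
  (u : vv A A') (v v1 : vv B B') (w : vv C C') (f' : hh A' B') (g' : hh B' C') :
  Bd a f u v f' -> Bd b g v1 w g' -> v = v1 -> Bd (hcp a b) (hc f g) u w (hc f' g').
Proof. intros [s ->] [t ->] ->; rewrite <- pk_h; apply Bd_pk. Qed.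

Lemma Bd_v (A B A' B' A'' B'' : D) (a b : option (Packed D)) (f : hh A B)
  (u : vv A A') (v : vv B B') (g g1 : hh A' B') (u' : vv A' A'') (v' : vv B' B'')
  (h : hh A'' B'') :
  Bd a f u v g -> Bd b g1 u' v' h -> g = g1 -> Bd (vcp a b) f (vc u u') (vc v v') h.
Proof. intros [s ->] [t ->] ->; rewrite <- pk_v; apply Bd_pk. Qed.
End Packing.

Declare Scope packed_scope.
Delimit Scope packed_scope with packed.
Open Scope packed_scope.
Notation "a <|> b" := (hcp a b) (at level 44, left associativity) : packed_scope.
Notation "a </> b" := (vcp a b) (at level 46, left associativity) : packed_scope.

Lemma option_eq (X : Type) (a b : option X) :
  (forall x, a = Some x -> b = Some x) -> (forall x, b = Some x -> a = Some x) -> a = b.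
Proof.
  destruct a as [x|], b as [y|]; intros H H'; try reflexivity.
  - symmetry; now apply H.
  - symmetry; now apply H.
  - now apply H'.
Qed.

Section PackedLaws.
Context {D : DoubleCat}.
Let L := dbl_laws D.

Lemma hcp_inv (a b : option (Packed D)) (x : Packed D) :
  a <|> b = Some x -> hrel a b (Some x).
Proof.
  unfold hcp; intros H.
  destruct (partial_op_inv (hrel a b)) as [(c & Hc & E)|E]; congruence.
Qed.

Lemma vcp_inv (a b : option (Packed D)) (x : Packed D) :
  a </> b = Some x -> vrel a b (Some x).
Proof.
  unfold vcp; intros H.
  destruct (partial_op_inv (vrel a b)) as [(c & Hc & E)|E]; congruence.
Qed.

Lemma pk_corners (A B A' B' : D) (f : hh A B) (u : vv A A') (v : vv B B')
  (g : hh A' B') (s : sq f u v g)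
  (A1 B1 A1' B1' : D) (f1 : hh A1 B1) (u1 : vv A1 A1') (v1 : vv B1 B1')
  (g1 : hh A1' B1') (s1 : sq f1 u1 v1 g1) :
  pk s = pk s1 -> A = A1 /\ B = B1 /\ A' = A1' /\ B' = B1'.
Proof.
  intros H.
  assert (E1 := f_equal (option_map (@pA D)) H); assert (E2 := f_equal (option_map (@pB D)) H).
  assert (E3 := f_equal (option_map (@pA' D)) H); assert (E4 := f_equal (option_map (@pB' D)) H).
  cbn in *; repeat split; congruence.
Qed.

(** No side condition is needed because both bracketings are defined together: if one of them is,
    the square shared by its inner and outer composites fixes all boundaries, and [sqhA] applies.
    Otherwise both are [None]. *)
Lemma hcpA (a b c : option (Packed D)) : (a <|> b) <|> c = a <|> (b <|> c).
Proof.
  apply option_eq; intros x H.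
  - apply hcp_inv in H.
    destruct H as (A & B & C & A' & B' & C' & f & g & u & v & w & f' & g' & s & t & E & -> & ->).
    apply hcp_inv in E.
    destruct E as (A1 & B1 & C1 & A1' & B1' & C1' & f1 & g1 & u1 & v1 & w1 & f1' & g1' & s1 & t1
          & -> & -> & E).
    destruct (pk_corners E) as (-> & -> & -> & ->).
    destruct (sqeq_pk E) as (e1 & e2 & e3 & e4 & _); subst; apply pk_inj in E; subst s.
    rewrite <- !pk_h; symmetry; apply pk_sqeq, (sqhA L).
  - apply hcp_inv in H.
    destruct H as (A & B & C & A' & B' & C' & f & g & u & v & w & f' & g' & s & t & -> & E & ->).
    apply hcp_inv in E.
    destruct E as (A1 & B1 & C1 & A1' & B1' & C1' & f1 & g1 & u1 & v1 & w1 & f1' & g1' & s1 & t1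
          & -> & -> & E).
    destruct (pk_corners E) as (-> & -> & -> & ->).
    destruct (sqeq_pk E) as (e1 & e2 & e3 & e4 & _); subst; apply pk_inj in E; subst t.
    rewrite <- !pk_h; apply pk_sqeq, (sqhA L).
Qed.

Lemma vcpA (a b c : option (Packed D)) : (a </> b) </> c = a </> (b </> c).
Proof.
  apply option_eq; intros x H.
  - apply vcp_inv in H.
    destruct H as (A & B & C & A' & B' & C' & f & g & u & v & w & f' & g' & s & t & E & -> & ->).
    apply vcp_inv in E.
    destruct E as (A1 & B1 & C1 & A1' & B1' & C1' & f1 & g1 & u1 & v1 & w1 & f1' & g1' & s1 & t1
          & -> & -> & E).
    destruct (pk_corners E) as (-> & -> & -> & ->).
    destruct (sqeq_pk E) as (e1 & e2 & e3 & e4 & _); subst; apply pk_inj in E; subst s.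
    rewrite <- !pk_v; symmetry; apply pk_sqeq, (sqvA L).
  - apply vcp_inv in H.
    destruct H as (A & B & C & A' & B' & C' & f & g & u & v & w & f' & g' & s & t & -> & E & ->).
    apply vcp_inv in E.
    destruct E as (A1 & B1 & C1 & A1' & B1' & C1' & f1 & g1 & u1 & v1 & w1 & f1' & g1' & s1 & t1
          & -> & -> & E).
    destruct (pk_corners E) as (-> & -> & -> & ->).
    destruct (sqeq_pk E) as (e1 & e2 & e3 & e4 & _); subst; apply pk_inj in E; subst t.
    rewrite <- !pk_v; apply pk_sqeq, (sqvA L).
Qed.

Lemma hcpl (A B A' B' : D) (a : option (Packed D)) (f : hh A B) (u u1 : vv A A')
  (v : vv B B') (g : hh A' B') : Bd a f u v g -> u1 = u -> pk (id_v u1) <|> a = a.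
Proof. intros [s ->] ->; rewrite <- pk_h; apply pk_sqeq, (sqhl L). Qed.

Lemma hcpr (A B A' B' : D) (a : option (Packed D)) (f : hh A B) (u : vv A A')
  (v v1 : vv B B') (g : hh A' B') : Bd a f u v g -> v1 = v -> a <|> pk (id_v v1) = a.
Proof. intros [s ->] ->; rewrite <- pk_h; apply pk_sqeq, (sqhr L). Qed.

Lemma vcpl (A B A' B' : D) (a : option (Packed D)) (f f1 : hh A B) (u : vv A A')
  (v : vv B B') (g : hh A' B') : Bd a f u v g -> f1 = f -> pk (id_h f1) </> a = a.
Proof. intros [s ->] ->; rewrite <- pk_v; apply pk_sqeq, (sqvl L). Qed.

Lemma vcpr (A B A' B' : D) (a : option (Packed D)) (f : hh A B) (u : vv A A')
  (v : vv B B') (g g1 : hh A' B') : Bd a f u v g -> g1 = g -> a </> pk (id_h g1) = a.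
Proof. intros [s ->] ->; rewrite <- pk_v; apply pk_sqeq, (sqvr L). Qed.

(** Unlike associativity, interchange does depend on the boundaries: the left side can be defined
    because two composite 1h-cells are equal, although their factors differ and [a] does not compose
    with [c]. *)
Lemma interchangep (A B C A' B' C' A'' B'' C'' : D) (a b c d : option (Packed D))
  (f : hh A B) (g : hh B C) (u : vv A A') (v v1 : vv B B') (w : vv C C')
  (f' f1' : hh A' B') (g' g1' : hh B' C') (u' : vv A' A'') (v' v1' : vv B' B'')
  (w' : vv C' C'') (f'' : hh A'' B'') (g'' : hh B'' C'') :
  Bd a f u v f' -> Bd b g v1 w g' -> Bd c f1' u' v' f'' -> Bd d g1' v1' w' g'' ->
  v = v1 -> f' = f1' -> g' = g1' -> v' = v1' ->
  (a <|> b) </> (c <|> d) = (a </> c) <|> (b </> d).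
Proof.
  intros [s ->] [t ->] [s' ->] [t' ->] -> -> -> ->.
  rewrite <- !pk_h, <- !pk_v, <- !pk_h; apply f_equal, (interchange L).
Qed.

Lemma pk_id_h (A B C : D) (f : hh A B) (g : hh B C) :
  pk (id_h f) <|> pk (id_h g) = pk (id_h (hc f g)).
Proof. rewrite <- pk_h; apply f_equal, (id_h_hc L). Qed.

Lemma pk_id_v (A B C : D) (u : vv A B) (v : vv B C) :
  pk (id_v u) </> pk (id_v v) = pk (id_v (u // v)).
Proof. rewrite <- pk_v; apply f_equal, (id_v_vc L). Qed.

Lemma pk_id_hv (A : D) : pk (id_h (hid A)) = pk (id_v (vid A)).
Proof. apply f_equal, (id_hv L). Qed.
End PackedLaws.

(** * Canonical 2-cells between companions *)

Definition Fp (D E : DblOps) (F : DFun D E) (a : option (Packed D)) : option (Packed E) :=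
  option_map (fun p => @Pack E _ _ _ _ _ _ _ _ (fs F (pcell p))) a.

Lemma Bd_Fp (D E : DblOps) (F : DFun D E) (A B A' B' : D) (a : option (Packed D)) (f : hh A B)
  (u : vv A A') (v : vv B B') (g : hh A' B') :
  Bd a f u v g -> @Bd E (F A) (F B) (F A') (F B') (Fp F a) (m1 F f) (fv F u) (fv F v) (m1 F g).
Proof. intros [s ->]; exact (Bd_pk (D := E) (fs F s)). Qed.

Definition gpk {D : DblOps} {A B : D} {f g : hh A B} (s : @two (hor_pre D) A B f g) :
  option (Packed D) := @pk D A B A B f (vid A) (vid B) g s.

Lemma Bd_gpk (D : DblOps) (A B : D) (f g : hh A B) (s : @two (hor_pre D) A B f g) :
  Bd (gpk s) f (vid A) (vid B) g.
Proof. apply Bd_pk. Qed.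

Ltac sides :=
  solve [ reflexivity | assumption | symmetry; assumption
        | cbn; rewrite ?fv_id, ?fv_vc;
          repeat first [ rewrite hcA | rewrite hcl | rewrite hcr | rewrite vcA
                       | rewrite vcl | rewrite vcr
                       (* Cancels a 1v-cell against its inverse, using the equations that
                          [lift_inverse] places in the context. *)
                       | match goal with H : _ = vid _ |- _ => rewrite H end ];
          first [ reflexivity | assumption | symmetry; assumption | congruence ] ].

Ltac bd :=
  lazymatch goal with
  | |- Bd (_ <|> _) _ _ _ _ => eapply Bd_h; [ bd | bd | sides ]
  | |- Bd (_ </> _) _ _ _ _ => eapply Bd_v; [ bd | bd | sides ]
  | |- Bd (pk _) _ _ _ _ => eapply Bd_pk
  | |- Bd (gpk _) _ _ _ _ => eapply Bd_gpk
  | |- Bd (Fp _ (pk _)) _ _ _ _ => eapply Bd_pk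
  | |- Bd (Fp _ _) _ _ _ _ => eapply Bd_Fp; bd
  | |- Bd ?x _ _ _ _ => first [ eassumption | is_var x; unfold x; bd ]
  end.

Ltac bde := eapply Bd_eq; [ bd | sides.. ].

Tactic Notation "ich" uconstr(a) uconstr(b) uconstr(c) uconstr(d) :=
  erewrite (@interchangep _ _ _ _ _ _ _ _ _ _ a b c d); [ | bd .. | sides | sides | sides | sides ].
Tactic Notation "ichr" uconstr(a) uconstr(b) uconstr(c) uconstr(d) :=
  erewrite <- (@interchangep _ _ _ _ _ _ _ _ _ _ a b c d); [ | bd .. | sides | sides | sides | sides ].

(* Only [ι] is recorded: [ε] is determined by it, and the laws of composition of
   folds are then equalities (see [comp_foldA]). *)
Record Fold (D : DblOps) (A B : D) : Type := MkFold {
  fu : vv A B;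
  fh : hh A B;
  fi : sq (hid A) (vid A) fu fh }.

Definition of_comp (D : DblOps) (A B : D) (u : vv A B) (κ : CompanionData u) : Fold A B :=
  {| fu := u; fh := ch κ; fi := cι κ |}.

Definition id_fold (D : DblOps) (A : D) : Fold A A :=
  {| fu := vid A; fh := hid A; fi := id_h (hid A) |}.

Definition comp_fold (D : DblOps) (A B C : D) (P : Fold A B) (Q : Fold B C) : Fold A C := {|
  fu := fu P // fu Q;
  fh := hc (fh P) (fh Q);
  fi := sqcast eq_refl (vcl (vid A)) eq_refl eq_refl
          (fi P /// sqcast (hcr (fh P)) eq_refl eq_refl eq_refl ⟦ id_h (fh P) | fi Q ⟧) |}.

Definition pair_fold (D E : DblOps) (A B : prod_dbl D E) (P : Fold (fst A) (fst B))
  (Q : Fold (snd A) (snd B)) : Fold A B :=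
  @MkFold (prod_dbl D E) A B (fu P, fu Q) (fh P, fh Q) (fi P, fi Q).

Definition map_fold (D E : DblOps) (F : DFun D E) (A B : D) (P : Fold A B) :
  @Fold E (F A) (F B) :=
  @MkFold E (F A) (F B) (fv F (fu P)) (m1 F (fh P))
    (sqcast eq_refl
       (eq_trans (f_equal (fun x => vid (F A) // x) (fv_id F A)) (vcl (vid (F A))))
       (vcl (fv F (fu P))) eq_refl (sph0 F A /// fs F (fi P))).

Definition is_companion (D : DblOps) (A B : D) (u : vv A B) (κ : CompanionData u) : Prop :=
  pk (cι κ) <|> pk (cε κ) = pk (id_h (ch κ)) /\ pk (cι κ) </> pk (cε κ) = pk (id_v u).

Definition to_comp (D : DblOps) (A B : D) (P : Fold A B)
  (ε : sq (fh P) (fu P) (vid B) (hid B)) : CompanionData (fu P) :=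
  {| ch := fh P; cε := ε; cι := fi P |}.

Arguments to_comp {D A B} P ε.

Definition IsComp (D : DblOps) (A B : D) (P : Fold A B) : Prop :=
  exists ε, is_companion (to_comp P ε).

Definition Can (D : DblOps) (A B : D) (P Q : Fold A B)
  (s : sq (fh P) (vid A) (vid B) (fh Q)) : Prop :=
  pk (fi P) </> pk s = pk (fi Q).

Section Folds.
Context {D : DblOps}.

(** The vertical cell and its companion are the right side and the bottom of ι, so the packed ι
    already determines the whole fold. *)
Lemma fold_ext (A B : D) (P Q : Fold A B) : pk (fi P) = pk (fi Q) -> P = Q.
Proof.
  destruct P as [u f i], Q as [v g j]; cbn; intros H.
  destruct (sqeq_pk H) as (e1 & e2 & e3 & e4 & e5).
  destruct e3, e4; rewrite (UIP_refl _ _ e1), (UIP_refl _ _ e2) in e5; cbn in e5.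
  now rewrite e5.
Qed.

Lemma pk_comp_fold (A B C : D) (P : Fold A B) (Q : Fold B C) :
  pk (fi (comp_fold P Q)) = pk (fi P) </> (pk (id_h (fh P)) <|> pk (fi Q)).
Proof. unfold comp_fold; cbn [fi]; now rewrite pk_cast, pk_v, pk_cast, pk_h. Qed.

Lemma pk_map_fold (E : DblOps) (F : DFun D E) (A B : D) (P : Fold A B) :
  pk (fi (map_fold F P)) = pk (sph0 F A) </> Fp F (pk (fi P)).
Proof. unfold map_fold; cbn [fi]; now rewrite pk_cast, pk_v. Qed.

Lemma pk_pair (E : DblOps) (A B A' B' : D) (f : hh A B) (u : vv A A') (v : vv B B')
  (g : hh A' B') (s : sq f u v g) (A1 B1 A1' B1' : E) (f1 : hh A1 B1) (u1 : vv A1 A1')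
  (v1 : vv B1 B1') (g1 : hh A1' B1') (s1 : sq f1 u1 v1 g1)
  (h : hh A B) (x : vv A A') (y : vv B B') (k : hh A' B') (t : sq h x y k)
  (h1 : hh A1 B1) (x1 : vv A1 A1') (y1 : vv B1 B1') (k1 : hh A1' B1')
  (t1 : sq h1 x1 y1 k1) :
  pk s = pk t -> pk s1 = pk t1 ->
  @pk (prod_dbl D E) (A, A1) (B, B1) (A', A1') (B', B1') (f, f1) (u, u1) (v, v1) (g, g1)
    (s, s1)
  = @pk (prod_dbl D E) (A, A1) (B, B1) (A', A1') (B', B1') (h, h1) (x, x1) (y, y1) (k, k1)
      (t, t1).
Proof.
  intros H H1.
  destruct (sqeq_pk H) as (e1 & e2 & e3 & e4 & e5), (sqeq_pk H1) as (e1' & e2' & e3' & e4' & e5').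
  destruct e1, e2, e3, e4, e1', e2', e3', e4'; cbn in e5, e5'; now subst.
Qed.

Lemma pk_hor_v2 (A B : D) (f g h : hh A B) (s : sq f (vid A) (vid B) g)
  (t : sq g (vid A) (vid B) h) :
  pk (@v2 (hor_ops D) A B f g h s t) = pk s </> pk t.
Proof. unfold v2, hor_ops; now rewrite pk_cast, pk_v. Qed.
End Folds.

Section FoldLaws.
Context {D : DoubleCat}.

Lemma comp_foldA (A B C E : D) (P : Fold A B) (Q : Fold B C) (R : Fold C E) :
  comp_fold (comp_fold P Q) R = comp_fold P (comp_fold Q R).
Proof.
  apply fold_ext; rewrite !pk_comp_fold; cbn [fu fh comp_fold].
  rewrite vcpA, <- pk_id_h; f_equal.
  assert (E1 : pk (id_h (fh P)) <|> (pk (fi Q) </> (pk (id_h (fh Q)) <|> pk (fi R)))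
    = (pk (id_h (fh P)) </> pk (id_h (fh P)))
        <|> (pk (fi Q) </> (pk (id_h (fh Q)) <|> pk (fi R)))).
  { f_equal; symmetry; eapply vcpl; [bd|sides]. }
  rewrite E1.
  ichr (pk (id_h (fh P))) (pk (fi Q)) (pk (id_h (fh P))) (pk (id_h (fh Q)) <|> pk (fi R)).
  now rewrite hcpA.
Qed.

Lemma comp_foldl (A B : D) (P : Fold A B) : comp_fold (id_fold A) P = P.
Proof.
  apply fold_ext; rewrite pk_comp_fold; cbn [fu fh fi id_fold].
  erewrite vcpl; [|bde|sides].
  rewrite pk_id_hv; eapply hcpl; [bd|sides].
  Unshelve. all: sides.
Qed.

Lemma comp_foldr (A B : D) (P : Fold A B) : comp_fold P (id_fold B) = P.
Proof.
  apply fold_ext; rewrite pk_comp_fold; cbn [fu fh fi id_fold].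
  rewrite pk_id_h; eapply vcpr; [bd|sides].
Qed.

Lemma companion_id (A : D) : is_companion (id_companion A).
Proof.
  unfold is_companion; cbn; split.
  - rewrite pk_id_h; now rewrite hcl.
  - rewrite <- pk_id_hv; eapply vcpl; [bd|sides].
Qed.

Lemma companion_comp (A B C : D) (u : vv A B) (v : vv B C) (κ : CompanionData u)
  (κ' : CompanionData v) :
  is_companion κ -> is_companion κ' -> is_companion (comp_companion κ κ').
Proof.
  (* By definitional eta a companion is [to_comp] of its fold and its ε. In this form its ι is the
     [fi] of a fold, so [pk_comp_fold] applies. *)
  enough (H : forall (P : Fold A B) (Q : Fold B C) (εP : sq (fh P) (fu P) (vid B) (hid B))
    (εQ : sq (fh Q) (fu Q) (vid C) (hid C)),
    is_companion (to_comp P εP) -> is_companion (to_comp Q εQ) ->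
    is_companion (comp_companion (to_comp P εP) (to_comp Q εQ)))
    by exact (H (of_comp κ) (of_comp κ') (cε κ) (cε κ')).
  clear; intros P Q εP εQ (hP & vP) (hQ & vQ); unfold is_companion.
  cbn [cι cε ch to_comp] in hP, vP, hQ, vQ.
  change (pk (cι (comp_companion (to_comp P εP) (to_comp Q εQ))))
    with (pk (fi (comp_fold P Q))).
  change (pk (cε (comp_companion (to_comp P εP) (to_comp Q εQ)))) with
    (pk (sqcast eq_refl eq_refl (vcl (vid C)) eq_refl
          (sqcast eq_refl eq_refl eq_refl (hcl (fh Q)) ⟦ εP | id_h (fh Q) ⟧ /// εQ))).
  change (pk (id_h (ch (comp_companion (to_comp P εP) (to_comp Q εQ)))))
    with (pk (id_h (hc (fh P) (fh Q)))).
  rewrite pk_comp_fold, pk_cast, pk_v, pk_cast, pk_h; cbn [fh fu comp_fold]; split.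
  - ichr (pk (fi P)) (pk εP <|> pk (id_h (fh Q))) (pk (id_h (fh P)) <|> pk (fi Q)) (pk εQ).
    rewrite hcpA, hQ, <- hcpA, hP, pk_id_h.
    eapply vcpl; [bd|sides].
  - rewrite <- vcpA, (vcpA _ _ (pk εP <|> _)).
    ich (pk (id_h (fh P))) (pk (fi Q)) (pk εP) (pk (id_h (fh Q))).
    erewrite vcpl; [|bd|sides]; erewrite vcpr; [|bd|sides].
    (* An Eckmann-Hilton argument: ε_P ends and ι_Q begins with identities of [B], so both
       composites equal [[ε_P|Id] / [Id|ι_Q]]. *)
    assert (E : pk εP <|> pk (fi Q) = pk εP </> pk (fi Q)).
    { erewrite <- (vcpr (a := pk εP)) at 1; [|bd|reflexivity].
      erewrite <- (vcpl (a := pk (fi Q))) at 1; [|bd|reflexivity].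
      ichr (pk εP) (pk (id_h (hid B))) (pk (id_h (hid B))) (pk (fi Q)).
      rewrite !pk_id_hv; f_equal; [eapply hcpr; [bd|sides]|eapply hcpl; [bd|sides]]. }
    rewrite E, <- vcpA, vP, vcpA, vQ; apply pk_id_v.
Qed.

Lemma companion_pair (E : DoubleCat) (A B : D) (A' B' : E) (u : vv A B) (v : vv A' B')
  (κ : CompanionData u) (κ' : CompanionData v) :
  is_companion κ -> is_companion κ' -> is_companion (pair_companion κ κ').
Proof.
  intros (h & w) (h' & w'); unfold is_companion.
  rewrite <- pk_h, <- pk_v; split; cbn; apply pk_pair; cbn.
  all: rewrite ?pk_h, ?pk_v; assumption.
Qed.

Lemma IsComp_id (A : D) : IsComp (id_fold A).
Proof. exists (id_h (hid A)); exact (companion_id A). Qed.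

Lemma IsComp_comp (A B C : D) (P : Fold A B) (Q : Fold B C) :
  IsComp P -> IsComp Q -> IsComp (comp_fold P Q).
Proof. intros (ε & h) (ε' & h'); eexists; exact (companion_comp h h'). Qed.

Lemma IsComp_pair (E : DoubleCat) (A B : prod_dbl D E) (P : Fold (fst A) (fst B))
  (Q : Fold (snd A) (snd B)) : IsComp P -> IsComp Q -> IsComp (pair_fold P Q).
Proof.
  intros (ε & h) (ε' & h'); destruct A, B; eexists; exact (companion_pair h h').
Qed.

(** A companion is an epimorphism for vertical composition. *)
Lemma cancel (A0 A B A' B' : D) (P : Fold A B) (f : hh A0 A) (x y : option (Packed D))
  (w w1 : vv A0 A') (z : vv B B') (g g1 : hh A' B') :
  IsComp P -> Bd x (hc f (fh P)) w z g -> Bd y (hc f (fh P)) w1 z g1 ->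
  pk (id_h f) <|> pk (fi P) </> x = pk (id_h f) <|> pk (fi P) </> y -> x = y.
Proof.
  intros (ε & h & _) Hx Hy E; cbn [cι cε ch to_comp] in h.
  (* Here [a] is recovered from [[Id_f|ι]/a] by placing [ε/Id^z] on its right: interchange brings ι
     next to ε, and [[ι|ε] = Id]. *)
  assert (K : forall a (u : vv A0 A') (k : hh A' B'), Bd a (hc f (fh P)) u z k ->
    a = (pk (id_h f) <|> pk (fi P) </> a) <|> (pk ε </> pk (id_v z))).
  { intros a u k Ha.
    ichr (pk (id_h f) <|> pk (fi P)) (pk ε) a (pk (id_v z)).
    rewrite hcpA, h, pk_id_h.
    erewrite (hcpr (a := a)); [|exact Ha|sides].
    symmetry; eapply vcpl; [exact Ha|sides]. }
  rewrite (K _ _ _ Hx), (K _ _ _ Hy), E; reflexivity.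
Qed.

Lemma cancel1 (A B A' B' : D) (P : Fold A B) (x y : option (Packed D))
  (w w1 : vv A A') (z : vv B B') (g g1 : hh A' B') :
  IsComp P -> Bd x (fh P) w z g -> Bd y (fh P) w1 z g1 ->
  pk (fi P) </> x = pk (fi P) </> y -> x = y.
Proof.
  intros HP Hx Hy E.
  eapply (cancel (f := hid A)); [exact HP|eapply Bd_eq; [exact Hx|sides..]
    |eapply Bd_eq; [exact Hy|sides..]|].
  rewrite pk_id_hv; erewrite hcpl; [exact E|bd|sides].
Qed.

Lemma Can_unique (A B : D) (P Q : Fold A B) (s s' : sq (fh P) (vid A) (vid B) (fh Q)) :
  IsComp P -> Can s -> Can s' -> s = s'.
Proof.
  intros HP H H'; apply pk_inj; eapply cancel1; [exact HP|bd|bd|].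
  now rewrite H, H'.
Qed.

Lemma Can_i2 (A B : D) (P : Fold A B) : @Can D A B P P (id_h (fh P)).
Proof. eapply vcpr; [bd|sides]. Qed.

Lemma Can_v2 (A B : D) (P Q R : Fold A B) (s : sq (fh P) (vid A) (vid B) (fh Q))
  (t : sq (fh Q) (vid A) (vid B) (fh R)) :
  Can s -> Can t -> @Can D A B P R (@v2 (hor_ops D) A B (fh P) (fh Q) (fh R) s t).
Proof. unfold Can; intros H H'; now rewrite pk_hor_v2, <- vcpA, H. Qed.

Lemma Can_inv (A B : D) (P Q : Fold A B) (s : sq (fh P) (vid A) (vid B) (fh Q))
  (t : sq (fh Q) (vid A) (vid B) (fh P)) :
  pk s </> pk t = pk (id_h (fh P)) -> Can s -> @Can D A B Q P t.
Proof.
  unfold Can; intros H <-; rewrite vcpA, H; eapply vcpr; [bd|sides].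
Qed.

Lemma Can_h2 (A B C : D) (P P' : Fold A B) (Q Q' : Fold B C)
  (s : sq (fh P) (vid A) (vid B) (fh P')) (t : sq (fh Q) (vid B) (vid C) (fh Q')) :
  Can s -> Can t -> @Can D A C (comp_fold P Q) (comp_fold P' Q') ⟦ s | t ⟧.
Proof.
  unfold Can; intros H H'; rewrite !pk_comp_fold; cbn [fu fh comp_fold]; rewrite pk_h, vcpA.
  ich (pk (id_h (fh P))) (pk (fi Q)) (pk s) (pk t).
  rewrite H'; erewrite vcpl; [|bd|sides].
  rewrite <- H, vcpA; f_equal.
  (* Since the top and left sides of ι_{Q'} are identities, [[s|ι_{Q'}]] equals [s / [Id|ι_{Q'}]].
     The arguments on lifts reuse this step. *)
  erewrite <- (vcpr (a := pk s)) at 1; [|bd|reflexivity].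
  erewrite <- (vcpl (a := pk (fi Q'))) at 1; [|bd|reflexivity].
  ichr (pk s) (pk (id_h (hid B))) (pk (id_h (fh P'))) (pk (fi Q')).
  rewrite pk_id_hv; f_equal; eapply hcpr; [bd|sides].
Qed.

(** Placed above [[ι_u|Id|ε_v]], the square ι_v meets ε_v and becomes Id^v, which leaves ι_u. *)
Lemma Can_lift_id (A B : D) (u v : vv A B) (e : u = v) (κ : CompanionData u)
  (κ' : CompanionData v) : is_companion κ' ->
  @Can D A B (of_comp κ') (of_comp κ) (lift_id e κ κ').
Proof.
  intros [_ Hv]; unfold Can, lift_id; cbn [fu fh fi of_comp].
  rewrite pk_cast, !pk_h, pk_cast.
  erewrite (hcpr (a := pk (cι κ))); [|bd|sides].
  erewrite <- (hcpl (a := pk (cι κ'))); [|bd|reflexivity].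
  rewrite <- pk_id_hv; subst v.
  ich (pk (id_h (hid A))) (pk (cι κ')) (pk (cι κ)) (pk (cε κ')).
  rewrite Hv; erewrite vcpl; [|bd|sides]; eapply hcpr; [bd|sides].
Qed.

Lemma companion_laws (A B : D) (u : vv A B) (κ : Companion u) : is_companion κ.
Proof.
  destruct κ as [κ Hh Hv]; unfold is_companion; cbn.
  rewrite <- pk_h, <- pk_v; split; now apply pk_sqeq.
Qed.

Lemma IsComp_of_comp (A B : D) (u : vv A B) (κ : Companion u) : IsComp (of_comp κ).
Proof. exists (cε κ); exact (companion_laws κ). Qed.

Lemma Can_exists (A B : D) (P Q : Fold A B) :
  IsComp P -> fu P = fu Q -> exists s, @Can D A B P Q s.
Proof.
  destruct P as [u f i], Q as [v g j]; cbn; intros (ε & h & w) ->; cbn in *.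
  exists (sqcast (hcl f) eq_refl eq_refl (hcr g) ⟦ j | ε ⟧).
  unfold Can; cbn; rewrite pk_cast, pk_h.
  erewrite <- (hcpl (a := pk i)); [|bd|reflexivity].
  rewrite <- pk_id_hv.
  ich (pk (id_h (hid A))) (pk i) (pk j) (pk ε).
  rewrite w; erewrite vcpl; [|bd|sides]; eapply hcpr; [bd|sides].
Qed.

(** The inverse is the canonical cell in the other direction: both composites are canonical
    endo-2-cells, hence equal to identities. *)
Lemma Can_invertible (A B : D) (P Q : Fold A B) (s : sq (fh P) (vid A) (vid B) (fh Q)) :
  IsComp P -> IsComp Q -> fu P = fu Q -> Can s ->
  @invertible2 (hor_ops D) A B (fh P) (fh Q) s.
Proof.
  intros HP HQ e H; destruct (Can_exists HQ (eq_sym e)) as [t Ht].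
  exists t; split; (eapply Can_unique; [eassumption|eapply Can_v2; eassumption|apply Can_i2]).
Qed.
End FoldLaws.

(** * Double functors *)

Section Globular.
Context {D : DblOps}.

Lemma eq2_gpk (A B : D) (f g f1 g1 : hh A B) (s : @two (hor_pre D) A B f g)
  (s1 : @two (hor_pre D) A B f1 g1) :
  @eq2 (hor_pre D) A B f g f1 g1 s s1 -> gpk s = gpk s1.
Proof. intros (e & e' & <-); destruct e, e'; reflexivity. Qed.

Lemma gpk_eq2 (A B : D) (f g f1 g1 : hh A B) (s : @two (hor_pre D) A B f g)
  (s1 : @two (hor_pre D) A B f1 g1) :
  gpk s = gpk s1 -> @eq2 (hor_pre D) A B f g f1 g1 s s1.
Proof. intros H; apply sqeq_eq2, sqeq_pk, H. Qed.

Lemma gpk_cast2 (A B : D) (f g f1 g1 : hh A B) (e : f = f1) (e' : g = g1)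
  (s : @two (hor_pre D) A B f g) : gpk (@cast2 (hor_pre D) A B f f1 g g1 e e' s) = gpk s.
Proof. now destruct e, e'. Qed.

Lemma gpk_as2 (A B : D) (f g f1 g1 : hh A B) (s : @two (hor_pre D) A B f g)
  (e : Strict f f1) (e' : Strict g g1) :
  gpk (@as2 (hor_pre D) A B f g f1 g1 s e e') = gpk s.
Proof. apply gpk_cast2. Qed.

Lemma gpk_v2 (A B : D) (f g h : hh A B) (s : @two (hor_pre D) A B f g)
  (t : @two (hor_pre D) A B g h) :
  gpk (@v2 (hor_ops D) A B f g h s t) = gpk s </> gpk t.
Proof. apply pk_hor_v2. Qed.

Lemma gpk_glue (A B : D) (f g g' h : hh A B) (s : @two (hor_pre D) A B f g)
  (t : @two (hor_pre D) A B g' h) (e : Strict g' g) :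
  gpk (@glue (hor_ops D) A B f g g' h s t e) = gpk s </> gpk t.
Proof. unfold glue; now rewrite gpk_v2, gpk_cast2. Qed.

Lemma gpk_h2 (A B C : D) (f g : hh A B) (f' g' : hh B C) (s : @two (hor_pre D) A B f g)
  (t : @two (hor_pre D) B C f' g') :
  gpk (@h2 (hor_ops D) A B C f g f' g' s t) = gpk s <|> gpk t.
Proof. apply pk_h. Qed.

Lemma gpk_i2 (A B : D) (f : hh A B) : gpk (@i2 (hor_ops D) A B f) = pk (id_h f).
Proof. reflexivity. Qed.

Lemma gpk_inj (A B : D) (f g : hh A B) (s t : @two (hor_pre D) A B f g) :
  gpk s = gpk t -> s = t.
Proof. apply pk_inj. Qed.
End Globular.

Ltac gpks := rewrite ?gpk_glue, ?gpk_as2, ?gpk_v2, ?gpk_h2, ?gpk_i2.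
Ltac gpks_in H := rewrite ?gpk_glue, ?gpk_as2, ?gpk_v2, ?gpk_h2, ?gpk_i2 in H.

Section Functor.
Context {D : DblOps} {E : DoubleCat} (F : DFun D E) (HF : is_double_functor F).

Local Notation "'Fh' f" := (m1 F f : @hh E _ _) (at level 10, f at level 9).
Definition sphi {A B C : D} (f : hh A B) (g : hh B C) :
  @sq E _ _ _ _ (m1 F (hc f g)) (vid _) (vid _) (hc (m1 F f) (m1 F g : hh (F B) (F C))) :=
  @phi _ _ F A B C f g.

Lemma Fp_v (A B A' B' A'' B'' : D) (a b : option (Packed D)) (f : hh A B) (u : vv A A')
  (v : vv B B') (g g1 : hh A' B') (u' : vv A' A'') (v' : vv B' B'') (h : hh A'' B'') :
  Bd a f u v g -> Bd b g1 u' v' h -> g = g1 -> Fp F (a </> b) = Fp F a </> Fp F b.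
Proof.
  intros [s ->] [t ->] ->; rewrite <- pk_v; cbn -[pk].
  change (pk (fs F (s /// t)) = pk (fs F s) </> pk (fs F t)).
  rewrite <- pk_v; apply pk_sqeq, (fs_sqv HF).
Qed.

Lemma Fp_id_h (A B : D) (f : hh A B) :
  Fp F (pk (id_h f)) = pk (@id_h E (F A) (F B) (m1 F f)).
Proof. exact (pk_sqeq (fs_id_h HF f)). Qed.

Lemma Fp_gpk (A B : D) (f g : hh A B) (s : sq f (vid A) (vid B) g) :
  Fp F (pk s) = gpk (f2 F s).
Proof. exact (pk_sqeq (fs_f2 HF s)). Qed.

Lemma Fp_h (A B C A' B' C' : D) (a b : option (Packed D)) (f : hh A B) (g : hh B C)
  (u : vv A A') (v v1 : vv B B') (w : vv C C') (f' : hh A' B') (g' : hh B' C') :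
  Bd a f u v f' -> Bd b g v1 w g' -> v = v1 ->
  (Fp F a <|> Fp F b) </> pk (sph F f' g') = pk (sph F f g) </> Fp F (a <|> b).
Proof.
  intros [s ->] [t ->] ->; rewrite <- pk_h.
  change ((pk (fs F s) <|> pk (fs F t)) </> pk (sph F f' g')
    = pk (sph F f g) </> pk (fs F ⟦ s | t ⟧)).
  rewrite <- pk_h, <- !pk_v; apply pk_sqeq, (sph_nat HF).
Qed.

Lemma Fp_id_v (A B : D) (u : vv A B) :
  pk (id_v (fv F u)) </> pk (sph0 F B) = pk (sph0 F A) </> Fp F (pk (id_v u)).
Proof.
  change (pk (id_v (fv F u)) </> pk (sph0 F B) = pk (sph0 F A) </> pk (fs F (id_v u))).
  rewrite <- !pk_v; apply pk_sqeq, (sph0_nat HF).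
Qed.

Lemma sph_sphi (A B C : D) (f : hh A B) (g : hh B C) :
  pk (sph F f g) </> pk (sphi f g) = pk (id_h (hc (m1 F f) (m1 F g : @hh E (F B) (F C)))).
Proof. rewrite <- (pk_hor_v2 (D := E)); exact (f_equal gpk (proj1 (ph_inv (df_hor HF) f g))). Qed.

Lemma sph0_sph0i (A : D) :
  pk (sph0 F A) </> pk (sph0i F A) = pk (@id_h E (F A) (F A) (hid (F A))).
Proof. rewrite <- (pk_hor_v2 (D := E)); exact (f_equal gpk (proj1 (ph0_inv (df_hor HF) A))). Qed.

Lemma sph_unitl (A B : D) (f : hh A B) :
  (pk (sph0 F A) <|> pk (@id_h E (F A) (F B) (m1 F f))) </> pk (sph F (hid A) f)
  = pk (@id_h E (F A) (F B) (m1 F f)).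
Proof.
  assert (H := eq2_gpk (ph_unitl (df_hor HF) f)); gpks_in H; exact H.
Qed.

Lemma sph_unitr (A B : D) (f : hh A B) :
  (pk (@id_h E (F A) (F B) (m1 F f)) <|> pk (sph0 F B)) </> pk (sph F f (hid B))
  = pk (@id_h E (F A) (F B) (m1 F f)).
Proof.
  assert (H := eq2_gpk (ph_unitr (df_hor HF) f)); gpks_in H; exact H.
Qed.
End Functor.

Section FunctorCanonical.
Context {D : DblOps} {E : DoubleCat} (F : DFun D E) (HF : is_double_functor F).

Lemma sphi_unitr (A B : D) (f : hh A B) :
  pk (sphi F f (hid B)) </> (pk (@id_h E (F A) (F B) (m1 F f)) <|> pk (sph0i F B))
  = pk (@id_h E (F A) (F B) (m1 F f)).
Proof.
  assert (H : (pk (@id_h E (F A) (F B) (m1 F f)) <|> pk (sph0 F B)) </> pk (sph F f (hid B))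
     </> (pk (sphi F f (hid B)) </> (pk (@id_h E (F A) (F B) (m1 F f)) <|> pk (sph0i F B)))
     = pk (@id_h E (F A) (F B) (m1 F f))).
  { rewrite (vcpA _ (pk (sph F f (hid B)))), <- (vcpA (pk (sph F f (hid B)))), (sph_sphi HF).
    erewrite (vcpl (f1 := hc (m1 F f) _)); [|bd|sides].
    ich (pk (@id_h E (F A) (F B) (m1 F f))) (pk (sph0 F B)) (pk (@id_h E (F A) (F B) (m1 F f))) (pk (sph0i F B)).
    rewrite (sph0_sph0i HF); erewrite vcpl; [|bd|sides]; rewrite pk_id_h; now rewrite hcr. }
  rewrite (sph_unitr HF) in H; erewrite vcpl in H; [exact H|bd|].
  cbn; now rewrite hcr.
Qed.

(** Horizontally, [[Fι|Fε]] is F of [[ι|ε] = Id] between a compositor and an inverse compositor; the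
    unitors included in ι and ε of the image cancel these by the unit laws. Vertically, F is strict
    and its unitors are natural. *)
Lemma companion_map (A B : D) (w : vv A B) (κ : CompanionData w) :
  is_companion κ -> is_companion (map_companion F κ).
Proof.
  enough (H : forall (P : Fold A B) (ε : sq (fh P) (fu P) (vid B) (hid B)),
    is_companion (to_comp P ε) -> is_companion (map_companion F (to_comp P ε)))
    by exact (H (of_comp κ) (cε κ)).
  clear w κ; intros P ε (h & v); unfold is_companion.
  cbn [cι cε ch to_comp] in h, v.
  change (pk (cι (map_companion F (to_comp P ε)))) with (pk (fi (map_fold F P))).
  change (pk (cε (map_companion F (to_comp P ε)))) with
    (pk (sqcast eq_refl (vcr (fv F (fu P)))
       (eq_trans (f_equal (fun x => x // vid (F B)) (fv_id F B)) (vcl (vid (F B))))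
       eq_refl (fs F ε /// sph0i F B))).
  change (pk (id_h (ch (map_companion F (to_comp P ε)))))
    with (pk (@id_h E (F A) (F B) (m1 F (fh P)))).
  rewrite pk_map_fold, pk_cast, pk_v; change (pk (fs F ε)) with (Fp F (pk ε)).
  cbn [fu fh map_fold]; split.
  - set (i := pk (@id_h E (F A) (F B) (m1 F (fh P)))).
    assert (E1 : Fp F (pk ε) </> pk (sph0i F B) = i </> (Fp F (pk ε) </> pk (sph0i F B))).
    { symmetry; unfold i; eapply vcpl; [bd|sides]. }
    rewrite E1.
    ichr (pk (sph0 F A)) i (Fp F (pk (fi P))) (Fp F (pk ε) </> pk (sph0i F B)).
    assert (E2 : Fp F (pk (fi P)) <|> (Fp F (pk ε) </> pk (sph0i F B))
      = (Fp F (pk (fi P)) </> i) <|> (Fp F (pk ε) </> pk (sph0i F B))).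
    { f_equal; symmetry; eapply vcpr; [bd|sides]. }
    rewrite E2.
    ichr (Fp F (pk (fi P))) (Fp F (pk ε)) i (pk (sph0i F B)).
    assert (E3 : Fp F (pk (fi P)) <|> Fp F (pk ε)
       = pk (sph F (hid A) (fh P)) </> pk (sphi F (fh P) (hid B))).
    { erewrite <- (vcpr (a := _ <|> _)); [|bd|reflexivity].
      rewrite <- (sph_sphi HF), <- vcpA.
      erewrite (Fp_h HF); [|bd|bd|reflexivity].
      rewrite h, (Fp_id_h HF); f_equal; eapply vcpr; [bd|sides]. }
    rewrite E3; unfold i at 1.
    rewrite <- !vcpA, (sph_unitl HF), vcpA, (sphi_unitr); eapply vcpl; [bd|sides].
  - rewrite vcpA, <- (vcpA (Fp F (pk (fi P)))).
    erewrite <- (Fp_v HF); [|bd|bd|reflexivity].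
    rewrite v, <- vcpA, <- (Fp_id_v HF), vcpA, (sph0_sph0i HF).
    eapply vcpr; [bd|sides].
Qed.

Lemma IsComp_map (A B : D) (P : Fold A B) : IsComp P -> IsComp (map_fold F P).
Proof. intros (ε & h); eexists; exact (companion_map h). Qed.

Lemma Can_f2 (A B : D) (P Q : Fold A B) (s : sq (fh P) (vid A) (vid B) (fh Q)) :
  Can s -> @Can E (F A) (F B) (map_fold F P) (map_fold F Q) (f2 F s).
Proof.
  unfold Can; intros H.
  rewrite !pk_map_fold, vcpA; cbn [fu fh map_fold].
  change (pk (sph0 F A) </> (Fp F (pk (fi P)) </> gpk (f2 F s))
    = pk (sph0 F A) </> Fp F (pk (fi Q))).
  rewrite <- (Fp_gpk HF); erewrite <- (Fp_v HF); [|bd|bd|reflexivity].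
  now rewrite H.
Qed.

(** The ι of the composite of the images contains the unitor at [B]. Naturality moves the compositor
    above the images of Id and ι_Q, where the right unit law cancels it against this unitor. *)
Lemma Can_ph (A B C : D) (P : Fold A B) (Q : Fold B C) :
  @Can E (F A) (F C) (comp_fold (map_fold F P) (map_fold F Q))
    (map_fold F (comp_fold P Q)) (ph F (fh P) (fh Q)).
Proof.
  unfold Can.
  change (pk (fi (comp_fold (map_fold F P) (map_fold F Q))) </> pk (sph F (fh P) (fh Q))
    = pk (fi (map_fold F (comp_fold P Q)))).
  rewrite pk_comp_fold, !pk_map_fold, pk_comp_fold; cbn [fu fh map_fold comp_fold].
  rewrite !vcpA; f_equal.
  set (i := pk (@id_h E (F A) (F B) (m1 F (fh P)))).
  assert (E1 : i <|> (pk (sph0 F B) </> Fp F (pk (fi Q)))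
    = (i <|> pk (sph0 F B)) </> (i <|> Fp F (pk (fi Q)))).
  { unfold i; ich (pk (@id_h E (F A) (F B) (m1 F (fh P)))) (pk (sph0 F B)) (pk (@id_h E (F A) (F B) (m1 F (fh P)))) (Fp F (pk (fi Q))).
    f_equal; symmetry; eapply vcpl; [bd|sides]. }
  rewrite E1, vcpA; unfold i at 2; rewrite <- (Fp_id_h HF).
  erewrite (Fp_h HF); [|bd|bd|sides].
  rewrite <- (vcpA _ (pk (sph F _ _))); unfold i; rewrite (sph_unitr HF).
  erewrite (vcpl (a := Fp F (pk (id_h (fh P)) <|> _))); [|bd|sides].
  erewrite <- (Fp_v HF); [reflexivity|bd|bd|sides].
Qed.

Lemma Can_phi (A B C : D) (P : Fold A B) (Q : Fold B C) :
  @Can E (F A) (F C) (map_fold F (comp_fold P Q)) (comp_fold (map_fold F P) (map_fold F Q))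
    (phi F (fh P) (fh Q)).
Proof. eapply Can_inv; [apply (sph_sphi HF)|apply Can_ph]. Qed.

Lemma Can_ph0 (A : D) :
  @Can E (F A) (F A) (id_fold (F A)) (map_fold F (id_fold A)) (ph0 F A).
Proof.
  unfold Can; rewrite pk_map_fold; cbn [fu fh fi map_fold id_fold].
  rewrite (Fp_id_h HF).
  etransitivity; [eapply (vcpl (D := E)); [exact (Bd_pk (sph0 F A))|sides]|].
  symmetry; eapply vcpr; [bd|sides].
Qed.

Lemma Can_ph0i (A : D) :
  @Can E (F A) (F A) (map_fold F (id_fold A)) (id_fold (F A)) (ph0i F A).
Proof. eapply Can_inv; [apply (sph0_sph0i HF)|apply Can_ph0]. Qed.
End FunctorCanonical.

Lemma map_fold_comp (D E : DblOps) (E' : DoubleCat) (G : DFun D E) (H : DFun E E') (A B : D)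
  (P : Fold A B) : is_double_functor H ->
  map_fold (comp_dfun H G) P = map_fold H (map_fold G P).
Proof.
  intros HH; apply fold_ext; rewrite pk_map_fold.
  etransitivity; [|symmetry; exact (pk_map_fold H (map_fold G P))].
  rewrite (pk_map_fold G P); cbn [fu fh map_fold].
  erewrite (Fp_v HH); [|bd|bd|sides].
  rewrite <- vcpA; change (Fp (comp_dfun H G) (pk (fi P))) with (Fp H (Fp G (pk (fi P)))).
  f_equal; rewrite (Fp_gpk HH); exact (gpk_v2 (ph0 H (G A)) (f2 H (ph0 G A))).
Qed.

Lemma map_fold_pair (D E E' : DblOps) (G : DFun D E) (H : DFun D E') (A B : D)
  (P : Fold A B) :
  map_fold (pair_dfun G H) P
  = @pair_fold E E' (G A, H A) (G B, H B) (map_fold G P) (map_fold H P).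
Proof.
  apply fold_ext; rewrite pk_map_fold.
  etransitivity; [symmetry; apply (pk_v (sph0 (pair_dfun G H) A) (fs (pair_dfun G H) (fi P)))|].
  apply (pk_pair (s := sph0 G A /// fs G (fi P)) (s1 := sph0 H A /// fs H (fi P))
    (t := fi (map_fold G P)) (t1 := fi (map_fold H P)));
    unfold map_fold; cbn [fi]; symmetry; apply pk_cast.
Qed.

(** * Companion-lifts *)

(** A horizontal transformation presented as the companion-lift of the vertical
    transformation with components [lu] and squares [ls]. *)
Record Lifted (D E : DblOps) (F G : DMap D E) (α : HNat F G) : Type := {
  lu : forall A : D, @vv E (F A) (G A);
  li : forall A : D, @sq E _ _ _ _ (hid (F A)) (vid (F A)) (lu A) (α A);
  ls : forall (A B : D) (f : hh A B),
      @sq E (F A) (F B) (G A) (G B) (m1 F f) (lu A) (lu B) (m1 G f);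
  li_comp : forall A : D, IsComp (MkFold (li A));
  li_nd : forall (A B : D) (f : hh A B),
      (pk (@id_h E (F A) (F B) (m1 F f)) <|> pk (li B)) </> gpk (nd α f)
      = pk (li A) <|> pk (ls f);
  li_hs : forall (A B : D) (u : vv A B),
      pk (li A) </> pk (hs α u) = pk (id_v (mv F u)) </> pk (li B) }.

Definition lf (D E : DblOps) (F G : DMap D E) (α : HNat F G) (a : Lifted α) (A : D) :
  @Fold E (F A) (G A) := MkFold (li a A).

(** This is what [lift_horizontal] asks of the source and target of a transformation. It passes
    directly to composites and pairings, hence to functors such as [(A B) C]. *)
Definition globular_action (D E : DblOps) (F : DFun D E) : Prop :=
  forall (A B : D) (f g : hh A B) (s : sq f (vid A) (vid B) g),
    Fp F (pk s) = gpk (f2 F s).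

(** * The companion-lift of one vertical transformation *)

Section LiftTransformation.
Context {D : DblOps} {E : DoubleCat} {F G : DFun D E} (α : VNat F G)
  (inv : VInvertible α) (κ : Liftable α).

Local Notation "'Fi' f" := (pk (@id_h E _ _ (m1 F f))) (at level 10, f at level 9).
Local Notation "'Gi' f" := (pk (@id_h E _ _ (m1 G f))) (at level 10, f at level 9).
Local Notation "'ι' A" := (pk (cι (κ A))) (at level 10, A at level 9).
Local Notation "'ε' A" := (pk (cε (κ A))) (at level 10, A at level 9).

Lemma comp_vp (A : D) : ι A </> ε A = pk (id_v (α A)).
Proof. rewrite <- pk_v; apply pk_sqeq, comp_v. Qed.

Lemma pk_lift_δ (A B : D) (f : hh A B) :
  pk (lift_δ κ f) = (ι A <|> pk (vs α f)) <|> ε B.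
Proof. unfold lift_δ; now rewrite pk_cast, !pk_h. Qed.

Lemma pk_lift_δinv (A B : D) (f : hh A B) :
  pk (lift_δinv inv κ f)
  = (ε A <|> Gi f) </> pk (inv_sq (inv f)) </> (Fi f <|> ι B).
Proof. unfold lift_δinv; now rewrite pk_cast, !pk_v, !pk_cast, !pk_h. Qed.

Lemma pk_lift_sq (A B : D) (u : vv A B) :
  pk (lift_sq κ u)
  = (pk (id_v (fv F u)) </> ι B) <|> (ε A </> pk (id_v (fv G u))).
Proof. unfold lift_sq; now rewrite pk_cast, pk_h, pk_cast, !pk_v. Qed.

(** The added ι_{α(B)} lies above the ε_{α(B)} of the lift, and the two compose to an identity. *)
Lemma lift_nd (A B : D) (f : hh A B) :
  (Fi f <|> ι B) </> pk (lift_δ κ f) = ι A <|> pk (vs α f).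
Proof.
  rewrite pk_lift_δ.
  ich (Fi f) (ι B) (ι A <|> pk (vs α f)) (ε B).
  rewrite comp_vp; erewrite vcpl; [|bd|sides]; eapply hcpr; [bd|sides].
Qed.

Lemma lift_hs (A B : D) (u : vv A B) :
  ι A </> pk (lift_sq κ u) = pk (id_v (fv F u)) </> ι B.
Proof.
  rewrite pk_lift_sq.
  erewrite <- (hcpl (a := ι A)); [|bd|reflexivity].
  rewrite <- pk_id_hv.
  (* Read by [sides]: the two halves of the lifted square meet along F(u)/α(B) and α(A)/G(u), which
     are equal only by naturality. *)
  assert (N := vt_nat α u).
  ich (pk (id_h (hid (F A)))) (ι A) (pk (id_v (fv F u)) </> ι B) (ε A </> pk (id_v (fv G u))).
  rewrite <- (vcpA (ι A)), comp_vp, pk_id_v.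
  erewrite vcpl; [|bd|sides]; eapply hcpr; [bd|sides].
Qed.

Definition lift_lifted : Lifted (lift inv κ).
Proof.
  unshelve refine (@Build_Lifted D E F G (lift inv κ) (fun A => α A) (fun A => cι (κ A))
    (fun A B f => vs α f) _ _ _).
  - intros A; exact (IsComp_of_comp (κ A)).
  - intros A B f; exact (lift_nd f).
  - intros A B u; exact (lift_hs u).
Defined.

Lemma vs_natp (A B A' B' : D) (a : option (Packed D)) (f : hh A B) (u : vv A A')
  (v : vv B B') (g : hh A' B') : Bd a f u v g ->
  Fp F a </> pk (vs α g) = pk (vs α f) </> Fp G a.
Proof.
  intros [s ->].
  change (pk (fs F s) </> pk (vs α g) = pk (vs α f) </> pk (fs G s)).
  rewrite <- !pk_v; apply pk_sqeq, vs_nat.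
Qed.

Lemma vs_php (A B C : D) (f : hh A B) (g : hh B C) :
  pk (sph F f g) </> pk (vs α (hc f g))
  = (pk (vs α f) <|> pk (vs α g)) </> pk (sph G f g).
Proof. rewrite <- pk_h, <- !pk_v; apply pk_sqeq, vs_ph. Qed.

Lemma vs_ph0p (A : D) :
  pk (sph0 F A) </> pk (vs α (hid A)) = pk (id_v (α A)) </> pk (sph0 G A).
Proof. rewrite <- !pk_v; apply pk_sqeq, vs_ph0. Qed.

(** For δ followed by its inverse, cancelling ι_{α(B)} reduces the claim to ι_{α(A)}/ε_{α(A)} being
    an identity and α_f/α_f^{-1} = Id. In the other order [lift_nd] applies directly, since the
    inverse ends in [[Id|ι_{α(B)}]]. *)
Lemma lift_inverse (A B : D) (f : hh A B) :
  @inverse2 (hor_ops E) (F A) (G B) _ _ (lift_δ κ f) (lift_δinv inv κ f).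
Proof.
  assert (Hr := pk_sqeq (inv_sqr (inv f))); assert (Hl := pk_sqeq (inv_sql (inv f))).
  destruct (inv_sqr (inv f)) as (_ & erl & err & _).
  destruct (inv_sql (inv f)) as (_ & ell & elr & _).
  rewrite pk_v in Hr, Hl.
  split; apply gpk_inj; rewrite gpk_v2; unfold gpk; rewrite pk_lift_δinv.
  - eapply (cancel (P := of_comp (κ B)) (f := (m1 F f : @hh E (F A) (F B)))
      (w := vid (F A)) (w1 := vid (F A)) (z := vid (G B))).
    + apply IsComp_of_comp.
    + rewrite pk_lift_δ; bde.
    + bde.
    + cbn [fu fh fi of_comp]; rewrite <- vcpA, lift_nd, <- !vcpA.
      ich (ι A) (pk (vs α f)) (ε A) (Gi f).
      rewrite comp_vp; erewrite (vcpr (a := pk (vs α f))); [|bd|sides].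
      erewrite (hcpl (a := pk (vs α f))); [|bd|sides].
      rewrite Hr; erewrite vcpl; [|bd|sides].
      etransitivity; [symmetry; eapply vcpr; [bd|reflexivity]|reflexivity].
  - rewrite !vcpA, lift_nd.
    erewrite <- (hcpl (a := pk (inv_sq (inv f)))); [|bd|reflexivity].
    ich (pk (id_v (inv_l (inv f)))) (pk (inv_sq (inv f))) (ι A) (pk (vs α f)).
    rewrite Hl.
    ich (ε A) (Gi f) (pk (id_v (inv_l (inv f))) </> ι A) (Gi f).
    erewrite (vcpl (a := Gi f)); [|bd|sides].
    (* Cancelling ι_{α(A)} turns ε_{α(A)} into Id^{α(A)}, which cancels against the inverse 1v-cell
       on the left of α_f^{-1}. *)
    assert (K : ε A </> (pk (id_v (inv_l (inv f))) </> ι A) = pk (id_h (ch (κ A)))).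
    { eapply (cancel1 (P := of_comp (κ A))); [apply IsComp_of_comp|bd|bde|].
      cbn [fu fh fi of_comp]; rewrite <- !vcpA, comp_vp, pk_id_v, erl, <- pk_id_hv.
      erewrite vcpl; [|bd|sides]; symmetry; eapply vcpr; [bd|sides]. }
    rewrite K, pk_id_h; reflexivity.
Qed.

Local Notation Lδ f := (lift_δ κ f).

(** Once ι_{α(B)} is cancelled, [lift_nd] and [lift_hs] remove all lifted cells except one δ_g, and
    what remains is naturality of α at the square [s], placed beside Id^{F(u)}. *)
Lemma lift_ht_nat (A B A' B' : D) (f : hh A B) (u : vv A A') (v : vv B B')
  (g : hh A' B') (s : sq f u v g) :
  (pk (fs F s) <|> pk (lift_sq κ v)) </> pk (Lδ g)
  = pk (Lδ f) </> (pk (lift_sq κ u) <|> pk (fs G s)).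
Proof.
  assert (Nu := vt_nat α u); assert (Nv := vt_nat α v).
  eapply (cancel (P := of_comp (κ B)) (f := (m1 F f : @hh E (F A) (F B)))
      (w := fv F u) (w1 := fv F u) (z := fv G v)).
  - apply IsComp_of_comp.
  - bde.
  - bde.
  - cbn [fu fh fi of_comp]; rewrite <- !vcpA, lift_nd.
    ich (Fi f) (ι B) (pk (fs F s)) (pk (lift_sq κ v)).
    rewrite lift_hs; erewrite (vcpl (a := pk (fs F s))); [|bd|sides].
    ich (ι A) (pk (vs α f)) (pk (lift_sq κ u)) (pk (fs G s)).
    rewrite lift_hs; change (pk (fs G s)) with (Fp G (pk s)).
    erewrite <- vs_natp; [|bd]; change (Fp F (pk s)) with (pk (fs F s)).
    ichr (pk (id_v (fv F u))) (pk (fs F s)) (ι A') (pk (vs α g)).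
    rewrite <- lift_nd, <- vcpA; f_equal.
    erewrite (hcpl (a := pk (fs F s))); [|bd|sides].
    erewrite <- (hcpr (a := pk (fs F s))) at 2; [|bd|reflexivity].
    ich (pk (fs F s)) (pk (id_v (fv F v))) (Fi g) (ι B').
    erewrite (vcpr (a := pk (fs F s))); [|bd|sides]; reflexivity.
Qed.

Lemma lift_horizontal : globular_action F -> globular_action G ->
  is_horizontal_transformation (lift inv κ).
Proof.
  intros gF gG.
  (* Needed twice: as the unit law for lifted squares, and to read naturality in 2-cells off
     naturality in squares. *)
  assert (Hid : forall A : D, pk (lift_sq κ (vid A)) = pk (id_h (ch (κ A)))).
  { intros A.
    eapply (cancel1 (P := of_comp (κ A)) (w := fv F (vid A)) (w1 := vid (F A)) (z := fv G (vid A)));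
      [apply IsComp_of_comp|bde|bde|].
    cbn [fu fh fi of_comp]; rewrite lift_hs, fv_id, <- pk_id_hv.
    erewrite vcpl; [|bd|sides]; symmetry; eapply vcpr; [bd|sides]. }
  split; [split|..].
  - intros A B f; apply lift_inverse.
  (* This is [lift_ht_nat] at identity 1v-cells, where the lifted squares are identities and [fs]
     agrees with [f2]. *)
  - intros A B f g s; apply gpk_eq2; gpks.
    change (gpk (nd (lift inv κ) f)) with (pk (Lδ f)).
    change (gpk (nd (lift inv κ) g)) with (pk (Lδ g)).
    assert (H := lift_ht_nat s); rewrite !Hid in H.
    change (pk (fs F s)) with (Fp F (pk s)) in H; change (pk (fs G s)) with (Fp G (pk s)) in H.
    rewrite gF, gG in H; exact H.
  - intros A B C f g; apply gpk_eq2; gpks.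
    change (gpk (nd (lift inv κ) (f · g))) with (pk (Lδ (hc f g))).
    change (gpk (nd (lift inv κ) f)) with (pk (Lδ f)).
    change (gpk (nd (lift inv κ) g)) with (pk (Lδ g)).
    change (gpk (ph F f g)) with (pk (sph F f g)).
    change (gpk (ph G f g)) with (pk (sph G f g)).
    change ((pk (sph F f g) <|> pk (id_h (ch (κ C)))) </> pk (Lδ (hc f g))
      = ((Fi f <|> pk (Lδ g)) </> (pk (Lδ f) <|> Gi g)) </> (pk (id_h (ch (κ A))) <|> pk (sph G f g))).
    (* Both sides become ι_{α(A)} beside the composite of a compositor with α, by [lift_nd] at [g],
       at [f] and at their composite; [vs_ph] identifies the results. *)
    eapply (cancel (P := of_comp (κ C)) (f := hc (m1 F f : @hh E (F A) (F B)) (m1 F g : @hh E (F B) (F C)))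
      (w := vid (F A)) (w1 := vid (F A)) (z := vid (G C)));
      [apply IsComp_of_comp|bde|bde|].
    cbn [fu fh fi of_comp]; rewrite <- !vcpA.
    ich (pk (id_h (hc (m1 F f : @hh E (F A) (F B)) (m1 F g : @hh E (F B) (F C))))) (ι C) (pk (sph F f g)) (pk (id_h (ch (κ C)))).
    erewrite vcpl; [|bd|sides]; erewrite (vcpr (a := ι C)); [|bd|sides].
    rewrite <- pk_id_h, hcpA.
    ich (Fi f) (Fi g <|> ι C) (Fi f) (pk (Lδ g)).
    rewrite lift_nd; erewrite vcpl; [|bd|sides].
    rewrite <- hcpA.
    ich (Fi f <|> ι B) (pk (vs α g)) (pk (Lδ f)) (Gi g).
    rewrite lift_nd; erewrite (vcpr (a := pk (vs α g))); [|bd|sides].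
    rewrite hcpA.
    ich (ι A) (pk (vs α f) <|> pk (vs α g)) (pk (id_h (ch (κ A)))) (pk (sph G f g)).
    rewrite <- vs_php; erewrite (vcpr (a := ι A)); [|bd|sides].
    erewrite <- (vcpr (a := pk (sph F f g))) at 1; [|bd|reflexivity].
    erewrite <- (vcpl (a := ι C)); [|bd|reflexivity].
    ichr (pk (sph F f g)) (pk (id_h (hid (F C)))) (Fi (hc f g)) (ι C).
    rewrite vcpA, lift_nd, pk_id_hv.
    erewrite (hcpr (a := pk (sph F f g))); [|bd|sides].
    erewrite <- (hcpl (a := pk (sph F f g))) at 1; [|bd|reflexivity].
    ich (pk (id_v (vid (F A)))) (pk (sph F f g)) (ι A) (pk (vs α (hc f g))).
    f_equal; rewrite <- pk_id_hv; eapply vcpl; [bd|sides].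
  - intros A; apply gpk_eq2; gpks.
    change ((pk (sph0 F A) <|> pk (id_h (ch (κ A)))) </> pk (Lδ (hid A))
      = pk (id_h (ch (κ A))) <|> pk (sph0 G A)).
    eapply (cancel (P := of_comp (κ A)) (f := hid (F A)) (w := vid (F A)) (w1 := vid (F A)) (z := vid (G A)));
      [apply IsComp_of_comp|bde|bde|].
    cbn [fu fh fi of_comp]; rewrite <- !vcpA.
    ich (pk (id_h (hid (F A)))) (ι A) (pk (sph0 F A)) (pk (id_h (ch (κ A)))).
    erewrite vcpl; [|bd|sides]; erewrite (vcpr (a := ι A)); [|bd|sides].
    rewrite pk_id_hv at 1.
    erewrite (hcpl (a := ι A)); [|bd|sides].
    erewrite <- (hcpr (a := ι A)) at 2; [|bd|reflexivity].
    ich (ι A) (pk (id_v (α A))) (pk (id_h (ch (κ A)))) (pk (sph0 G A)).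
    rewrite <- vs_ph0p; erewrite (vcpr (a := ι A)); [|bd|sides].
    erewrite <- (vcpr (a := pk (sph0 F A))) at 1; [|bd|reflexivity].
    erewrite <- (vcpl (a := ι A)) at 1; [|bd|reflexivity].
    ichr (pk (sph0 F A)) (pk (id_h (hid (F A)))) (Fi (hid A)) (ι A).
    rewrite vcpA, lift_nd, pk_id_hv.
    erewrite (hcpr (a := pk (sph0 F A))); [|bd|sides].
    erewrite <- (hcpl (a := pk (sph0 F A))) at 1; [|bd|reflexivity].
    ich (pk (id_v (vid (F A)))) (pk (sph0 F A)) (ι A) (pk (vs α (hid A))).
    f_equal; rewrite <- pk_id_hv; eapply vcpl; [bd|sides].
  - intros A; apply sqeq_pk; exact (Hid A).
  - intros A B C u v; apply sqeq_pk; rewrite pk_v; cbn [hs lift].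
    assert (Nu := vt_nat α u); assert (Nv := vt_nat α v).
    eapply (cancel1 (P := of_comp (κ A)) (w := fv F (u // v)) (w1 := fv F u // fv F v) (z := fv G (u // v)));
      [apply IsComp_of_comp|bde|bde|].
    cbn [fu fh fi of_comp]; rewrite <- !vcpA, !lift_hs, vcpA, lift_hs, <- vcpA, pk_id_v, fv_vc.
    reflexivity.
  - intros A B A' B' f u v g s; apply sqeq_pk; rewrite !pk_v, !pk_h; exact (lift_ht_nat s).
Qed.

(** Naturality of α at the square ι_P exchanges F(ι_P) above α at the companion for α at the
    identity above G(ι_P). Compatibility with unitors then turns α at the identity into
    Id^{α(A)}. *)
Lemma Can_nd (A B : D) (P : Fold A B) :
  @Can E (F A) (G B) (comp_fold (map_fold F P) (of_comp (κ B)))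
    (comp_fold (of_comp (κ A)) (map_fold G P)) (lift_δ κ (fh P)).
Proof.
  unfold Can; rewrite !pk_comp_fold, !pk_map_fold; cbn [fu fh fi map_fold of_comp comp_fold].
  rewrite !vcpA, lift_nd, <- vcpA.
  set (x := pk (sph0 F A) </> Fp F (pk (fi P))).
  erewrite <- (hcpl (a := x) (u1 := vid (F A))); [|bd|sides]; unfold x; clear x.
  ich (pk (id_v (vid (F A)))) (pk (sph0 F A) </> Fp F (pk (fi P))) (ι A) (pk (vs α (fh P))).
  rewrite <- pk_id_hv; erewrite vcpl; [|bd|sides].
  rewrite vcpA; erewrite vs_natp; [|bd].
  rewrite <- vcpA, vs_ph0p, vcpA.
  erewrite <- (vcpr (a := ι A)) at 1; [|bd|reflexivity].
  ichr (ι A) (pk (id_v (α A))) (pk (id_h (ch (κ A)))) (pk (sph0 G A) </> Fp G (pk (fi P))).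
  f_equal; eapply hcpr; [bd|sides].
Qed.

Lemma Can_ndi (A B : D) (P : Fold A B) :
  @Can E (F A) (G B) (comp_fold (of_comp (κ A)) (map_fold G P))
    (comp_fold (map_fold F P) (of_comp (κ B))) (lift_δinv inv κ (fh P)).
Proof.
  eapply Can_inv; [|exact (Can_nd P)].
  assert (H := f_equal gpk (proj1 (lift_inverse (fh P)))); rewrite gpk_v2 in H; exact H.
Qed.
End LiftTransformation.

(** * Stability of lifts under composition, whiskering and pairing *)

Section LiftedOperations.
Context {D : DblOps} {E : DoubleCat}.

(** Kept transparent, like the other operations on [Lifted]: the squares [ls] of a composite have to
    compute to the pastings in the equations of the vertical structure. *)
Definition comp_lifted {F G H : DMap D E} {α : HNat F G} {β : HNat G H}
  (a : Lifted α) (b : Lifted β) : Lifted (comp_hnat α β).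
Proof.
  unshelve refine (@Build_Lifted D E F H (comp_hnat α β) (fun A => lu a A // lu b A)
    (fun A => fi (comp_fold (lf a A) (lf b A)))
    (fun A B f => ls a f /// ls b f) _ _ _).
  - intros A; exact (IsComp_comp (li_comp a A) (li_comp b A)).
  - intros A B f.
    change ((pk (@id_h E (F A) (F B) (m1 F f)) <|> pk (fi (comp_fold (lf a B) (lf b B))))
      </> gpk (nd (@comp_nat (hor_pre D) (hor_ops E) F G H α β) f)
      = pk (fi (comp_fold (lf a A) (lf b A))) <|> pk (ls a f /// ls b f)).
    assert (En : gpk (nd (@comp_nat (hor_pre D) (hor_ops E) F G H α β) f)
      = (gpk (nd α f) <|> pk (@id_h E (G B) (H B) (β B)))
        </> (pk (@id_h E (F A) (G A) (α A)) <|> gpk (nd β f))).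
    { etransitivity; [apply gpk_as2|]; gpks; reflexivity. }
    rewrite En, !pk_comp_fold; cbn [fu fh fi lf].
    set (Fi := pk (@id_h E (F A) (F B) (m1 F f))).
    set (Gi := pk (@id_h E (G A) (G B) (m1 G f))).
    set (αA := pk (@id_h E (F A) (G A) (α A))).
    set (αB := pk (@id_h E (F B) (G B) (α B))).
    set (βB := pk (@id_h E (G B) (H B) (β B))).
    assert (E1 : Fi <|> (pk (li a B) </> (αB <|> pk (li b B)))
      = (Fi <|> pk (li a B)) </> ((Fi <|> αB) <|> pk (li b B))).
    { rewrite hcpA; ich Fi (pk (li a B)) Fi (αB <|> pk (li b B)).
      f_equal; symmetry; eapply vcpl; [bd|sides]. }
    rewrite E1, vcpA, <- (vcpA _ (gpk (nd α f) <|> βB)).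
    unfold Fi at 2, αB; rewrite pk_id_h.
    ich (pk (id_h (hc (m1 F f : @hh E (F A) (F B)) (α B)))) (pk (li b B)) (gpk (nd α f)) βB.
    erewrite (vcpl (a := gpk (nd α f))); [|bd|sides].
    unfold βB; erewrite (vcpr (a := pk (li b B))); [|bd|sides].
    assert (E2 : gpk (nd α f) <|> pk (li b B)
      = gpk (nd α f) </> ((αA <|> Gi) <|> pk (li b B))).
    { unfold αA, Gi; rewrite pk_id_h.
      erewrite <- (vcpr (a := gpk (nd α f))
        (g1 := hc (α A) (m1 G f : @hh E (G A) (G B)))) at 1; [|bd|reflexivity].
      erewrite <- (vcpl (a := pk (li b B))) at 1; [|bd|reflexivity].
      ichr (gpk (nd α f)) (pk (id_h (hid (G B)))) (pk (id_h (hc (α A) (m1 G f : @hh E (G A) (G B))))) (pk (li b B)).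
      rewrite (pk_id_hv (G B)); f_equal; eapply hcpr; [bd|sides]. }
    rewrite E2, vcpA, hcpA.
    ich αA (Gi <|> pk (li b B)) αA (gpk (nd β f)).
    unfold Gi; rewrite (li_nd b f), <- vcpA; unfold Fi; rewrite (li_nd a f).
    unfold αA; erewrite (vcpl (a := pk (@id_h E (F A) (G A) (α A)))); [|bd|sides].
    fold αA.
    rewrite <- hcpA.
    ich (pk (li a A)) (pk (ls a f)) (αA <|> pk (li b A)) (pk (ls b f)).
    now rewrite pk_v.
  - intros A B u.
    change (pk (fi (comp_fold (lf a A) (lf b A))) </> pk ⟦ hs α u | hs β u ⟧
      = pk (id_v (mv F u)) </> pk (fi (comp_fold (lf a B) (lf b B)))).
    rewrite !pk_comp_fold, pk_h; cbn [fu fh fi lf].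
    set (αA := pk (@id_h E (F A) (G A) (α A))).
    set (αB := pk (@id_h E (F B) (G B) (α B))).
    rewrite vcpA.
    (* Naturality of the vertical components is not a field of [Lifted]; it is the equality of the
       right sides of the two squares in [li_hs]. *)
    assert (N : mv F u // lu a B = lu a A // mv G u).
    { destruct (sqeq_pk (eq_trans (eq_trans (pk_v _ _) (li_hs a u)) (eq_sym (pk_v _ _))))
        as (_ & _ & e & _); now symmetry. }
    ich αA (pk (li b A)) (pk (hs α u)) (pk (hs β u)).
    unfold αA; erewrite (vcpl (a := pk (hs α u))); [|bd|sides].
    rewrite (li_hs b u), <- vcpA, <- (li_hs a u), vcpA; f_equal.
    erewrite <- (vcpr (a := pk (hs α u)) (g1 := (α B : @hh E (F B) (G B)))) at 1;
      [|bd|reflexivity].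
    unfold αB.
    ichr (pk (hs α u)) (pk (id_v (mv G u))) (pk (@id_h E (F B) (G B) (α B))) (pk (li b B)).
    f_equal; eapply hcpr; [bd|sides].
Defined.

Definition id_lifted (F : DMap D E) : Lifted (id_hnat F).
Proof.
  unshelve refine (@Build_Lifted D E F F (id_hnat F) (fun A => vid (F A))
    (fun A => fi (id_fold (F A))) (fun A B f => @id_h E (F A) (F B) (m1 F f)) _ _ _).
  - intros A; exact (IsComp_id (F A)).
  - intros A B f.
    change ((pk (@id_h E (F A) (F B) (m1 F f)) <|> pk (@id_h E (F B) (F B) (hid (F B))))
      </> gpk (nd (@id_nat (hor_pre D) (hor_ops E) F) f)
      = pk (@id_h E (F A) (F A) (hid (F A))) <|> pk (@id_h E (F A) (F B) (m1 F f))).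
    assert (En : gpk (nd (@id_nat (hor_pre D) (hor_ops E) F) f)
      = pk (@id_h E (F A) (F B) (m1 F f))) by (etransitivity; [apply gpk_as2|reflexivity]).
    rewrite En.
    rewrite !pk_id_h.
    etransitivity; [eapply vcpr; [bd|cbn; symmetry; apply hcr]|].
    now rewrite hcl, hcr.
  - intros A B u.
    change (pk (@id_h E (F A) (F A) (hid (F A))) </> pk (@id_v E (F A) (F B) (mv F u))
      = pk (@id_v E (F A) (F B) (mv F u)) </> pk (@id_h E (F B) (F B) (hid (F B)))).
    erewrite vcpl; [|bd|sides]; symmetry; eapply vcpr; [bd|sides].
Defined.

Definition pre_lifted {D' : DblOps} {F G : DMap D E} {α : HNat F G} (a : Lifted α)
  (K : DMap D' D) : Lifted (pre_hnat α K) :=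
  @Build_Lifted D' E (comp_dmap F K) (comp_dmap G K) (pre_hnat α K)
    (fun A => lu a (K A)) (fun A => li a (K A)) (fun A B f => ls a (m1 K f))
    (fun A => li_comp a (K A)) (fun A B f => li_nd a (m1 K f))
    (fun A B u => li_hs a (mv K u)).

Definition pair_lifted {E' : DoubleCat} {F G : DMap D E} {F' G' : DMap D E'}
  {α : HNat F G} {β : HNat F' G'} (a : Lifted α) (b : Lifted β) :
  Lifted (pair_hnat α β).
Proof.
  unshelve refine (@Build_Lifted D (prod_dbl E E') (pair_dmap F F') (pair_dmap G G')
    (pair_hnat α β) (fun A => (lu a A, lu b A))
    (fun A => (li a A, li b A)) (fun A B f => (ls a f, ls b f)) _ _ _).
  - intros A; exact (@IsComp_pair E E' (F A, F' A) (G A, G' A) (lf a A) (lf b A)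
      (li_comp a A) (li_comp b A)).
  - intros A B f; rewrite <- !pk_h; unfold gpk; rewrite <- pk_v.
    apply pk_pair; cbn; rewrite pk_v, !pk_h; [exact (li_nd a f)|exact (li_nd b f)].
  - intros A B u; rewrite <- !pk_v; apply pk_pair; cbn; rewrite !pk_v;
      [exact (li_hs a u)|exact (li_hs b u)].
Defined.
End LiftedOperations.

(** The pseudonaturality cell of Tα is T(δ_f) between two compositors. Naturality moves the
    compositors past T of [[Id|ι]] and T of [[ι|α_f]], and the unit laws cancel them against the
    unitors in the image of ι. *)
Definition post_lifted {D E : DblOps} {E' : DoubleCat} (T : DFun E E')
  (HT : is_double_functor T) {F G : DMap D E} {α : HNat F G} (a : Lifted α) :
  Lifted (post_hnat T α).
Proof.
  unshelve refine (@Build_Lifted D E' (comp_dmap T F) (comp_dmap T G) (post_hnat T α)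
    (fun A => fv T (lu a A)) (fun A => fi (map_fold T (lf a A)))
    (fun A B f => fs T (ls a f)) _ _ _).
  - intros A; exact (IsComp_map HT (li_comp a A)).
  - intros A B f.
    set (Fi := pk (@id_h E' (T (F A)) (T (F B)) (m1 T (m1 F f)))).
    change ((Fi <|> pk (fi (map_fold T (lf a B))))
      </> gpk (nd (@post_nat (hor_pre D) (hor_pre E) (hor_ops E') T F G α) f)
      = pk (fi (map_fold T (lf a A))) <|> pk (fs T (ls a f))).
    assert (En : gpk (nd (@post_nat (hor_pre D) (hor_pre E) (hor_ops E') T F G α) f)
      = pk (sph T (m1 F f : @hh E (F A) (F B)) (α B)) </> gpk (f2 T (nd α f))
         </> pk (sphi T (α A) (m1 G f : @hh E (G A) (G B))))
      by (etransitivity; [apply gpk_glue|]; gpks; reflexivity).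
    rewrite En, !pk_map_fold; cbn [fu fh fi lf].
    rewrite <- (Fp_gpk HT); change (pk (nd α f)) with (gpk (nd α f)).
    change (pk (fs T (ls a f))) with (Fp T (pk (ls a f))).
    set (TFi := Fp T (pk (@id_h E (F A) (F B) (m1 F f)))).
    assert (EF : TFi = Fi) by exact (Fp_id_h HT _).
    assert (E1 : Fi <|> (pk (sph0 T (F B)) </> Fp T (pk (li a B)))
      = (Fi <|> pk (sph0 T (F B))) </> (TFi <|> Fp T (pk (li a B)))).
    { rewrite EF.
      ich Fi (pk (sph0 T (F B))) Fi (Fp T (pk (li a B))).
      f_equal; symmetry; eapply vcpl; [bd|sides]. }
    rewrite E1, !vcpA, <- (vcpA (TFi <|> _)); unfold TFi.
    erewrite (Fp_h HT); [|bd|bd|sides].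
    rewrite !vcpA, <- (vcpA (Fi <|> _)); unfold Fi; rewrite (sph_unitr HT).
    assert (E2 : Fp T (pk (@id_h E (F A) (F B) (m1 F f)) <|> pk (li a B))
        </> (Fp T (gpk (nd α f)) </> pk (sphi T (α A) (m1 G f : @hh E (G A) (G B))))
      = Fp T (pk (li a A) <|> pk (ls a f)) </> pk (sphi T (α A) (m1 G f : @hh E (G A) (G B)))).
    { rewrite <- vcpA; erewrite <- (Fp_v HT); [|bd|bd|sides]; now rewrite li_nd. }
    rewrite E2; clear E1 E2.
    set (lsT := Fp T (pk (ls a f))).
    assert (E3 : (pk (sph0 T (F A)) </> Fp T (pk (li a A))) <|> lsT
      = (pk (sph0 T (F A)) <|> Fi) </> (Fp T (pk (li a A)) <|> lsT)).
    { unfold Fi, lsT.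
      ich (pk (sph0 T (F A))) (pk (@id_h E' (T (F A)) (T (F B)) (m1 T (m1 F f)))) (Fp T (pk (li a A))) (Fp T (pk (ls a f))).
      f_equal; symmetry; eapply vcpl; [bd|sides]. }
    rewrite E3; unfold lsT.
    assert (E4 : Fp T (pk (li a A)) <|> Fp T (pk (ls a f))
      = (pk (sph T (hid (F A)) (m1 F f : @hh E (F A) (F B))) </> Fp T (pk (li a A) <|> pk (ls a f)))
         </> pk (sphi T (α A) (m1 G f : @hh E (G A) (G B)))).
    { erewrite <- (Fp_h HT (a := pk (li a A))); [|bd|bd|sides].
      rewrite vcpA, (sph_sphi HT); symmetry; eapply vcpr; [bd|sides]. }
    rewrite E4, <- !vcpA; unfold Fi; rewrite (sph_unitl HT); reflexivity.
  - intros A B u.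
    change (pk (fi (map_fold T (lf a A))) </> Fp T (pk (hs α u))
      = pk (id_v (fv T (mv F u))) </> pk (fi (map_fold T (lf a B)))).
    rewrite !pk_map_fold; cbn [fu fh fi lf].
    rewrite vcpA; erewrite <- (Fp_v HT); [|bd|bd|reflexivity].
    rewrite li_hs; erewrite (Fp_v HT); [|bd|bd|sides].
    rewrite <- !vcpA; f_equal; symmetry; exact (Fp_id_v HT (mv F u)).
Defined.

Section Modifications.
Context {D : DblOps} {E : DoubleCat} {F G : DMap D E}.

(** After ι is cancelled, canonicity replaces ι followed by γ with the ι of β. Compatibility with
    1v-cells then holds by [li_hs], and compatibility with 1h-cells becomes the assumed equality of
    the squares [ls]. *)
Lemma lifted_modification (α β : HNat F G) (a : Lifted α) (b : Lifted β) (γ : Cells α β) :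
  (forall (A B : D) (f : hh A B), pk (ls a f) = pk (ls b f)) ->
  (forall A : D, @Can E (F A) (G A) (lf a A) (lf b A) (γ A)) ->
  is_invertible_hmod γ.
Proof.
  intros Hs Hc.
  assert (Hu : forall A : D, lu a A = lu b A).
  { intros A; assert (H := Hc A); unfold Can in H; rewrite <- pk_v in H.
    destruct (sqeq_pk H) as (_ & _ & e & _); cbn in e; now rewrite vcr in e. }
  assert (Hc' : forall A : D, pk (li a A) </> gpk (γ A) = pk (li b A)) by exact Hc.
  assert (N : forall (A B : D) (u : vv A B), mv F u // lu a B = lu a A // mv G u).
  { intros A B u.
    destruct (sqeq_pk (eq_trans (eq_trans (pk_v _ _) (li_hs a u)) (eq_sym (pk_v _ _))))
        as (_ & _ & e & _); now symmetry. }
  split; [split|].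
  - intros A B f; apply gpk_eq2; gpks.
    set (Fi := pk (@id_h E (F A) (F B) (m1 F f))).
    set (Gi := pk (@id_h E (G A) (G B) (m1 G f))).
    change ((Fi <|> gpk (γ B)) </> gpk (nd β f) = gpk (nd α f) </> (gpk (γ A) <|> Gi)).
    eapply (cancel (P := lf a B) (f := (m1 F f : @hh E (F A) (F B)))
      (w := vid (F A)) (w1 := vid (F A)) (z := vid (G B)));
      [exact (li_comp a B)|bde|bde|].
    cbn [fu fh fi lf]; rewrite <- !vcpA, (li_nd a f).
    change (pk (@id_h E (F A) (F B) (m1 F f))) with Fi.
    ich Fi (pk (li a B)) Fi (gpk (γ B)).
    rewrite Hc'; unfold Fi; erewrite vcpl; [|bd|sides]; rewrite (li_nd b f).
    ich (pk (li a A)) (pk (ls a f)) (gpk (γ A)) Gi.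
    rewrite Hc', Hs; f_equal; symmetry; eapply vcpr; [bd|sides].
  - intros A B u; apply sqeq_pk; rewrite !pk_v.
    change (gpk (γ A) </> pk (hs β u) = pk (hs α u) </> gpk (γ B)).
    eapply (cancel1 (P := lf a A) (w := mv F u) (w1 := mv F u) (z := mv G u));
      [exact (li_comp a A)|bde|bde|].
    cbn [fu fh fi lf]; rewrite <- !vcpA, Hc', (li_hs a u), (li_hs b u), vcpA, Hc'.
    reflexivity.
  - intros A; eapply (Can_invertible (P := lf a A) (Q := lf b A));
      [exact (li_comp a A)|exact (li_comp b A)|exact (Hu A)|exact (Hc A)].
Qed.
End Modifications.

Lemma globular_comp (D E F : DblOps) (H : DFun E F) (G : DFun D E) :
  globular_action H -> globular_action G -> globular_action (comp_dfun H G).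
Proof.
  intros hH hG A B f g s.
  change (Fp (comp_dfun H G) (pk s)) with (Fp H (Fp G (pk s))); rewrite hG; apply hH.
Qed.

Lemma globular_pair (D E F : DblOps) (G : DFun D E) (H : DFun D F) :
  globular_action G -> globular_action H -> globular_action (pair_dfun G H).
Proof. intros hG hH A B f g s; exact (pk_pair (hG A B f g s) (hH A B f g s)). Qed.

(** * Coherence in locally thin 2-categories *)

Section Thin.
Context {K : TwoOps} (thin : forall (A B : K) (f g : hom A B) (s t : f ⇒ g), s = t).

(** Leaves only the equality of the boundaries, which [solve_strict] proves by reassociating
    composites and removing units. *)
Lemma thin_eq2 (A B : K) (f g f1 g1 : hom A B) (s : f ⇒ g) (s1 : f1 ⇒ g1) :
  Strict f f1 -> Strict g g1 -> s ≈ s1.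
Proof. intros e e'; exists e, e'; apply thin. Qed.

Lemma thin_monoidal (M : MonData K) : monoidal_axioms M.
Proof.
  split; red; intros; apply thin_eq2; solve_strict.
Qed.

Lemma thin_pseudomonad (T : MonadData K) : pseudomonad_axioms T.
Proof. split; intros; apply thin_eq2; solve_strict. Qed.

Lemma thin_left_strength (M : MonData K) (T : MonadData K) (S : LStrData M T) :
  left_strength_axioms S.
Proof. split; intros; apply thin_eq2; solve_strict. Qed.

Lemma thin_right_strength (M : MonData K) (T : MonadData K) (S : RStrData M T) :
  right_strength_axioms S.
Proof. split; intros; apply thin_eq2; solve_strict. Qed.
End Thin.

(** * The 2-category of companions and canonical cells *)

Record CFold (D : DblOps) (A B : D) : Type := MkCFold {
  cf :> Fold A B;
  cf_comp : IsComp cf }.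

Record CCell (D : DblOps) (A B : D) (P Q : CFold A B) : Type := MkCCell {
  cc : sq (fh P) (vid A) (vid B) (fh Q);
  cc_can : @Can D A B P Q cc }.

Lemma cfold_ext (D : DblOps) (A B : D) (P Q : CFold A B) : cf P = cf Q -> P = Q.
Proof.
  destruct P as [P p], Q as [Q q]; cbn; intros e; destruct e.
  now rewrite (proof_irrelevance _ p q).
Qed.

Section CanonicalTwoCategory.
Variable D : DoubleCat.

Definition id_cf (A : D) : CFold A A := MkCFold (IsComp_id A).
Definition comp_cf (A B C : D) (P : CFold A B) (Q : CFold B C) : CFold A C :=
  MkCFold (IsComp_comp (cf_comp P) (cf_comp Q)).

Definition can_pre : PreTwo := {|
  ob := D;
  hom A B := CFold A B;
  two A B P Q := CCell P Q;
  i1 A := id_cf A;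
  c1 A B C P Q := comp_cf P Q |}.

Definition can_ops : TwoOps.
Proof.
  refine {|
    pre2 := can_pre;
    i2 A B f := @MkCCell D A B f f _ (Can_i2 (cf f));
    v2 A B f g h s t := @MkCCell D A B f h _ (Can_v2 (cc_can s) (cc_can t));
    h2 A B C f f' g g' s t :=
      @MkCCell D A C (comp_cf f g) (comp_cf f' g') _ (Can_h2 (cc_can s) (cc_can t)) |}.
  - intros; apply cfold_ext, comp_foldA.
  - intros; apply cfold_ext, comp_foldl.
  - intros; apply cfold_ext, comp_foldr.
Defined.

Lemma can_thin (A B : can_ops) (f g : hom A B) (s t : f ⇒ g) : s = t.
Proof.
  destruct s as [s hs], t as [t ht].
  assert (e : s = t) by exact (Can_unique (cf_comp f) hs ht).
  destruct e; now rewrite (proof_irrelevance _ hs ht).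
Qed.
End CanonicalTwoCategory.

(** * Restriction of functors, tensor and unit to canonical cells *)

Section CanonicalFunctor.
Context {D E : DoubleCat} (F : DFun D E) (HF : is_double_functor F).

Definition map_cf (A B : D) (P : CFold A B) : @CFold E (F A) (F B) :=
  @MkCFold E (F A) (F B) (map_fold F P) (IsComp_map HF (cf_comp P)).

Definition can_fun : PsFun (can_ops D) (can_ops E) :=
  @Build_PsFun (can_pre D) (can_pre E)
    (@Build_Map (can_pre D) (can_pre E) (fun A => F A) map_cf)
    (fun A B P Q s =>
       @MkCCell E (F A) (F B) (map_cf P) (map_cf Q) (f2 F (cc s)) (Can_f2 HF (cc_can s)))
    (fun A B C P Q =>
       @MkCCell E (F A) (F C) (comp_cf (map_cf P) (map_cf Q)) (map_cf (comp_cf P Q))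
         (ph F (fh P) (fh Q)) (Can_ph HF P Q))
    (fun A B C P Q =>
       @MkCCell E (F A) (F C) (map_cf (comp_cf P Q)) (comp_cf (map_cf P) (map_cf Q))
         (phi F (fh P) (fh Q)) (Can_phi HF P Q))
    (fun A => @MkCCell E (F A) (F A) (id_cf (F A)) (map_cf (id_cf A)) (ph0 F A) (Can_ph0 HF A))
    (fun A => @MkCCell E (F A) (F A) (map_cf (id_cf A)) (id_cf (F A)) (ph0i F A)
       (Can_ph0i HF A)).
End CanonicalFunctor.

Section CanonicalTensor.
Context {D : DoubleCat} (F : DFun (prod_dbl D D) D) (HF : is_double_functor F).

Definition ten_cf {A B : prod_dbl D D} (P : CFold (fst A) (fst B)) (Q : CFold (snd A) (snd B)) :
  @CFold D (F A) (F B) :=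
  @MkCFold D (F A) (F B) (map_fold F (pair_fold P Q))
    (IsComp_map HF (IsComp_pair (cf_comp P) (cf_comp Q))).

Lemma comp_fold_pair (A B C : prod_dbl D D) (P : Fold (fst A) (fst B)) (P' : Fold (fst B) (fst C))
  (Q : Fold (snd A) (snd B)) (Q' : Fold (snd B) (snd C)) :
  comp_fold (pair_fold P Q) (pair_fold P' Q')
  = @pair_fold D D A C (comp_fold P P') (comp_fold Q Q').
Proof.
  destruct A as [A A'], B as [B B'], C as [C C'].
  change (Fold A B) in P; change (Fold B C) in P'; change (Fold A' B') in Q;
    change (Fold B' C') in Q'.
  apply fold_ext; rewrite pk_comp_fold.
  rewrite <- pk_h.
  etransitivity; [|apply (pk_pair (s := fi P /// sqcast (hcr (fh P)) eq_refl eq_refl eq_refl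
    ⟦ id_h (fh P) | fi P' ⟧) (s1 := fi Q /// sqcast (hcr (fh Q)) eq_refl eq_refl eq_refl
    ⟦ id_h (fh Q) | fi Q' ⟧) (t := fi (comp_fold P P')) (t1 := fi (comp_fold Q Q')));
    rewrite pk_comp_fold, pk_v, pk_cast, pk_h; reflexivity].
  symmetry; etransitivity; [apply (pk_v (D := prod_dbl D D)
    (fi (@pair_fold D D (A, A') (B, B') P Q))
    ((sqcast (hcr (fh P)) eq_refl eq_refl eq_refl ⟦ id_h (fh P) | fi P' ⟧,
      sqcast (hcr (fh Q)) eq_refl eq_refl eq_refl ⟦ id_h (fh Q) | fi Q' ⟧)
      : @sq (prod_dbl D D) (A, A') (B, B') (A, A') (C, C') (fh P, fh Q) (vid A, vid A')
          (fu P', fu Q') (hc (fh P) (fh P'), hc (fh Q) (fh Q'))))|].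
  f_equal; apply pk_pair; rewrite pk_cast; reflexivity.
Qed.

Lemma Can_pair (A B : prod_dbl D D) (P P' : Fold (fst A) (fst B)) (Q Q' : Fold (snd A) (snd B))
  (s : sq (fh P) (vid _) (vid _) (fh P')) (t : sq (fh Q) (vid _) (vid _) (fh Q')) :
  Can s -> Can t -> @Can (prod_dbl D D) A B (pair_fold P Q) (pair_fold P' Q') (s, t).
Proof.
  destruct A as [A A'], B as [B B'].
  unfold Can; intros H H'; rewrite <- pk_v; apply pk_pair; cbn; rewrite pk_v; assumption.
Qed.

(** A 1-cell of the source is a pair of folds, whereas F acts on folds of pairs. Composition
    respects this passage only up to the proven equality [comp_fold_pair], which therefore enters
    the proofs for the compositors. *)
Definition can_ten : PsFun (prod_pre (can_ops D) (can_ops D)) (can_ops D).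
Proof.
  set (K := prod_pre (can_pre D) (can_pre D)).
  set (h := fun (A B : K) (P : hom A B) =>
    (fh (fst P), fh (snd P)) : @hh (prod_dbl D D) A B).
  set (φ := fun (A B : K) (P : hom A B) => @ten_cf A B (fst P) (snd P)).
  unshelve refine (@Build_PsFun K (can_pre D) (@Build_Map K (can_pre D) (fun A => F A) φ)
    (fun A B P Q s => @MkCCell D (F A) (F B) (φ A B P) (φ A B Q)
       (@f2 _ _ F A B (h A B P) (h A B Q) (cc (fst s), cc (snd s))) _)
    (fun A B C P Q => @MkCCell D (F A) (F C) (comp_cf (φ A B P) (φ B C Q)) (φ A C (P · Q))
       (@ph _ _ F A B C (h A B P) (h B C Q)) _)
    (fun A B C P Q => @MkCCell D (F A) (F C) (φ A C (P · Q)) (comp_cf (φ A B P) (φ B C Q))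
       (@phi _ _ F A B C (h A B P) (h B C Q)) _)
    (fun A => @MkCCell D (F A) (F A) (id_cf (F A)) (φ A A (i1 A)) (ph0 F A) _)
    (fun A => @MkCCell D (F A) (F A) (φ A A (i1 A)) (id_cf (F A)) (ph0i F A) _));
    unfold h, φ.
  - exact (Can_f2 HF (P := pair_fold (fst P) (snd P)) (Q := pair_fold (fst Q) (snd Q))
      (Can_pair (A := A) (B := B) (cc_can (fst s)) (cc_can (snd s)))).
  - exact (eq_trans (Can_ph HF (@pair_fold D D A B (fst P) (snd P)) (@pair_fold D D B C (fst Q) (snd Q)))
      (f_equal (fun R => pk (fi (map_fold F R)))
         (@comp_fold_pair A B C (fst P) (fst Q) (snd P) (snd Q)))).
  - exact (eq_trans (f_equal (fun R => pk (fi (map_fold F R)) </> _)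
         (eq_sym (@comp_fold_pair A B C (fst P) (fst Q) (snd P) (snd Q))))
      (Can_phi HF (@pair_fold D D A B (fst P) (snd P)) (@pair_fold D D B C (fst Q) (snd Q)))).
  - exact (Can_ph0 HF A).
  - exact (Can_ph0i HF A).
Defined.
End CanonicalTensor.

Section CanonicalUnit.
Context {D : DoubleCat} (F : DFun one_dbl D) (HF : is_double_functor F).

Definition one_fold (A B : one_dbl) : Fold A B := @MkFold one_dbl A B tt tt tt.

Lemma one_fold_eq (A B : one_dbl) (P Q : Fold A B) : P = Q.
Proof. destruct P as [[] [] []], Q as [[] [] []]; reflexivity. Qed.

Lemma IsComp_one (A B : one_dbl) : IsComp (one_fold A B).
Proof.
  exists (tt : @sq one_dbl A B B B tt tt tt tt).
  unfold is_companion; rewrite <- pk_h, <- pk_v; destruct A, B; split; reflexivity.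
Qed.

Lemma Can_one (A B : one_dbl) (P Q : Fold A B) (s : sq (fh P) (vid A) (vid B) (fh Q)) : Can s.
Proof.
  destruct A, B, P as [[] [] []], Q as [[] [] []], s; unfold Can; now rewrite <- pk_v.
Qed.

Definition unt_cf (A B : one_dbl) : @CFold D (F A) (F B) :=
  @MkCFold D (F A) (F B) (map_fold F (one_fold A B)) (IsComp_map HF (IsComp_one A B)).

Definition can_unt : PsFun one_pre (can_ops D).
Proof.
  unshelve refine (@Build_PsFun one_pre (can_pre D)
    (@Build_Map one_pre (can_pre D) (fun A => F A) (fun A B _ => unt_cf A B))
    (fun A B P Q s => @MkCCell D (F A) (F B) (unt_cf A B) (unt_cf A B)
       (@f2 _ _ F A B tt tt tt) _)
    (fun A B C P Q => @MkCCell D (F A) (F C) (comp_cf (unt_cf A B) (unt_cf B C)) (unt_cf A C)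
       (@ph _ _ F A B C tt tt) _)
    (fun A B C P Q => @MkCCell D (F A) (F C) (unt_cf A C) (comp_cf (unt_cf A B) (unt_cf B C))
       (@phi _ _ F A B C tt tt) _)
    (fun A => @MkCCell D (F A) (F A) (id_cf (F A)) (unt_cf A A) (ph0 F A) _)
    (fun A => @MkCCell D (F A) (F A) (unt_cf A A) (id_cf (F A)) (ph0i F A) _)).
  - exact (Can_f2 HF (P := one_fold A B) (Q := one_fold A B)
      (@Can_one A B (one_fold A B) (one_fold A B) tt)).
  - exact (eq_trans (Can_ph HF (one_fold A B) (one_fold B C))
      (f_equal (fun R => pk (fi (map_fold F R))) (one_fold_eq _ (one_fold A C)))).
  - exact (eq_trans (f_equal (fun R => pk (fi (map_fold F R)) </> _)
      (one_fold_eq (one_fold A C) _)) (Can_phi HF (one_fold A B) (one_fold B C))).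
  - exact (eq_trans (Can_ph0 HF A)
      (f_equal (fun R => pk (fi (map_fold F R))) (one_fold_eq _ (one_fold A A)))).
  - exact (eq_trans (f_equal (fun R => pk (fi (map_fold F R)) </> _)
      (one_fold_eq (one_fold A A) _)) (Can_ph0i HF A)).
Defined.
End CanonicalUnit.

(** * Images of folds under composite functors and projections *)

Section MapFold.
Context {D : DoubleCat} (ten : DFun (prod_dbl D D) D) (Hten : is_double_functor ten).

Lemma map_fold_ten (X : DblOps) (F G : DFun X D) (A B : X) (P : Fold A B) :
  map_fold (ten_dfun ten F G) P
  = map_fold ten (@pair_fold D D (F A, G A) (F B, G B) (map_fold F P) (map_fold G P)).
Proof.
  etransitivity; [exact (map_fold_comp (pair_dfun F G) P Hten)|].
  exact (f_equal (fun R => map_fold ten R) (map_fold_pair F G P)).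
Qed.

(** Serves the identity functor and the projections, whose unitors are identities. *)
Lemma map_fold_strict (X : DblOps) (F : DFun X D) (A B : X) (P : Fold A B)
  (Q : @Fold D (F A) (F B)) :
  pk (sph0 F A) = pk (@id_h D (F A) (F A) (hid (F A))) -> Fp F (pk (fi P)) = pk (fi Q) ->
  map_fold F P = Q.
Proof.
  intros H H'; apply fold_ext; rewrite pk_map_fold, H, H'.
  eapply vcpl; [bd|sides].
Qed.

Lemma map_fold_id (A B : D) (P : Fold A B) : map_fold (id_dfun D) P = P.
Proof. apply (@map_fold_strict D (id_dfun D) A B P P); reflexivity. Qed.

Lemma map_fold_1_2 (A B : prod_dbl D D) (P : Fold (fst A) (fst B)) (Q : Fold (snd A) (snd B)) :
  map_fold D1_2 (pair_fold P Q) = P.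
Proof. apply (@map_fold_strict _ D1_2 A B (pair_fold P Q) P); reflexivity. Qed.

Lemma map_fold_2_2 (A B : prod_dbl D D) (P : Fold (fst A) (fst B)) (Q : Fold (snd A) (snd B)) :
  map_fold D2_2 (pair_fold P Q) = Q.
Proof. apply (@map_fold_strict _ D2_2 A B (pair_fold P Q) Q); reflexivity. Qed.

Section Triples.
Context {A B : prod_dbl (prod_dbl D D) D} (P : Fold (fst (fst A)) (fst (fst B)))
  (Q : Fold (snd (fst A)) (snd (fst B))) (R : Fold (snd A) (snd B)).

Definition triple_fold : Fold A B :=
  @pair_fold (prod_dbl D D) D A B (@pair_fold D D (fst A) (fst B) P Q) R.

Lemma map_fold_1_3 : map_fold D1_3 triple_fold = P.
Proof.
  apply (@map_fold_strict _ D1_3 A B triple_fold P); [|reflexivity].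
  etransitivity; [exact (gpk_v2 _ _)|].
  eapply (vcpl (D := D)); [exact (Bd_pk _)|reflexivity].
Qed.

Lemma map_fold_2_3 : map_fold D2_3 triple_fold = Q.
Proof.
  apply (@map_fold_strict _ D2_3 A B triple_fold Q); [|reflexivity].
  etransitivity; [exact (gpk_v2 _ _)|].
  eapply (vcpl (D := D)); [exact (Bd_pk _)|reflexivity].
Qed.

Lemma map_fold_3_3 : map_fold D3_3 triple_fold = R.
Proof. apply (@map_fold_strict _ D3_3 A B triple_fold R); reflexivity. Qed.
End Triples.
End MapFold.

Section CanonicalLift.
Context {D : DblOps} {E : DoubleCat} {F G : DFun D E} (α : VNat F G)
  (inv : VInvertible α) (κ : Liftable α).

Definition lift_cf (A : D) : @CFold E (F A) (G A) :=
  MkCFold (IsComp_of_comp (κ A)).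

Context {A B : D} (P : Fold A B) (P' : @CFold E (F A) (F B)) (Q' : @CFold E (G A) (G B))
  (eP : map_fold F P = P') (eQ : map_fold G P = Q').

(** The 2-categorical composite maps send P to folds P', Q' that equal the images under the
    composite double functors only by proof. The statement uses [pk] rather than [Can] because the
    1h-cells of P' and of the image of P are convertible only at the instances used later. *)
Lemma Can_nd_at :
  pk (fi (comp_cf P' (lift_cf B))) </> pk (lift_δ κ (fh P)) = pk (fi (comp_cf (lift_cf A) Q')).
Proof.
  cbn [cf comp_cf lift_cf]; rewrite <- eP, <- eQ; exact (Can_nd κ P).
Qed.

Lemma Can_ndi_at :
  pk (fi (comp_cf (lift_cf A) Q')) </> pk (lift_δinv inv κ (fh P))
  = pk (fi (comp_cf P' (lift_cf B))).
Proof.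
  cbn [cf comp_cf lift_cf]; rewrite <- eP, <- eQ; exact (Can_ndi inv κ P).
Qed.
End CanonicalLift.

Ltac companions := first
  [ apply companion_laws
  | apply companion_id
  | apply companion_comp; companions
  | apply companion_map; [apply pdf_laws | companions]
  | apply companion_pair; companions ].

(** The [refine] rests on conversion: the folds at the two ends of a structure cell compute to those
    of the companions from which the lifted cell was built. *)
Ltac lifted_id :=
  cbv beta iota;
  lazymatch goal with
  | |- @Can ?D ?A ?B _ _ (@lift_id _ _ _ ?u ?v ?e ?κ ?κ') =>
      refine (@Can_lift_id D A B u v e κ κ' _); companions
  end.

(** * Monoidal structure, monad and strengths on companions and canonical cells *)

Section CanonicalMonoidal.
Context {D : DoubleCat} (M : MonoidalDoubleCat D)
  (κa : Liftable (mass M)) (κl : Liftable (mlun M)) (κr : Liftable (mrun M)).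

Local Notation X := (can_ops D).
Local Notation tenX := (can_ten (pdf_laws (mten M))).
Local Notation untX := (can_unt (pdf_laws (munt M))).
Local Notation Hten := (pdf_laws (mten M)).
Local Notation Hunt := (pdf_laws (munt M)).

Lemma ass_src_fold (A B : prod_pre (prod_pre X X) X) (f : hom A B) :
  map_fold (ten_dfun (mten M) (ten_dfun (mten M) D1_3 D2_3) D3_3)
    (triple_fold (A := A) (B := B) (fst (fst f)) (snd (fst f)) (snd f))
  = cf (m1 (ten_map tenX (ten_map tenX v1_3 v2_3) v3_3) f).
Proof.
  rewrite (map_fold_ten Hten), (map_fold_ten Hten), map_fold_1_3, map_fold_2_3, map_fold_3_3.
  reflexivity.
Qed.

Lemma ass_tgt_fold (A B : prod_pre (prod_pre X X) X) (f : hom A B) :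
  map_fold (ten_dfun (mten M) D1_3 (ten_dfun (mten M) D2_3 D3_3))
    (triple_fold (A := A) (B := B) (fst (fst f)) (snd (fst f)) (snd f))
  = cf (m1 (ten_map tenX v1_3 (ten_map tenX v2_3 v3_3)) f).
Proof.
  rewrite (map_fold_ten Hten), (map_fold_ten Hten), map_fold_1_3, map_fold_2_3, map_fold_3_3.
  reflexivity.
Qed.

Definition can_ass : PsNat (ten_map tenX (ten_map tenX v1_3 v2_3) v3_3)
    (ten_map tenX v1_3 (ten_map tenX v2_3 v3_3)) :=
  @Build_PsNat (prod_pre (prod_pre X X) X) X (ten_map tenX (ten_map tenX v1_3 v2_3) v3_3)
    (ten_map tenX v1_3 (ten_map tenX v2_3 v3_3))
    (fun A => lift_cf κa A)
    (fun A B f =>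
       @MkCCell D _ _
         (comp_cf (m1 (ten_map tenX (ten_map tenX v1_3 v2_3) v3_3) f) (lift_cf κa B))
         (comp_cf (lift_cf κa A) (m1 (ten_map tenX v1_3 (ten_map tenX v2_3 v3_3)) f))
         _ (Can_nd_at κa (ass_src_fold f) (ass_tgt_fold f)))
    (fun A B f =>
       @MkCCell D _ _
         (comp_cf (lift_cf κa A) (m1 (ten_map tenX v1_3 (ten_map tenX v2_3 v3_3)) f))
         (comp_cf (m1 (ten_map tenX (ten_map tenX v1_3 v2_3) v3_3) f) (lift_cf κa B))
         _ (Can_ndi_at (mass_inv M) κa (ass_src_fold f) (ass_tgt_fold f))).

Lemma unt_fold_eq (A B : D) (P : CFold A B) :
  map_fold (unt_dfun (munt M) D) P = cf (m1 (unt_map untX X) P).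
Proof.
  etransitivity; [exact (map_fold_comp (one_dfun D) P Hunt)|].
  exact (f_equal (fun R => map_fold (munt M) R) (one_fold_eq _ _)).
Qed.

Lemma lun_src_fold (A B : X) (f : hom A B) :
  map_fold (ten_dfun (mten M) (unt_dfun (munt M) D) (id_dfun D)) (cf f)
  = cf (m1 (ten_map tenX (unt_map untX X) (id_map X)) f).
Proof. now rewrite (map_fold_ten Hten), unt_fold_eq, map_fold_id. Qed.

Lemma run_src_fold (A B : X) (f : hom A B) :
  map_fold (ten_dfun (mten M) (id_dfun D) (unt_dfun (munt M) D)) (cf f)
  = cf (m1 (ten_map tenX (id_map X) (unt_map untX X)) f).
Proof. now rewrite (map_fold_ten Hten), unt_fold_eq, map_fold_id. Qed.

Definition can_lun : PsNat (ten_map tenX (unt_map untX X) (id_map X)) (id_map X) :=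
  @Build_PsNat X X (ten_map tenX (unt_map untX X) (id_map X)) (id_map X)
    (fun A => lift_cf κl A)
    (fun A B f =>
       @MkCCell D _ _
         (comp_cf (m1 (ten_map tenX (unt_map untX X) (id_map X)) f) (lift_cf κl B))
         (comp_cf (lift_cf κl A) f)
         _ (Can_nd_at κl (lun_src_fold f) (map_fold_id f)))
    (fun A B f =>
       @MkCCell D _ _
         (comp_cf (lift_cf κl A) f)
         (comp_cf (m1 (ten_map tenX (unt_map untX X) (id_map X)) f) (lift_cf κl B))
         _ (Can_ndi_at (mlun_inv M) κl (lun_src_fold f) (map_fold_id f))).

Definition can_run : PsNat (ten_map tenX (id_map X) (unt_map untX X)) (id_map X) :=
  @Build_PsNat X X (ten_map tenX (id_map X) (unt_map untX X)) (id_map X)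
    (fun A => lift_cf κr A)
    (fun A B f =>
       @MkCCell D _ _
         (comp_cf (m1 (ten_map tenX (id_map X) (unt_map untX X)) f) (lift_cf κr B))
         (comp_cf (lift_cf κr A) f)
         _ (Can_nd_at κr (run_src_fold f) (map_fold_id f)))
    (fun A B f =>
       @MkCCell D _ _
         (comp_cf (lift_cf κr A) f)
         (comp_cf (m1 (ten_map tenX (id_map X) (unt_map untX X)) f) (lift_cf κr B))
         _ (Can_ndi_at (mrun_inv M) κr (run_src_fold f) (map_fold_id f))).

Definition can_mon_core : MonCore X := @Build_MonCore X tenX untX can_ass can_lun can_run.

Definition can_pent : Cells (pent_src can_mon_core) (pent_tgt can_mon_core).
Proof.
  intros (((A, B), C), E).
  refine (@MkCCell D _ _ (pent_src can_mon_core (A, B, C, E)) (pent_tgt can_mon_core (A, B, C, E))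
    (lift_pent κa κl κr (A, B, C, E)) _).
  unfold lift_pent; lifted_id.
Defined.

Definition can_mid : Cells (mid_src can_mon_core) (mid_tgt can_mon_core).
Proof.
  intros (A, B).
  refine (@MkCCell D _ _ (mid_src can_mon_core (A, B)) (mid_tgt can_mon_core (A, B))
    (lift_mid κa κl κr (A, B)) _).
  unfold lift_mid; lifted_id.
Defined.

Definition can_lft : Cells (left_src can_mon_core) (left_tgt can_mon_core).
Proof.
  intros (A, B).
  refine (@MkCCell D _ _ (left_src can_mon_core (A, B)) (left_tgt can_mon_core (A, B))
    (lift_lft κa κl κr (A, B)) _).
  unfold lift_lft; lifted_id.
Defined.

Definition can_rgt : Cells (right_src can_mon_core) (right_tgt can_mon_core).
Proof.
  intros (A, B).
  refine (@MkCCell D _ _ (right_src can_mon_core (A, B)) (right_tgt can_mon_core (A, B))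
    (lift_rgt κa κl κr (A, B)) _).
  unfold lift_rgt; lifted_id.
Defined.

Definition can_mon : MonData X :=
  @Build_MonData X can_mon_core can_pent can_mid can_lft can_rgt.
End CanonicalMonoidal.

Section CanonicalMonad.
Context {D : DoubleCat} (T : VerticalDoubleMonad D)
  (iμ : VInvertible (vmu T)) (iη : VInvertible (veta T))
  (κμ : Liftable (vmu T)) (κη : Liftable (veta T)).

Local Notation X := (can_ops D).
Local Notation HT := (pdf_laws (vT T)).
Local Notation TX := (can_fun (pdf_laws (vT T))).

Definition can_mu : PsNat (comp_map TX TX) TX :=
  @Build_PsNat X X (comp_map TX TX) TX
    (fun A => lift_cf κμ A)
    (fun A B f =>
       @MkCCell D _ _ (comp_cf (m1 (comp_map TX TX) f) (lift_cf κμ B))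
         (comp_cf (lift_cf κμ A) (m1 TX f))
         _ (Can_nd_at κμ (P := cf f) (P' := m1 (comp_map TX TX) f) (Q' := m1 TX f)
              (map_fold_comp (vT T) f HT) eq_refl))
    (fun A B f =>
       @MkCCell D _ _ (comp_cf (lift_cf κμ A) (m1 TX f))
         (comp_cf (m1 (comp_map TX TX) f) (lift_cf κμ B))
         _ (Can_ndi_at iμ κμ (P := cf f) (P' := m1 (comp_map TX TX) f) (Q' := m1 TX f)
              (map_fold_comp (vT T) f HT) eq_refl)).

Definition can_eta : PsNat (id_map X) TX :=
  @Build_PsNat X X (id_map X) TX
    (fun A => lift_cf κη A)
    (fun A B f =>
       @MkCCell D _ _ (comp_cf f (lift_cf κη B)) (comp_cf (lift_cf κη A) (m1 TX f))
         _ (Can_nd_at κη (P := cf f) (P' := f) (Q' := m1 TX f) (map_fold_id f) eq_refl))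
    (fun A B f =>
       @MkCCell D _ _ (comp_cf (lift_cf κη A) (m1 TX f)) (comp_cf f (lift_cf κη B))
         _ (Can_ndi_at iη κη (P := cf f) (P' := f) (Q' := m1 TX f) (map_fold_id f) eq_refl)).

Definition can_monad_core : MonadCore X := @Build_MonadCore X TX can_mu can_eta.

Definition can_a : Cells (massoc_src can_monad_core) (massoc_tgt can_monad_core).
Proof.
  intros A.
  refine (@MkCCell D _ _ (massoc_src can_monad_core A) (massoc_tgt can_monad_core A)
    (lift_a iμ iη κμ κη A) _).
  unfold lift_a; lifted_id.
Defined.

Definition can_r : Cells (mright_src can_monad_core) (munit_tgt can_monad_core).
Proof.
  intros A.
  refine (@MkCCell D _ _ (mright_src can_monad_core A) (munit_tgt can_monad_core A)
    (lift_r iμ iη κμ κη A) _).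
  unfold lift_r; lifted_id.
Defined.

Definition can_l : Cells (mleft_src can_monad_core) (munit_tgt can_monad_core).
Proof.
  intros A.
  refine (@MkCCell D _ _ (mleft_src can_monad_core A) (munit_tgt can_monad_core A)
    (lift_l iμ iη κμ κη A) _).
  unfold lift_l; lifted_id.
Defined.

Definition can_monad : MonadData X := @Build_MonadData X can_monad_core can_a can_r can_l.
End CanonicalMonad.

Section CanonicalStrength.
Context {D : DoubleCat} (M : MonoidalDoubleCat D) (T : VerticalDoubleMonad D)
  (κa : Liftable (mass M)) (κl : Liftable (mlun M)) (κr : Liftable (mrun M))
  (iμ : VInvertible (vmu T)) (iη : VInvertible (veta T))
  (κμ : Liftable (vmu T)) (κη : Liftable (veta T)).

Local Notation X := (can_ops D).
Local Notation TX := (can_fun (pdf_laws (vT T))).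
Local Notation tenX := (can_ten (pdf_laws (mten M))).
Local Notation MX := (can_mon κa κl κr).
Local Notation MT := (can_monad iμ iη κμ κη).
Local Notation HT := (pdf_laws (vT T)).
Local Notation Hten := (pdf_laws (mten M)).

Local Notation Lsrc := (ten_map tenX v1_2 (comp_map TX v2_2)).
Local Notation Rsrc := (ten_map tenX (comp_map TX v1_2) v2_2).
Local Notation Ltgt := (comp_map TX (ten_map tenX v1_2 v2_2)).

Lemma str_tgt_fold (A B : prod_pre X X) (f : hom A B) :
  map_fold (comp_dfun (vT T) (ten_dfun (mten M) D1_2 D2_2))
    (@pair_fold D D A B (fst f) (snd f)) = cf (m1 Ltgt f).
Proof.
  etransitivity; [exact (map_fold_comp (ten_dfun (mten M) D1_2 D2_2) _ HT)|].
  rewrite (map_fold_ten Hten), map_fold_1_2, map_fold_2_2; reflexivity.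
Qed.

Lemma lstr_src_fold (A B : prod_pre X X) (f : hom A B) :
  map_fold (ten_dfun (mten M) D1_2 (comp_dfun (vT T) D2_2))
    (@pair_fold D D A B (fst f) (snd f)) = cf (m1 Lsrc f).
Proof.
  rewrite (map_fold_ten Hten), map_fold_1_2.
  rewrite (map_fold_comp D2_2 (@pair_fold D D A B (fst f) (snd f)) HT), map_fold_2_2.
  reflexivity.
Qed.

Lemma rstr_src_fold (A B : prod_pre X X) (f : hom A B) :
  map_fold (ten_dfun (mten M) (comp_dfun (vT T) D1_2) D2_2)
    (@pair_fold D D A B (fst f) (snd f)) = cf (m1 Rsrc f).
Proof.
  rewrite (map_fold_ten Hten), map_fold_2_2.
  rewrite (map_fold_comp D1_2 (@pair_fold D D A B (fst f) (snd f)) HT), map_fold_1_2.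
  reflexivity.
Qed.

Section Left.
Context (S : LeftVerticalStrength M T) (it : VInvertible (vlt S)) (κt : Liftable (vlt S)).

Definition can_lt : LNat MX MT :=
  @Build_PsNat (prod_pre X X) X Lsrc Ltgt
    (fun A => lift_cf κt A)
    (fun A B f =>
       @MkCCell D _ _ (comp_cf (m1 Lsrc f) (lift_cf κt B)) (comp_cf (lift_cf κt A) (m1 Ltgt f))
         _ (Can_nd_at κt (lstr_src_fold f) (str_tgt_fold f)))
    (fun A B f =>
       @MkCCell D _ _ (comp_cf (lift_cf κt A) (m1 Ltgt f)) (comp_cf (m1 Lsrc f) (lift_cf κt B))
         _ (Can_ndi_at it κt (lstr_src_fold f) (str_tgt_fold f))).

Definition can_lx : Cells (lx_src can_lt) (lx_tgt MX MT).
Proof.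
  intros A.
  refine (@MkCCell D _ _ (lx_src can_lt A) (lx_tgt MX MT A)
    (lift_lx κa κl κr iμ iη κμ κη it κt A) _).
  unfold lift_lx; lifted_id.
Defined.

Definition can_ly : Cells (ly_src can_lt) (ly_tgt can_lt).
Proof.
  intros ((A, B), C).
  refine (@MkCCell D _ _ (ly_src can_lt (A, B, C)) (ly_tgt can_lt (A, B, C))
    (lift_ly κa κl κr iμ iη κμ κη it κt (A, B, C)) _).
  unfold lift_ly; lifted_id.
Defined.

Definition can_lw : Cells (lw_src can_lt) (lw_tgt can_lt).
Proof.
  intros (A, B).
  refine (@MkCCell D _ _ (lw_src can_lt (A, B)) (lw_tgt can_lt (A, B))
    (lift_lw κa κl κr iμ iη κμ κη it κt (A, B)) _).
  unfold lift_lw; lifted_id.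
Defined.

Definition can_lz : Cells (lz_src can_lt) (lz_tgt MX MT).
Proof.
  intros (A, B).
  refine (@MkCCell D _ _ (lz_src can_lt (A, B)) (lz_tgt MX MT (A, B))
    (lift_lz κa κl κr iμ iη κμ κη it κt (A, B)) _).
  unfold lift_lz; lifted_id.
Defined.

Definition can_lstr : LStrData MX MT := @Build_LStrData X MX MT can_lt can_lx can_ly can_lw can_lz.
End Left.

Section Right.
Context (S : RightVerticalStrength M T) (is : VInvertible (vrs S)) (κs : Liftable (vrs S)).

Definition can_rs : RNat MX MT :=
  @Build_PsNat (prod_pre X X) X Rsrc Ltgt
    (fun A => lift_cf κs A)
    (fun A B f =>
       @MkCCell D _ _ (comp_cf (m1 Rsrc f) (lift_cf κs B)) (comp_cf (lift_cf κs A) (m1 Ltgt f))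
         _ (Can_nd_at κs (rstr_src_fold f) (str_tgt_fold f)))
    (fun A B f =>
       @MkCCell D _ _ (comp_cf (lift_cf κs A) (m1 Ltgt f)) (comp_cf (m1 Rsrc f) (lift_cf κs B))
         _ (Can_ndi_at is κs (rstr_src_fold f) (str_tgt_fold f))).

Definition can_rx : Cells (rx_src can_rs) (rx_tgt MX MT).
Proof.
  intros A.
  refine (@MkCCell D _ _ (rx_src can_rs A) (rx_tgt MX MT A)
    (lift_rx κa κl κr iμ iη κμ κη is κs A) _).
  unfold lift_rx; lifted_id.
Defined.

Definition can_ry : Cells (ry_src can_rs) (ry_tgt can_rs).
Proof.
  intros ((A, B), C).
  refine (@MkCCell D _ _ (ry_src can_rs (A, B, C)) (ry_tgt can_rs (A, B, C))
    (lift_ry κa κl κr iμ iη κμ κη is κs (A, B, C)) _).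
  unfold lift_ry; lifted_id.
Defined.

Definition can_rw : Cells (rw_src can_rs) (rw_tgt can_rs).
Proof.
  intros (A, B).
  refine (@MkCCell D _ _ (rw_src can_rs (A, B)) (rw_tgt can_rs (A, B))
    (lift_rw κa κl κr iμ iη κμ κη is κs (A, B)) _).
  unfold lift_rw; lifted_id.
Defined.

Definition can_rz : Cells (rz_src can_rs) (rz_tgt MX MT).
Proof.
  intros (A, B).
  refine (@MkCCell D _ _ (rz_src can_rs (A, B)) (rz_tgt MX MT (A, B))
    (lift_rz κa κl κr iμ iη κμ κη is κs (A, B)) _).
  unfold lift_rz; lifted_id.
Defined.

Definition can_rstr : RStrData MX MT := @Build_RStrData X MX MT can_rs can_rx can_ry can_rw can_rz.
End Right.
End CanonicalStrength.

(** * Transport of coherence axioms to the horizontal 2-category *)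

Section Transport.
Context {D : DoubleCat}.

(** Compared after packing, because each of the two 2-categories inserts casts along its own proofs
    of [Strict], and packing erases both kinds. *)
Definition Rel {A B A' B' : D} {P Q : @hom (can_ops D) A B} {f g : @hom (hor_ops D) A' B'}
  (s : P ⇒ Q) (s' : f ⇒ g) : Prop := gpk (cc s) = gpk s'.

Lemma rel_glue (A B : D) (P Q Q' R : @hom (can_ops D) A B) (f g g' h : @hom (hor_ops D) A B)
  (s : P ⇒ Q) (t : Q' ⇒ R) (e : Strict Q' Q) (s' : f ⇒ g) (t' : g' ⇒ h) (e' : Strict g' g) :
  Rel s s' -> Rel t t' -> Rel (@glue (can_ops D) A B P Q Q' R s t e)
    (@glue (hor_ops D) A B f g g' h s' t' e').
Proof.
  unfold Rel; intros H H'; rewrite gpk_glue, <- H, <- H'.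
  unfold glue; destruct (@strict _ _ _ e); exact (gpk_v2 _ _).
Qed.

Lemma rel_as2 (A B : D) (P P' Q Q' : @hom (can_ops D) A B) (f f' g g' : @hom (hor_ops D) A B)
  (s : P ⇒ Q) (e1 : Strict P P') (e2 : Strict Q Q') (s' : f ⇒ g) (e1' : Strict f f')
  (e2' : Strict g g') :
  Rel s s' -> Rel (@as2 (can_ops D) A B P Q P' Q' s e1 e2)
    (@as2 (hor_ops D) A B f g f' g' s' e1' e2').
Proof.
  unfold Rel; intros H; etransitivity; [|symmetry; exact (gpk_as2 s' e1' e2')].
  rewrite <- H; unfold as2; destruct (@strict _ _ _ e1), (@strict _ _ _ e2); reflexivity.
Qed.

Lemma rel_h2 (A B C : D) (P P' : @hom (can_ops D) A B) (Q Q' : @hom (can_ops D) B C)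
  (f f' : @hom (hor_ops D) A B) (g g' : @hom (hor_ops D) B C)
  (s : P ⇒ P') (t : Q ⇒ Q') (s' : f ⇒ f') (t' : g ⇒ g') :
  Rel s s' -> Rel t t' -> Rel (@h2 (can_ops D) A B C P P' Q Q' s t)
    (@h2 (hor_ops D) A B C f f' g g' s' t').
Proof.
  unfold Rel; intros H H'; rewrite gpk_h2, <- H, <- H'; exact (gpk_h2 _ _).
Qed.

Lemma rel_i2 (A B : D) (P : @hom (can_ops D) A B) (f : @hom (hor_ops D) A B) :
  fh P = f -> Rel (@i2 (can_ops D) A B P) (@i2 (hor_ops D) A B f).
Proof. intros <-; reflexivity. Qed.

Lemma rel_eq2 (A B : D) (P Q P' Q' : @hom (can_ops D) A B) (f g f' g' : @hom (hor_ops D) A B)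
  (s : P ⇒ Q) (t : P' ⇒ Q') (s' : f ⇒ g) (t' : f' ⇒ g') :
  s ≈ t -> Rel s s' -> Rel t t' -> s' ≈ t'.
Proof.
  intros (e & e' & <-) H H'; apply gpk_eq2; unfold Rel in H, H'; rewrite <- H, <- H'.
  destruct e, e'; reflexivity.
Qed.
End Transport.

(** Recursion on the common syntax of the two readings of an axiom. The leaves are structure cells,
    which on companions are by construction the cells of H(D), so they agree by conversion. The
    compositors of [lten] and [rten] hide an [as2] and get cases of their own. *)
Ltac rel :=
  lazymatch goal with
  | |- Rel (glue _ _) (glue _ _) => apply rel_glue; rel
  | |- Rel (h2 _ _) (h2 _ _) => apply rel_h2; rel
  | |- Rel (i2 _) (i2 _) => apply rel_i2; reflexivity
  | |- Rel (as2 _) (as2 _) => apply rel_as2; rel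
  | |- Rel (ph (lten _ _) _ _) _ => apply rel_as2; reflexivity
  | |- Rel (phi (lten _ _) _ _) _ => apply rel_as2; reflexivity
  | |- Rel (ph (rten _ _) _ _) _ => apply rel_as2; reflexivity
  | |- Rel (phi (rten _ _) _ _) _ => apply rel_as2; reflexivity
  | |- _ => reflexivity
  end.

Ltac transport H :=
  intros; eapply rel_eq2; [apply H| |];
  unfold im20, im21, im12, im22, im23, im32, ph3, phi3, al_n1, al_n1i, al_n2, al_n2i, al_n3, al_n3i, la_n, ro_n,
    tt_n1i, tt_n2, tt_n2i, ss_n2i, ss_n1, ss_n1i; rel.

Section LiftAxioms.
Context {D : DoubleCat} (M : MonoidalDoubleCat D) (T : VerticalDoubleMonad D)
  (κa : Liftable (mass M)) (κl : Liftable (mlun M)) (κr : Liftable (mrun M))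
  (iμ : VInvertible (vmu T)) (iη : VInvertible (veta T))
  (κμ : Liftable (vmu T)) (κη : Liftable (veta T)).

Lemma lift_monoidal_axioms : monoidal_axioms (hor_mon (lift_monoidal κa κl κr)).
Proof.
  assert (H := thin_monoidal (@can_thin D) (can_mon κa κl κr)).
  split; red.
  - transport (mon_cocycle H).
  - transport (mon_left H).
  - transport (mon_right H).
Qed.

Lemma lift_pseudomonad_axioms : pseudomonad_axioms (hor_monad (lift_monad iμ iη κμ κη)).
Proof.
  assert (H := thin_pseudomonad (@can_thin D) (can_monad iμ iη κμ κη)).
  split.
  - transport (pm_assoc H).
  - transport (pm_unit H).
Qed.

Lemma lift_left_strength_axioms (S : LeftVerticalStrength M T) (it : VInvertible (vlt S))
  (κt : Liftable (vlt S)) :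
  left_strength_axioms (hor_lstr (lift_left_strength κa κl κr iμ iη κμ κη it κt)).
Proof.
  assert (H := thin_left_strength (@can_thin D) (can_lstr κa κl κr iμ iη κμ κη it κt)).
  split.
  - transport (ls_mid H).
  - transport (ls_left H).
  - transport (ls_pent H).
  - transport (ls_monad_left H).
  - transport (ls_monad_right H).
  - transport (ls_monad_assoc H).
  - transport (ls_unit_eta H).
  - transport (ls_unit_mu H).
  - transport (ls_assoc_eta H).
  - transport (ls_assoc_mu H).
Qed.

Lemma lift_right_strength_axioms (S : RightVerticalStrength M T) (is : VInvertible (vrs S))
  (κs : Liftable (vrs S)) :
  right_strength_axioms (hor_rstr (lift_right_strength κa κl κr iμ iη κμ κη is κs)).
Proof.
  assert (H := thin_right_strength (@can_thin D) (can_rstr κa κl κr iμ iη κμ κη is κs)).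
  split.
  - transport (rs_mid H).
  - transport (rs_right H).
  - transport (rs_pent H).
  - transport (rs_monad_left H).
  - transport (rs_monad_right H).
  - transport (rs_monad_assoc H).
  - transport (rs_unit_eta H).
  - transport (rs_unit_mu H).
  - transport (rs_assoc_eta H).
  - transport (rs_assoc_mu H).
Qed.
End LiftAxioms.

(** * Lifted modifications *)

Lemma globular_functor (D : DblOps) (E : DoubleCat) (F : PseudoDoubleFunctor D E) :
  globular_action F.
Proof. exact (Fp_gpk (pdf_laws F)). Qed.

Lemma globular_fst (D E : DblOps) : globular_action (fst_dfun D E).
Proof. intros A B f g s; reflexivity. Qed.

Lemma globular_snd (D E : DblOps) : globular_action (snd_dfun D E).
Proof. intros A B f g s; reflexivity. Qed.

Lemma globular_id (D : DblOps) : globular_action (id_dfun D).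
Proof. intros A B f g s; reflexivity. Qed.

Lemma globular_one (D : DblOps) : globular_action (one_dfun D).
Proof. intros A B f g s; reflexivity. Qed.

Ltac globular := first
  [ apply globular_functor | apply globular_fst | apply globular_snd | apply globular_id
  | apply globular_one | apply globular_comp; globular | apply globular_pair; globular ].

Definition ten_lifted {X : DblOps} {D : DoubleCat} (ten : PseudoDoubleFunctor (prod_dbl D D) D)
  {F G F' G' : DMap X D} {α : HNat F G} {β : HNat F' G'} (a : Lifted α) (b : Lifted β) :
  Lifted (ten_hnat ten α β) :=
  post_lifted (pdf_laws ten) (pair_lifted a b).

Section LiftMonoidal.
Context {D : DoubleCat} (M : MonoidalDoubleCat D)
  (κa : Liftable (mass M)) (κl : Liftable (mlun M)) (κr : Liftable (mrun M)).

Local Notation C := (lift_mon_core κa κl κr).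
Local Notation La := (lift_lifted (mass_inv M) κa).
Local Notation Ll := (lift_lifted (mlun_inv M) κl).
Local Notation Lr := (lift_lifted (mrun_inv M) κr).
Local Notation "a ⊠ b" := (ten_lifted (mten M) a b) (at level 39, left associativity).
Local Notation "1_[ F ]" := (id_lifted F).

Local Notation "F ⊠d G" := (ten_dmap (mten M) F G) (at level 39, left associativity).
Local Notation Id X := (unt_dmap (munt M) X).

Definition ass_lifted {Y : DblOps} (F G H : DMap Y D) : Lifted (hass_at C F G H) :=
  pre_lifted La (pair_dmap (pair_dmap F G) H).
Definition lun_lifted {Y : DblOps} (F : DMap Y D) : Lifted (hlun_at C F) := pre_lifted Ll F.
Definition run_lifted {Y : DblOps} (F : DMap Y D) : Lifted (hrun_at C F) := pre_lifted Lr F.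

Definition pent_src_lifted : Lifted (hpent_src C) :=
  comp_lifted
    (comp_lifted (ass_lifted d1_4 d2_4 d3_4 ⊠ 1_[d4_4]) (ass_lifted d1_4 (d2_4 ⊠d d3_4) d4_4))
    (1_[d1_4] ⊠ ass_lifted d2_4 d3_4 d4_4).
Definition pent_tgt_lifted : Lifted (hpent_tgt C) :=
  comp_lifted (ass_lifted (d1_4 ⊠d d2_4) d3_4 d4_4) (ass_lifted d1_4 d2_4 (d3_4 ⊠d d4_4)).

Lemma lift_pent_mod : is_invertible_hmod (lift_pent κa κl κr).
Proof.
  apply (lifted_modification (a := pent_src_lifted) (b := pent_tgt_lifted)).
  - intros (((A, B), E), G) (((A', B'), E'), G') (((f, g), h), k).
    (* [lift_id] of u = v points from the companion of v to that of u, so the modification runs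
       opposite to the vertical equation. *)
    apply pk_sqeq, sqeq_sym; exact (m_pent_sq M f g h k).
  - intros (((A, B), E), G); unfold lift_pent; lifted_id.
Qed.

Definition mid_src_lifted : Lifted (hmid_src C) :=
  comp_lifted (ass_lifted d1_2 (Id _) d2_2) (1_[d1_2] ⊠ lun_lifted d2_2).
Definition mid_tgt_lifted : Lifted (hmid_tgt C) := run_lifted d1_2 ⊠ 1_[d2_2].

Lemma lift_mid_mod : is_invertible_hmod (lift_mid κa κl κr).
Proof.
  apply (lifted_modification (a := mid_src_lifted) (b := mid_tgt_lifted)).
  - intros (A, B) (A', B') (f, g); apply pk_sqeq, sqeq_sym; exact (m_mid_sq M f g).
  - intros (A, B); unfold lift_mid; lifted_id.
Qed.

Definition left_src_lifted : Lifted (hleft_src C) := lun_lifted d1_2 ⊠ 1_[d2_2].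
Definition left_tgt_lifted : Lifted (hleft_tgt C) :=
  comp_lifted (ass_lifted (Id _) d1_2 d2_2) (lun_lifted (d1_2 ⊠d d2_2)).

Lemma lift_lft_mod : is_invertible_hmod (lift_lft κa κl κr).
Proof.
  apply (lifted_modification (a := left_src_lifted) (b := left_tgt_lifted)).
  - intros (A, B) (A', B') (f, g); apply pk_sqeq, sqeq_sym; exact (m_lft_sq M f g).
  - intros (A, B); unfold lift_lft; lifted_id.
Qed.

Definition right_src_lifted : Lifted (hright_src C) := run_lifted (d1_2 ⊠d d2_2).
Definition right_tgt_lifted : Lifted (hright_tgt C) :=
  comp_lifted (ass_lifted d1_2 d2_2 (Id _)) (1_[d1_2] ⊠ run_lifted d2_2).

Lemma lift_rgt_mod : is_invertible_hmod (lift_rgt κa κl κr).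
Proof.
  apply (lifted_modification (a := right_src_lifted) (b := right_tgt_lifted)).
  - intros (A, B) (A', B') (f, g); apply pk_sqeq, sqeq_sym; exact (m_rgt_sq M f g).
  - intros (A, B); unfold lift_rgt; lifted_id.
Qed.

(** A horizontal equivalence needs 1h-cells back, for instance companions of the inverses of the
    1v-components. [Liftable] supplies companions in the forward direction, so the equivalences
    enter as premises. *)
Lemma lift_horizontally_monoidal :
  is_horizontal_equivalence (hass C) -> is_horizontal_equivalence (hlun C) ->
  is_horizontal_equivalence (hrun C) -> is_horizontally_monoidal (lift_monoidal κa κl κr).
Proof.
  intros ea el er; split; try assumption.
  - apply pdf_laws.
  - apply pdf_laws.
  - apply lift_horizontal; globular.
  - apply lift_horizontal; globular.
  - apply lift_horizontal; globular.
  - apply lift_pent_mod.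
  - apply lift_mid_mod.
  - apply lift_lft_mod.
  - apply lift_rgt_mod.
  - apply lift_monoidal_axioms.
Qed.
End LiftMonoidal.

Section LiftMonadStrength.
Context {D : DoubleCat} (M : MonoidalDoubleCat D) (T : VerticalDoubleMonad D)
  (κa : Liftable (mass M)) (κl : Liftable (mlun M)) (κr : Liftable (mrun M))
  (iμ : VInvertible (vmu T)) (iη : VInvertible (veta T))
  (κμ : Liftable (vmu T)) (κη : Liftable (veta T)).

Local Notation "a ⊠ b" := (ten_lifted (mten M) a b) (at level 39, left associativity).
Local Notation "1_[ F ]" := (id_lifted F).
Local Notation "'T∘' a" := (post_lifted (pdf_laws (vT T)) a) (at level 38).
Local Notation CT := (lift_monad_core iμ iη κμ κη).
Local Notation Mh := (lift_monoidal κa κl κr).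
Local Notation Th := (lift_monad iμ iη κμ κη).

Local Notation "F ⊠d G" := (ten_dmap (mten M) F G) (at level 39, left associativity).
Local Notation Id X := (unt_dmap (munt M) X).
Local Notation TT := (vT T : DFun D D).
Local Notation La F G H := (ass_lifted κa κl κr F G H).

Definition mu_lifted : Lifted (hmu CT) := lift_lifted iμ κμ.
Definition eta_lifted : Lifted (heta CT) := lift_lifted iη κη.
Definition mu_lifted_at {Y : DblOps} (K : DMap Y D) : Lifted (pre_hnat (hmu CT) K) :=
  pre_lifted mu_lifted K.
Definition eta_lifted_at {Y : DblOps} (K : DMap Y D) : Lifted (pre_hnat (heta CT) K) :=
  pre_lifted eta_lifted K.

Local Notation Lα := (lift_lifted (mass_inv M) κa : Lifted (hass Mh)).
Local Notation Lλ := (lift_lifted (mlun_inv M) κl : Lifted (hlun Mh)).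
Local Notation Lρ := (lift_lifted (mrun_inv M) κr : Lifted (hrun Mh)).

Lemma lift_a_mod : is_invertible_hmod (lift_a iμ iη κμ κη).
Proof.
  apply (lifted_modification (a := comp_lifted (T∘ mu_lifted) mu_lifted : Lifted (hmassoc_src CT))
    (b := comp_lifted (mu_lifted_at TT) mu_lifted : Lifted (hmassoc_tgt CT))).
  - intros A B f; apply pk_sqeq, sqeq_sym; exact (vm_assoc_sq T f).
  - intros A; unfold lift_a; lifted_id.
Qed.

Lemma lift_r_mod : is_invertible_hmod (lift_r iμ iη κμ κη).
Proof.
  apply (lifted_modification (a := comp_lifted (eta_lifted_at TT) mu_lifted : Lifted (hmright_src CT))
    (b := 1_[TT] : Lifted (hmunit_tgt CT))).
  - intros A B f; apply pk_sqeq, sqeq_sym; exact (vm_right_sq T f).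
  - intros A; unfold lift_r; lifted_id.
Qed.

Lemma lift_l_mod : is_invertible_hmod (lift_l iμ iη κμ κη).
Proof.
  apply (lifted_modification (a := comp_lifted (T∘ eta_lifted) mu_lifted : Lifted (hmleft_src CT))
    (b := 1_[TT] : Lifted (hmunit_tgt CT))).
  - intros A B f; apply pk_sqeq, sqeq_sym; exact (vm_left_sq T f).
  - intros A; unfold lift_l; lifted_id.
Qed.

Lemma lift_horizontal_monad : is_horizontal_double_monad Th.
Proof.
  split.
  - apply pdf_laws.
  - apply lift_horizontal; globular.
  - apply lift_horizontal; globular.
  - apply lift_a_mod.
  - apply lift_r_mod.
  - apply lift_l_mod.
  - apply lift_pseudomonad_axioms.
Qed.

Section Left.
Context (S : LeftVerticalStrength M T) (it : VInvertible (vlt S)) (κt : Liftable (vlt S)).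
Local Notation th := (lift_lt κa κl κr iμ iη κμ κη it κt).

Definition lt_lifted : Lifted th := lift_lifted it κt.
Definition lt_lifted_at {Y : DblOps} (F G : DMap Y D) : Lifted (ht_at th F G) :=
  pre_lifted lt_lifted (pair_dmap F G).

Lemma lift_lx_mod : is_invertible_hmod (lift_lx κa κl κr iμ iη κμ κη it κt).
Proof.
  apply (lifted_modification (a := comp_lifted (lt_lifted_at (Id D) (id_dmap D)) (T∘ Lλ) : Lifted (hlx_src th))
    (b := lun_lifted κa κl κr (comp_dmap TT (id_dmap D)) : Lifted (hlx_tgt Mh Th))).
  - intros A B f; apply pk_sqeq, sqeq_sym; exact (vl_x_sq S f).
  - intros A; unfold lift_lx; lifted_id.
Qed.

Lemma lift_ly_mod : is_invertible_hmod (lift_ly κa κl κr iμ iη κμ κη it κt).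
Proof.
  apply (lifted_modification (a := comp_lifted (lt_lifted_at (d1_3 ⊠d d2_3) d3_3) (T∘ Lα) : Lifted (hly_src th))
    (b := comp_lifted
            (comp_lifted (La d1_3 d2_3 (comp_dmap TT d3_3)) (1_[d1_3] ⊠ lt_lifted_at d2_3 d3_3))
            (lt_lifted_at d1_3 (d2_3 ⊠d d3_3)) : Lifted (hly_tgt th))).
  - intros ((A, B), E) ((A', B'), E') ((f, g), h).
    apply pk_sqeq, sqeq_sym; exact (vl_y_sq S f g h).
  - intros ((A, B), E); unfold lift_ly; lifted_id.
Qed.

Lemma lift_lw_mod : is_invertible_hmod (lift_lw κa κl κr iμ iη κμ κη it κt).
Proof.
  apply (lifted_modification
    (a := comp_lifted (comp_lifted (lt_lifted_at d1_2 (comp_dmap TT d2_2)) (T∘ lt_lifted))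
            (mu_lifted_at (d1_2 ⊠d d2_2))
       : Lifted (hlw_src th))
    (b := comp_lifted (1_[d1_2] ⊠ mu_lifted_at d2_2) lt_lifted : Lifted (hlw_tgt th))).
  - intros (A, B) (A', B') (f, g); apply pk_sqeq, sqeq_sym; exact (vl_w_sq S f g).
  - intros (A, B); unfold lift_lw; lifted_id.
Qed.

Lemma lift_lz_mod : is_invertible_hmod (lift_lz κa κl κr iμ iη κμ κη it κt).
Proof.
  apply (lifted_modification
    (a := comp_lifted (1_[d1_2] ⊠ eta_lifted_at d2_2) lt_lifted : Lifted (hlz_src th))
    (b := eta_lifted_at (d1_2 ⊠d d2_2) : Lifted (hlz_tgt Mh Th))).
  - intros (A, B) (A', B') (f, g); apply pk_sqeq, sqeq_sym; exact (vl_z_sq S f g).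
  - intros (A, B); unfold lift_lz; lifted_id.
Qed.

Lemma lift_left_horizontal :
  is_left_horizontal_strength (lift_left_strength κa κl κr iμ iη κμ κη it κt).
Proof.
  split.
  - apply lift_horizontal; globular.
  - apply lift_lx_mod.
  - apply lift_ly_mod.
  - apply lift_lw_mod.
  - apply lift_lz_mod.
  - apply lift_left_strength_axioms.
Qed.
End Left.

Section Right.
Context (S : RightVerticalStrength M T) (is : VInvertible (vrs S)) (κs : Liftable (vrs S)).
Local Notation sh := (lift_rs κa κl κr iμ iη κμ κη is κs).

Definition rs_lifted : Lifted sh := lift_lifted is κs.
Definition rs_lifted_at {Y : DblOps} (F G : DMap Y D) : Lifted (hs_at sh F G) :=
  pre_lifted rs_lifted (pair_dmap F G).

Lemma lift_rx_mod : is_invertible_hmod (lift_rx κa κl κr iμ iη κμ κη is κs).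
Proof.
  apply (lifted_modification (a := comp_lifted (rs_lifted_at (id_dmap D) (Id D)) (T∘ Lρ) : Lifted (hrx_src sh))
    (b := run_lifted κa κl κr (comp_dmap TT (id_dmap D)) : Lifted (hrx_tgt Mh Th))).
  - intros A B f; apply pk_sqeq, sqeq_sym; exact (vr_x_sq S f).
  - intros A; unfold lift_rx; lifted_id.
Qed.

Lemma lift_ry_mod : is_invertible_hmod (lift_ry κa κl κr iμ iη κμ κη is κs).
Proof.
  apply (lifted_modification
    (a := comp_lifted
            (comp_lifted (rs_lifted_at d1_3 d2_3 ⊠ 1_[d3_3]) (rs_lifted_at (d1_3 ⊠d d2_3) d3_3))
            (T∘ Lα)
       : Lifted (hry_src sh))
    (b := comp_lifted (La (comp_dmap TT d1_3) d2_3 d3_3) (rs_lifted_at d1_3 (d2_3 ⊠d d3_3)) : Lifted (hry_tgt sh))).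
  - intros ((A, B), E) ((A', B'), E') ((f, g), h).
    apply pk_sqeq, sqeq_sym; exact (vr_y_sq S f g h).
  - intros ((A, B), E); unfold lift_ry; lifted_id.
Qed.

Lemma lift_rw_mod : is_invertible_hmod (lift_rw κa κl κr iμ iη κμ κη is κs).
Proof.
  apply (lifted_modification
    (a := comp_lifted (comp_lifted (rs_lifted_at (comp_dmap TT d1_2) d2_2) (T∘ rs_lifted))
            (mu_lifted_at (d1_2 ⊠d d2_2))
       : Lifted (hrw_src sh))
    (b := comp_lifted (mu_lifted_at d1_2 ⊠ 1_[d2_2]) rs_lifted : Lifted (hrw_tgt sh))).
  - intros (A, B) (A', B') (f, g); apply pk_sqeq, sqeq_sym; exact (vr_w_sq S f g).
  - intros (A, B); unfold lift_rw; lifted_id.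
Qed.

Lemma lift_rz_mod : is_invertible_hmod (lift_rz κa κl κr iμ iη κμ κη is κs).
Proof.
  apply (lifted_modification
    (a := comp_lifted (eta_lifted_at d1_2 ⊠ 1_[d2_2]) rs_lifted : Lifted (hrz_src sh))
    (b := eta_lifted_at (d1_2 ⊠d d2_2) : Lifted (hrz_tgt Mh Th))).
  - intros (A, B) (A', B') (f, g); apply pk_sqeq, sqeq_sym; exact (vr_z_sq S f g).
  - intros (A, B); unfold lift_rz; lifted_id.
Qed.

Lemma lift_right_horizontal :
  is_right_horizontal_strength (lift_right_strength κa κl κr iμ iη κμ κη is κs).
Proof.
  split.
  - apply lift_horizontal; globular.
  - apply lift_rx_mod.
  - apply lift_ry_mod.
  - apply lift_rw_mod.
  - apply lift_rz_mod.
  - apply lift_right_strength_axioms.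
Qed.
End Right.
End LiftMonadStrength.

(** * Passage to horizontal 2-categories *)

Section Horizontal.
Context {D : DoubleCat}.
Local Notation K := (hor_ops D).

(* The vertical compositions of [H(D × D)] and [H(D) × H(D)] differ by casts. *)
Lemma psfun_prod (F : DFun (prod_dbl D D) D) :
  is_double_functor F -> @is_psfun (prod_two K K) K F.
Proof.
  intros [H _ _ _ _ _]; destruct H; split; try assumption.
  intros A B f g h s t.
  assert (e : @v2 (prod_two K K) A B f g h s t = @v2 (hor_ops (prod_dbl D D)) A B f g h s t).
  { destruct A as [A A'], B as [B B'], f as [f f'], g as [g g'], h as [h h'], s as [s s'],
      t as [t t'].
    refine (@pk_inj (prod_dbl D D) (A, A') (B, B') (A, A') (B, B') (f, f')
      (vid A, vid A') (vid B, vid B') (h, h') _ _ _).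
    etransitivity; [|symmetry; exact (pk_hor_v2 (D := prod_dbl D D) (A := (A, A'))
      (B := (B, B')) (f := (f, f')) (g := (g, g')) (h := (h, h')) (s, s') (t, t'))].
    etransitivity; [|exact (@pk_v (prod_dbl D D) (A, A') (B, B') (A, A') (B, B') (A, A') (B, B')
      (f, f') (vid A, vid A') (vid B, vid B') (g, g') (vid A, vid A') (vid B, vid B') (h, h')
      (s, s') (t, t'))].
    exact (pk_pair (pk_cast _ _ _ _ _) (pk_cast _ _ _ _ _)). }
  rewrite e; apply f2_v2.
Qed.

Lemma psfun_one (F : DFun one_dbl D) : is_double_functor F -> @is_psfun one_two K F.
Proof.
  intros [H _ _ _ _ _]; destruct H; split; assumption.
Qed.

Lemma hor_monoidal (M : HMonData D) :
  is_horizontally_monoidal M -> is_monoidal_bicategory (hor_mon M).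
Proof.
  intros [Ht Hu [Ha _ _ _] [Hl _ _ _] [Hr _ _ _] ea el er [[pm _] pi] [[mm _] mi]
    [[lm _] li] [[rm _] ri] ax].
  split.
  - apply hor_laws.
  - exact (psfun_prod Ht).
  - exact (psfun_one Hu).
  (* The record is rebuilt over a different source 2-category. Its fields agree by conversion, since
     none of them mentions vertical composition in the source, where the two products differ. *)
  - destruct Ha; split; assumption.
  - exact Hl.
  - exact Hr.
  - intros A B C; exact (ea (A, B, C)).
  - exact el.
  - exact er.
  - exact (conj pm pi).
  - exact (conj mm mi).
  - exact (conj lm li).
  - exact (conj rm ri).
  - exact ax.
Qed.

Lemma hor_pseudomonad (T : HMonadData D) :
  is_horizontal_double_monad T -> is_pseudomonad (hor_monad T).
Proof.
  intros [Hf [Hμ _ _ _] [Hη _ _ _] [[am _] ai] [[rm _] ri] [[lm _] li] ax].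
  split.
  - apply hor_laws.
  - exact (df_hor Hf).
  - exact Hμ.
  - exact Hη.
  - exact (conj am ai).
  - exact (conj rm ri).
  - exact (conj lm li).
  - exact ax.
Qed.

Lemma hor_left_strength (M : HMonData D) (T : HMonadData D) (S : HLStrData M T) :
  is_left_horizontal_strength S -> is_left_strength (hor_lstr S).
Proof.
  intros [[Ht _ _ _] [[xm _] xi] [[ym _] yi] [[wm _] wi] [[zm _] zi] ax].
  split.
  - destruct Ht; split; assumption.
  - exact (conj xm xi).
  - exact (conj ym yi).
  - exact (conj wm wi).
  - exact (conj zm zi).
  - exact ax.
Qed.

Lemma hor_right_strength (M : HMonData D) (T : HMonadData D) (S : HRStrData M T) :
  is_right_horizontal_strength S -> is_right_strength (hor_rstr S).
Proof.
  intros [[Hs _ _ _] [[xm _] xi] [[ym _] yi] [[wm _] wi] [[zm _] zi] ax].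
  split.
  - destruct Hs; split; assumption.
  - exact (conj xm xi).
  - exact (conj ym yi).
  - exact (conj wm wi).
  - exact (conj zm zi).
  - exact ax.
Qed.
End Horizontal.

Theorem theorem10p13 (D : DoubleCat) (M : MonoidalDoubleCat D)
  (T : VerticalDoubleMonad D)
  (κα : Liftable (mass M)) (κλ : Liftable (mlun M)) (κρ : Liftable (mrun M))
  (iμ : VInvertible (vmu T)) (iη : VInvertible (veta T))
  (κμ : Liftable (vmu T)) (κη : Liftable (veta T)) :
  let Mh := lift_monoidal κα κλ κρ in
  let Th := lift_monad iμ iη κμ κη in
  (is_horizontal_equivalence (hass Mh) ->
   is_horizontal_equivalence (hlun Mh) ->
   is_horizontal_equivalence (hrun Mh) ->
   is_horizontally_monoidal Mh /\ is_monoidal_bicategory (hor_mon Mh)) /\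
  (is_horizontal_double_monad Th /\ is_pseudomonad (hor_monad Th)) /\
  (forall (t : LeftVerticalStrength M T) (it : VInvertible (vlt t))
     (κt : Liftable (vlt t)),
     let th := lift_left_strength κα κλ κρ iμ iη κμ κη it κt in
     is_left_horizontal_strength th /\ is_left_strength (hor_lstr th)) /\
  (forall (s : RightVerticalStrength M T) (is : VInvertible (vrs s))
     (κs : Liftable (vrs s)),
     let sh := lift_right_strength κα κλ κρ iμ iη κμ κη is κs in
     is_right_horizontal_strength sh /\ is_right_strength (hor_rstr sh)).
Proof.
  intros Mh Th; split; [|split; [|split]].
  - intros ea el er.
    assert (H := lift_horizontally_monoidal ea el er).
    exact (conj H (hor_monoidal H)).
  - assert (H := lift_horizontal_monad iμ iη κμ κη).
    exact (conj H (hor_pseudomonad H)).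
  - intros t it κt th.
    assert (H := lift_left_horizontal κα κλ κρ iμ iη κμ κη it κt).
    exact (conj H (hor_left_strength H)).
  - intros s is κs sh.
    assert (H := lift_right_horizontal κα κλ κρ iμ iη κμ κη is κs).
    exact (conj H (hor_right_strength H)).
Qed.
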